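(* Let $d\ge 3$, let $E\subset 2\mathbb{Z}_+$ and $O\subset 2\mathbb{Z}_++1$ be infinite sets, let $j\in\{1,\ldots,d-1\}$, and for each $k\in E\cup O$ let $A_k$ be a set with ${}_{j}\tau_k^{d-1}\subset A_k\subset\tau_k^{d-1}$; put $A_k^c:=\tau_k^{d-1}\setminus A_k$. Then any continuous kernel $$K(\xi,\zeta)=\sum_{k\in E\cup O}\ \sum_{\alpha\in A_k}d_\alpha Y_\alpha(\xi)\overline{Y_\alpha(\zeta)},\qquad d_\alpha>0,\quad \xi,\zeta\in\mathbb{S}^{d-1},$$ is strictly positive definite on $\mathbb{S}^{d-1}$ when $$\lim_{k\to\infty,\ k\in O}\frac{|A_k^c|}{k^{(d-j-1)/2}}=\lim_{k\to\infty,\ k\in E}\frac{|A_k^c|}{k^{(d-j-1)/2}}=0.$$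
   Context: $\mathbb{Z}_+=\{0,1,2,\ldots\}$, and $\mathbb{S}^{d-1}$ is the unit sphere in $\mathbb{R}^d$. A kernel $K$ on $\mathbb{S}^{d-1}$ is strictly positive definite if for every finite set $\Xi\subset\mathbb{S}^{d-1}$ of distinct points the matrix $(K(\xi,\zeta))_{\xi,\zeta\in\Xi}$ is Hermitian positive definite. The series is understood to converge pointwise. Index sets: $\tau_k^{d-1}:=\{\alpha=(\alpha_1,\ldots,\alpha_{d-1})\in\mathbb{Z}^{d-1}:|\alpha_1|\le\alpha_2\le\cdots\le\alpha_{d-1}=k\}$ and ${}_j\tau_k^{d-1}:=\{\alpha\in\tau_k^{d-1}:\alpha_j=0\}$. Polar coordinates $(\theta_1,\ldots,\theta_{d-1})$ of $\xi\in\mathbb{S}^{d-1}$: $\xi_1=\cos\theta_{d-1}$, $\xi_2=\sin\theta_{d-1}\cos\theta_{d-2}$, ..., $\xi_{d-1}=\sin\theta_{d-1}\cdots\sin\theta_2\cos\theta_1$, $\xi_d=\sin\theta_{d-1}\cdots\sin\theta_2\sin\theta_1$, with $\theta_1\in[0,2\pi)$ and $\theta_i\in[0,\pi]$ for $i\ge2$. Spherical harmonics: for $\alpha\in\tau_k^{d-1}$, $$Y_\alpha(\xi)=\frac{1}{\sqrt{2\pi}}e^{i\alpha_1\theta_1}\prod_{i=2}^{d-1}{}_{i}\tilde{\mathsf P}_{\alpha_i}^{\alpha_{i-1}}(\theta_i),$$ $${}_{i}\tilde{\mathsf P}_{L}^{\ell}(\theta)=\left(\frac{\pi\,\Gamma(i/2)}{\Gamma((i+1)/2)}\right)^{1/2}{}_{i}c_L^{\ell}\,(\sin\theta)^{-(i-2)/2}\,\mathsf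 P_{L+(i-2)/2}^{-(\ell+(i-2)/2)}(\cos\theta),\qquad {}_{i}c_L^{\ell}=\left(\frac{2L+i-1}{2}\,\frac{(L+\ell+i-2)!}{(L-\ell)!}\right)^{1/2},$$ extended continuously to $\theta\in\{0,\pi\}$. Here $\mathsf P_\nu^\mu$ is the associated Legendre (Ferrers) function on $(-1,1)$, $\mathsf P_\nu^\mu(x)=\left(\frac{1+x}{1-x}\right)^{\mu/2}\mathbf{F}\left(\nu+1,-\nu;1-\mu;\frac{1-x}{2}\right)$, with $\mathbf F(a,b;c;z)=\sum_{n\ge0}\frac{(a)_n(b)_n}{\Gamma(c+n)\,n!}z^n$. Up to a multiplicative constant depending only on $d$, the functions $Y_\alpha$, $\alpha\in\tau_k^{d-1}$, form an orthonormal basis of the space of spherical harmonics of degree $k$ on $\mathbb{S}^{d-1}$. *)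

(* Defs.v *)
From HB Require Import structures.
From mathcomp Require Import all_boot all_order all_algebra spectral complex.
From mathcomp Require Import finmap zify.
From mathcomp Require Import all_classical all_reals all_analysis.

Set Implicit Arguments.
Unset Strict Implicit.
Unset Printing Implicit Defensive.

Import Order.TTheory GRing.Theory Num.Theory.
Import numFieldNormedType.Exports.

Local Open Scope classical_set_scope.
Local Open Scope ring_scope.
Local Open Scope complex_scope.
Local Open Scope sesquilinear_scope.

(* The topology on R[i] is the one of the norm `|z|; the library declares it
   only on variables of type numClosedFieldType. *)
HB.instance Definition _ (R : realType) := NormedModule.copy R[i] R[i]^o.

(* 1-based coordinates, used for multi-indices and for tuples of angles. *)
Definition coord1 (V : nmodType) (s : seq V) (i : nat) : V := s`_i.-1.
Notation "s .[# i ]" := (coord1 s i)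
  (at level 1, left associativity, i at level 200,
   format "s .[#  i ]") : ring_scope.

Section MultiIndices.
Variables (d k : nat).

Definition tau : set (d.-1.-tuple int) :=
  [set a | [/\ `|a.[# 1]| <= a.[# 2],
               (forall i, (2 <= i < d.-1)%N -> a.[# i] <= a.[# i.+1])
             & a.[# d.-1] = k%:Z]].

Definition tau_at (j : nat) : set (d.-1.-tuple int) :=
  [set a | tau a /\ a.[# j] = 0].

(* The sums over subsets of tau and their cardinals below are therefore the
   genuine ones. *)
Lemma finite_tau : (2 < d)%N -> finite_set tau.
Proof.
move=> d_gt2.
pose f (t : d.-1.-tuple 'I_(k + k).+1) : d.-1.-tuple int :=
  [tuple (tnth t i : nat)%:Z - k%:Z | i < d.-1].
apply: (@sub_finite_set _ _ (f @` setT)); last first.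
  by apply: finite_image; exact: finite_finset.
move=> a [a12 amono atop].
have step i : (2 <= d.-1 - i)%N -> a.[# d.-1 - i] <= k%:Z.
  elim: i => [|i IH] hi; first by rewrite subn0 atop.
  have hlt : (i < d.-1)%N by move: hi; lia.
  have := amono (d.-1 - i.+1)%N.
  rewrite subnSK// => mono.
  apply: (le_trans (mono _)); first by lia.
  by apply: IH; lia.
have up i : (2 <= i < d)%N -> a.[# i] <= k%:Z.
  move=> hi; have := step (d.-1 - i)%N.
  by rewrite subKn; [apply; lia | lia].
have low i : (2 <= i < d)%N -> 0 <= a.[# i].
  elim: i => [//|i IH] hi; case: (ltnP 1 i) => h1.
    by apply: (le_trans (IH _)); [lia | apply: amono; lia].
  have -> : i = 1%N by lia.
  exact: le_trans (normr_ge0 _) a12.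
have all_in i : (i < d.-1)%N -> `|a`_i| <= k%:Z.
  move=> hi; case: i hi => [|i] hi.
    apply: (le_trans a12); apply: up; lia.
  have [h1 h2] := (low i.+2, up i.+2).
  rewrite ger0_norm; [apply: h2|apply: h1]; lia.
exists [tuple inord (absz (tnth a i + k%:Z)%R) | i < d.-1] => //.
apply: eq_from_tnth => i; rewrite !tnth_mktuple.
have := all_in i (ltn_ord i); rewrite -(tnth_nth 0) ler_norml.
by move: (tnth a i) => z /andP[zlo zhi]; rewrite inordK; lia.
Qed.

End MultiIndices.
Arguments tau d k : clear implicits.
Arguments tau_at d k j : clear implicits.

Section SpecialFunctions.
Variable R : realType.
Implicit Types (a b c x z nu mu : R).

Definition pochhammer a (n : nat) : R := \prod_(m < n) (a + m%:R).

(* The entire function 1 / Gamma, by Gauss's formula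
   1 / Gamma(x) = lim_n x (x + 1) ... (x + n) / (n! n^x);
   it vanishes at the poles 0, -1, -2, ... of Gamma. *)
Definition rGamma x : R :=
  limn (fun n : nat => pochhammer x n.+1 / (n`!%:R * n%:R `^ x)).

Definition Gamma x : R := (rGamma x)^-1.

(* Regularised by 1 / Gamma(c + n), hence meaningful for c = 0, -1, -2, ... ,
   which occurs for negative orders l when i = 2. *)
Definition hyperF a b c z : R :=
  limn (series (fun n : nat =>
    pochhammer a n * pochhammer b n * rGamma (c + n%:R) / n`!%:R * z ^+ n)).

Definition ferrersP nu mu x : R :=
  ((1 + x) / (1 - x)) `^ (mu / 2)
  * hyperF (nu + 1) (- nu) (1 - mu) ((1 - x) / 2).

End SpecialFunctions.

Section SphericalHarmonics.
Variable R : realType.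

(* On tau, L + l + i - 2 and L - l are nonnegative, so the absolute values only
   serve to convert them to nat; l may be negative when i = 2. *)
Definition cLl (i : nat) (L l : int) : R :=
  Num.sqrt ((2 * L%:~R + i%:R - 1) / 2
            * ((absz (L + l + i%:Z - 2)%R)`!%:R / (absz (L - l)%R)`!%:R)).

Definition Ptilde_open (i : nat) (L l : int) (t : R) : R :=
  Num.sqrt (pi * Gamma (i%:R / 2 : R) / Gamma ((i%:R + 1) / 2))
  * cLl i L l
  * sin t `^ (- ((i%:R - 2) / 2))
  * ferrersP (L%:~R + (i%:R - 2) / 2) (- (l%:~R + (i%:R - 2) / 2)) (cos t).

Definition Ptilde (i : nat) (L l : int) (t : R) : R :=
  if t == 0 then lim (Ptilde_open i L l s @[s --> 0^'+])
  else if t == pi then lim (Ptilde_open i L l s @[s --> pi^'-])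
  else Ptilde_open i L l t.

Variable d : nat.

Definition unit_sphere : set 'rV[R]_d := [set x | \sum_i x 0 i ^+ 2 = 1].

(* With 0-based i, x 0 i is the coordinate xi_(i+1); the last coordinate xi_d
   has no cosine factor. *)
Definition polar_coordinates (x : 'rV[R]_d) (t : d.-1.-tuple R) : Prop :=
  [/\ 0 <= t.[# 1] < 2 * pi,
      (forall i, (2 <= i < d)%N -> 0 <= t.[# i] <= pi)
    & forall i : 'I_d,
        x 0 i = (\prod_(d - i <= l < d) sin t.[# l])
                * (if i == d.-1 :> nat then 1 else cos t.[# d - i.+1])].

(* Polar coordinates are not unique where some sin theta_i = 0 with i >= 2; the
   choice is immaterial, as Y_alpha does not depend on it for alpha in tau. *)
Definition polar (x : 'rV[R]_d) : d.-1.-tuple R :=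
  xget [tuple 0 | _ < d.-1] [set t | polar_coordinates x t].

Definition Y (a : d.-1.-tuple int) (x : 'rV[R]_d) : R[i] :=
  let t := polar x in
  ((Num.sqrt (2 * pi))^-1)%:C
  * (cos (a.[# 1]%:~R * t.[# 1]) +i* sin (a.[# 1]%:~R * t.[# 1]))
  * (\prod_(2 <= i < d) Ptilde i a.[# i] a.[# i.-1] t.[# i])%:C.

End SphericalHarmonics.

(* In R[i], 0 < z means that z is real and positive. *)
Definition posdefmx (R : realType) (n : nat) (M : 'M[R[i]]_n) : Prop :=
  M \is hermsymmx /\
  forall u : 'rV[R[i]]_n, u != 0 -> 0 < (u *m M *m u^t*) 0 0.

Definition strictly_positive_definite (R : realType) (d : nat)
    (K : 'rV[R]_d -> 'rV[R]_d -> R[i]) : Prop :=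
  forall (n : nat) (x : 'I_n -> 'rV[R]_d),
    injective x -> (forall i, unit_sphere (x i)) ->
    posdefmx (\matrix_(i, j) K (x i) (x j)).

(* Main.v *)
(* If the quadratic form of K at coefficients u and points x_i vanishes, then
   v_a := sum_i u_i Y_a(x_i) is 0 for all a in A_k.  Multiplying by
   conj Y_a(x_0) and summing over all of tau_k, the addition theorem turns the
   sum into a zonal one, sum_i u_i Z_k(x_i . x_0), in which only a in A_k^c
   survive.  Such a have a_j <> 0, and then |Y_a(x)|^2 = O(k^((d+j-3)/2)) at each
   fixed x; with |A_k^c| = o(k^((d-j-1)/2)) the surviving part is o(k^(d-2)), while
   Z_k(1) is of order k^(d-2).  As Z_k(t) = o(Z_k(1)) for |t| < 1 and
   Z_k(-t) = (-1)^k Z_k(t), one gets u_0 + u_(-x_0) = 0 along E and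
   u_0 - u_(-x_0) = 0 along O, hence u_0 = 0.
   The pointwise bound comes from |P~(theta)|^2 = O(sqrt L), uniformly in l and at
   fixed theta in (0, pi).  It is proved by recursion on the dimension i in steps
   of 2, starting from Bernstein's inequality for Legendre polynomials (i = 2, 3). *)

Require Import Defs.
From mathcomp Require Import all_boot all_order all_algebra ring lra zify complex spectral.
From mathcomp Require Import finmap.
From mathcomp Require Import all_classical all_reals all_analysis.

Set Implicit Arguments.
Unset Strict Implicit.
Unset Printing Implicit Defensive.

Import Order.TTheory GRing.Theory Num.Theory.
Import numFieldNormedType.Exports.

Local Open Scope classical_set_scope.
Local Open Scope ring_scope.
Local Open Scope complex_scope.
Local Open Scope sesquilinear_scope.

(** * Gegenbauer polynomials and their addition theorem *)

(** The parameter of [geg] is N = 2 lambda, so that integer and half-integer Gegenbauer parameters,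
    hence spheres of all dimensions, obey the same polynomial identities. The square of P~ of degree
    L and order l is, up to a constant, the l-th coefficient of the addition theorem at two equal
    angles. This makes it accessible: for i = 2 and 3 such a coefficient is the increment of a
    primitive (no integral is ever formed), and passing from i to i + 2 merely replaces (L, l) by (L
    + 1, l + 1) at the price of a factor 1 / sin^2. The resulting constants blow up where sin theta
    = 0. There a_j <> 0 is used: all later orders are then nonzero, and the factor sin^|l| kills the
    harmonic. The dependence of the constants on the angles is harmless, since only finitely many
    points occur. The exponent (d + j - 3) / 2 is (j - 1) + (d - 1 - j) / 2: the first j angles
    together cost a zonal value of order k^(j-1), each later one sqrt k. For |t| < 1 the crude decay
    Z_k(t)^2 = O(sqrt k Z_k(1)) suffices, because Z_k(1) grows at least linearly when d >= 3. *)

Fixpoint geg_pair (A : comNzRingType) (N : nat) (w s : A) (n : nat) : A * A :=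
  if n is m.+1 then
    let: (a, b) := geg_pair N w s m in
    (b, (2 * m + 2 + N)%:R * w * b - (m.+1 * (m + N))%:R * s * a)
  else (1, N%:R * w).

(* n! C_n^{(N/2)}(w), homogenised by s so that no division is needed. *)
Definition geg (A : comNzRingType) (N n : nat) (w s : A) : A := (geg_pair N w s n).1.

Section Geg.
Variables (A : comNzRingType) (w s : A).
Implicit Types N n : nat.

Lemma geg0 N : geg N 0 w s = 1.
Proof. by []. Qed.

Lemma geg1 N : geg N 1 w s = N%:R * w.
Proof. by []. Qed.

Lemma gegSS N n : geg N n.+2 w s =
  (2 * n + 2 + N)%:R * w * geg N n.+1 w s - (n.+1 * (n + N))%:R * s * geg N n w s.
Proof. by rewrite /geg /=; case: (geg_pair N w s n). Qed.

Lemma gegS N n : geg N.+2 n.+1 w s =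
  (2 * n + N.+2)%:R * w * geg N.+2 n w s - (n * (n + N.+1))%:R * s * geg N.+2 n.-1 w s.
Proof.
case: n => [|n]; first by rewrite geg1 geg0; ring.
rewrite gegSS /=; ring.
Qed.

(** The classical relations (n+1) C_{n+1}^lambda = 2 lambda (w C_n^{lambda+1} - C_{n-1}^{lambda+1})
    and (n + 2 lambda) C_n^lambda = 2 lambda (C_n^{lambda+1} - w C_{n-1}^{lambda+1}). They are
    proved together because each feeds the induction of the other. [n.-1] always comes with a factor
    n, so its value at 0 is harmless. *)
Lemma geg_lowering N n :
  geg N n.+1 w s = N%:R * (w * geg N.+2 n w s - n%:R * s * geg N.+2 n.-1 w s) /\
  (n + N)%:R * geg N n w s = N%:R * (geg N.+2 n w s - n%:R * w * geg N.+2 n.-1 w s).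
Proof.
elim: n => [|n [IHA IHB]]; first by rewrite geg1 !geg0; split; ring.
have HB : (n.+1 + N)%:R * geg N n.+1 w s
   = N%:R * (geg N.+2 n.+1 w s - n.+1%:R * w * geg N.+2 n w s).
  by rewrite IHA gegS; ring.
split=> //.
have -> : geg N n.+2 w s = w * ((n.+1 + N)%:R * geg N n.+1 w s) + w * n.+1%:R * geg N n.+1 w s
   - n.+1%:R * s * ((n + N)%:R * geg N n w s) by rewrite gegSS; ring.
by rewrite HB IHB IHA /=; ring.
Qed.

Lemma gegSA N n :
  geg N n.+1 w s = N%:R * (w * geg N.+2 n w s - n%:R * s * geg N.+2 n.-1 w s).
Proof. by case: (geg_lowering N n). Qed.

Lemma gegB N n :
  (n + N)%:R * geg N n w s = N%:R * (geg N.+2 n w s - n%:R * w * geg N.+2 n.-1 w s).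
Proof. by case: (geg_lowering N n). Qed.

(* n! (2 n + N - 2) / (N - 2) C_n^{((N - 2)/2)}, in a form that makes sense for N = 2. *)
Definition zgeg N n := geg N n w s - (n * n.-1)%:R * s * geg N n.-2 w s.

(** A combination of the two lowering relations in which the terms containing w cancel. *)
Lemma zgegE N n : (2 * n + N)%:R * geg N n w s = N%:R * zgeg N.+2 n.
Proof.
case: n => [|n]; first by rewrite /zgeg geg0 /= geg0; ring.
have -> : (2 * n.+1 + N)%:R * geg N n.+1 w s =
  n.+1%:R * geg N n.+1 w s + (n.+1 + N)%:R * geg N n.+1 w s by ring.
by rewrite gegB gegSA /zgeg /=; ring.
Qed.

End Geg.

(** The derivative of f = [geg N.+2 n] at s = 1 is n (N+2) [geg N.+4 n.-1], so the bracket is (N+1)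
    x f - (1 - x^2) f': up to sign and a power of 1 - x^2, the derivative of (1 - x^2)^((N+1)/2) f.
    This first-order relation is behind the addition theorem, Legendre's equation and the closed
    forms of the Ferrers functions. *)
Lemma geg_raising (A : comNzRingType) (x : A) N n :
  N%:R * (N.+1%:R * x * geg N.+2 n x 1 -
          (n * N.+2)%:R * (1 - x ^+ 2) * geg N.+4 n.-1 x 1)
  = (n + N).+1%:R * geg N n.+1 x 1.
Proof.
rewrite gegSA; case: n => [|n]; first by rewrite /= geg0; ring.
have HA := gegSA x 1 N.+2 n; have HB := gegB x 1 N.+2 n; rewrite /=.
have -> : (n.+1 + N).+1%:R *
  (N%:R * (x * geg N.+2 n.+1 x 1 - n.+1%:R * 1 * geg N.+2 n x 1)) =
  N%:R * ((n.+1 + N).+1%:R * x * geg N.+2 n.+1 x 1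
          - n.+1%:R * ((n + N.+2)%:R * geg N.+2 n x 1)) by ring.
by rewrite HB HA; ring.
Qed.

Lemma geg_morph (A B : comNzRingType) (f : {rmorphism A -> B}) N n (w s : A) :
  f (geg N n w s) = geg N n (f w) (f s).
Proof.
elim/ltn_ind: n => -[_|[_|n IH]]; first by rewrite !geg0 rmorph1.
  by rewrite !geg1 rmorphM rmorph_nat.
by rewrite !gegSS rmorphB !rmorphM !rmorph_nat !IH.
Qed.

Lemma geg_homog (A : comNzRingType) N n (r w s : A) :
  geg N n (r * w) (r ^+ 2 * s) = r ^+ n * geg N n w s.
Proof.
elim/ltn_ind: n => -[_|[_|n IH]]; first by rewrite !geg0; ring.
  by rewrite !geg1; ring.
by rewrite !gegSS !IH // !exprS; ring.
Qed.

Lemma geg11 (A : comNzRingType) N n : geg N.+1 n (1 : A) 1 * N`!%:R = (n + N)`!%:R.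
Proof.
elim/ltn_ind: n => -[_|[_|n IH]]; first by rewrite geg0 mul1r.
  by rewrite geg1 factS natrM; ring.
rewrite gegSS mulrBl -!mulrA.
have -> : (1 : A) * (geg N.+1 n.+1 1 1 * N`!%:R) = (n.+1 + N)`!%:R by rewrite IH ?mul1r.
have -> : (1 : A) * (geg N.+1 n 1 1 * N`!%:R) = (n + N)`!%:R by rewrite IH ?mul1r.
by rewrite !addSn !factS !natrM; ring.
Qed.

Lemma deriv_natr (R : nzRingType) n : (n%:R : {poly R})^`() = 0.
Proof. by rewrite -polyC_natr derivC. Qed.

(** The hypothesis stands for T = S' / 2 in a ring where 2 need not be invertible. Letting S vary is
    needed along the path used for the addition theorem. *)
Lemma deriv_geg (R : comNzRingType) (N n : nat) (W S T : {poly R}) :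
  S^`() = 2%:R * T ->
  (geg N n W S)^`() = (n * N)%:R * geg N.+2 n.-1 W S * W^`()
                      - (n * n.-1 * N)%:R * geg N.+2 n.-2 W S * T.
Proof.
move=> dS; elim/ltn_ind: n => -[_|[_|n IH]].
- by rewrite geg0 derivC; ring.
- by rewrite geg1 derivM deriv_natr /= !geg0; ring.
rewrite gegSS derivB !derivM !deriv_natr dS !IH //=.
have eA : geg N n.+1 W S = N%:R * (W * geg N.+2 n W S - n%:R * S * geg N.+2 n.-1 W S) := gegSA W S N n.
have eB : (n + N)%:R * geg N n W S = N%:R * (geg N.+2 n W S - n%:R * W * geg N.+2 n.-1 W S) := gegB W S N n.
set B := (n + N)%:R * geg N n W S in eB.
transitivity (
 (2 * n + 2 + N)%:R * W^`() * geg N n.+1 W S +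
  (2 * n + 2 + N)%:R * W * ((n.+1 * N)%:R * geg N.+2 n W S * W^`() - (n.+1 * n * N)%:R * geg N.+2 n.-1 W S * T)
  - n.+1%:R * (2%:R * T * B)
  - (n.+1 * (n + N))%:R * S * ((n * N)%:R * geg N.+2 n.-1 W S * W^`() - (n * n.-1 * N)%:R * geg N.+2 n.-2 W S * T)).
  by rewrite /B; ring.
rewrite eA eB gegS.
case: n {IH eA eB B} => [|n]; first by rewrite /= ?geg1 ?geg0; ring.
by rewrite (gegS _ _ N n) /=; ring.
Qed.

(** [zgeg] of parameter N behaves like a Gegenbauer polynomial of parameter N - 2, so its derivative
    comes back to parameter N. *)
Lemma deriv_zgeg (R : comNzRingType) (N n : nat) (W S T : {poly R}) :
  S^`() = 2%:R * T ->
  (zgeg W S N n.+1)^`() = (2 * n + N)%:R * n.+1%:R *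
    (geg N n W S * W^`() - n%:R * geg N n.-1 W S * T).
Proof.
move=> dS; rewrite /zgeg derivB !derivM !deriv_natr dS.
rewrite !(deriv_geg _ _ _ dS) /=.
have e1 := zgegE W S N n.
transitivity (n.+1%:R * ((N%:R * zgeg W S N.+2 n) * W^`()
  - n%:R * (2%:R * geg N n.-1 W S + N%:R * zgeg W S N.+2 n.-1) * T)).
  by case: n {e1} => [|n] /=; rewrite /zgeg /=; ring.
rewrite -!zgegE; case: n {e1} => [|n] /=; ring.
Qed.

Section AdditionDerivative.
Variables (A : comNzRingType) (N L : nat) (b c : nat -> A).
Hypothesis bS : forall l, b l.+1 * l.+1%:R = c l * (N + 2 * l)%:R.
Hypothesis cE : forall l, c l * (L + l + N)%:R = b l * ((L - l) * (N + 2 * l))%:R.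
Hypothesis bL1 : b L.+1 = 0.
Hypothesis N_gt0 : (0 < N)%N.

Let p l (x : A) := geg (N + 2 * l) (L - l) x 1.

(** The sum is the partial derivative in x of the addition sum when x y + w is kept fixed. Expanded
    in [geg N.+1 l w s] and reindexed, all its coefficients vanish, by [geg_raising] once in x and
    once in y. The sequence c is an intermediate between b l and b l.+1 that avoids division in the
    ring. *)
Lemma addition_cancel (x y w s : A) : s = (1 - x ^+ 2) * (1 - y ^+ 2) ->
  \sum_(l < L.+1) b l * p l y *
    (((L - l) * (N + 2 * l))%:R * p l.+1 x * zgeg w s N.+1 l
     - (l * (2 * l + N.-1))%:R * p l x *
       (y * geg N.+1 l.-1 w s - l.-1%:R * (x * (1 - y ^+ 2)) * geg N.+1 l.-2 w s)) = 0.
Proof.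
move=> sE.
pose t1 l := b l * p l y * ((L - l) * (N + 2 * l))%:R * p l.+1 x.
pose t3 l := - b l * p l y * p l x * (l * (2 * l + N.-1))%:R * y.
pose t2 l := b l * p l y * (l * l.-1)%:R * (1 - y ^+ 2) *
    ((2 * l + N.-1)%:R * x * p l x - ((L - l) * (N + 2 * l))%:R * (1 - x ^+ 2) * p l.+1 x).
transitivity (\sum_(l < L.+1) (t1 l * geg N.+1 l w s + t2 l * geg N.+1 l.-2 w s
    + t3 l * geg N.+1 l.-1 w s)).
  by apply: eq_bigr => l _; rewrite /t1 /t2 /t3 /zgeg sE; ring.
rewrite !big_split /=.
have -> : \sum_(l < L.+1) t1 l * geg N.+1 l w s = \sum_(l < L) t1 l * geg N.+1 l w s.
  by rewrite big_ord_recr /= /t1 subnn; ring.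
have -> : \sum_(l < L.+1) t3 l * geg N.+1 l.-1 w s = \sum_(l < L) t3 l.+1 * geg N.+1 l w s.
  rewrite big_ord_recl /=.
  have -> : t3 0%N = 0 by rewrite /t3; ring.
  by rewrite mul0r add0r.
(* Shifting by two would leave L - 1 terms. The term at L.+1, null by [bL1], is added first, so that
   all three sums run over l < L. *)
have -> : \sum_(l < L.+1) t2 l * geg N.+1 l.-2 w s = \sum_(l < L) t2 l.+2 * geg N.+1 l w s.
  transitivity (\sum_(l < L.+2) t2 l * geg N.+1 l.-2 w s).
    have t2L : t2 L.+1 = 0 by rewrite /t2 bL1; ring.
    by rewrite [RHS]big_ord_recr /= t2L mul0r addr0.
  rewrite big_ord_recl big_ord_recl /=.
  have -> : t2 0%N = 0 by rewrite /t2; ring.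
  have -> : t2 1%N = 0 by rewrite /t2 /= ?muln0; ring.
  by rewrite !mul0r !add0r.
rewrite -!big_split /= big1 // => -[l ltlL] _ /=; rewrite -!mulrDl.
have [n Ln] : exists n, L = (l + n).+1 by exists (L - l.+1)%N; lia.
have tz : t2 l.+2 = l.+1%:R * b l.+1 * p l.+2 y * (1 - y ^+ 2) *
    (n * (N + 2 * l.+1))%:R * p l.+1 x.
  case: n Ln => [|n] Ln; first by rewrite /t2 (_ : l.+2 = L.+1) ?bL1; [ring|lia].
  have -> : t2 l.+2 = (b l.+2 * l.+2%:R) * l.+1%:R * p l.+2 y * (1 - y ^+ 2) *
    ((N + 2 * l.+1).+1%:R * x * p l.+2 x - (n * (N + 2 * l.+1).+2)%:R * (1 - x ^+ 2) * p l.+3 x).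
    rewrite /t2; have -> : (L - l.+2 = n)%N by lia.
    have -> : (2 * l.+2 + N.-1 = (N + 2 * l.+1).+1)%N by lia.
    by rewrite /=; ring.
  rewrite bS.
  have := geg_raising x (N + 2 * l.+1) n.
  have -> : geg (N + 2 * l.+1).+2 n x 1 = p l.+2 x by rewrite /p; congr geg; lia.
  have -> : geg (N + 2 * l.+1) n.+1 x 1 = p l.+1 x by rewrite /p; congr geg; lia.
  have -> : (n * (N + 2 * l.+1).+2)%:R * (1 - x ^+ 2) * geg (N + 2 * l.+1).+4 n.-1 x 1 =
            (n * (N + 2 * l.+1).+2)%:R * (1 - x ^+ 2) * p l.+3 x.
    by case: n Ln => [|n] Ln; [ring | congr (_ * _); rewrite /p; congr geg; lia].
  move=> O.
  transitivity (c l.+1 * l.+1%:R * p l.+2 y * (1 - y ^+ 2) *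
   ((N + 2 * l.+1)%:R * ((N + 2 * l.+1).+1%:R * x * p l.+2 x -
     (n * (N + 2 * l.+1).+2)%:R * (1 - x ^+ 2) * p l.+3 x))); first by ring.
  rewrite O; have := cE l.+1.
  have -> : (L - l.+1 = n.+1)%N by lia.
  have -> : (L + l.+1 + N = (n + (N + 2 * l.+1)).+1)%N by lia.
  move=> E; transitivity (l.+1%:R * p l.+2 y * (1 - y ^+ 2) * p l.+1 x *
     (c l.+1 * (n + (N + 2 * l.+1)).+1%:R)); first by ring.
  by rewrite E; ring.
have E1 : t1 l = c l * (L + l + N)%:R * p l y * p l.+1 x by rewrite cE /t1; ring.
have E2 : t2 l.+2 = c l * (N + 2 * l)%:R * p l.+2 y * (1 - y ^+ 2) *
    (n * (N + 2 * l.+1))%:R * p l.+1 x by rewrite -bS tz; ring.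
have E3 : t3 l.+1 = - c l * (N + 2 * l)%:R * p l.+1 y * p l.+1 x * (2 * l.+1 + N.-1)%:R * y.
  by rewrite mulNr -bS /t3; ring.
rewrite E1 E2 E3.
have := geg_raising y (N + 2 * l) n.
have -> : geg (N + 2 * l).+2 n y 1 = p l.+1 y by rewrite /p; congr geg; lia.
have -> : geg (N + 2 * l) n.+1 y 1 = p l y by rewrite /p; congr geg; lia.
have -> : (n * (N + 2 * l).+2)%:R * (1 - y ^+ 2) * geg (N + 2 * l).+4 n.-1 y 1 =
          (n * (N + 2 * l).+2)%:R * (1 - y ^+ 2) * p l.+2 y.
  by case: n Ln {tz E2} => [|n] Ln; [ring | congr (_ * _); rewrite /p; congr geg; lia].
have -> : (L + l + N = (n + (N + 2 * l)).+1)%N by lia.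
move=> O.
transitivity (c l * p l.+1 x * geg N.+1 l w s * ((n + (N + 2 * l)).+1%:R * p l y
  + (N + 2 * l)%:R * (1 - y ^+ 2) * (n * (N + 2 * l.+1))%:R * p l.+2 y
  - (N + 2 * l)%:R * p l.+1 y * (2 * l.+1 + N.-1)%:R * y)); first by ring.
rewrite -O.
have -> : (2 * l.+1 + N.-1 = (N + 2 * l).+1)%N by lia.
by ring.
Qed.

End AdditionDerivative.

(* Along the segment from (x, y, w) to (x y + w, 1, 0) the quantity x y + w is constant,
   and so is the left-hand side: its derivative vanishes. *)
Theorem geg_addition (R : numFieldType) (N L : nat) (b c : nat -> R) :
  (forall l, b l.+1 * l.+1%:R = c l * (N + 2 * l)%:R) ->
  (forall l, c l * (L + l + N)%:R = b l * ((L - l) * (N + 2 * l))%:R) ->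
  b L.+1 = 0 -> (0 < N)%N -> forall x y w : R,
  \sum_(l < L.+1) b l * geg (N + 2 * l) (L - l) x 1 * geg (N + 2 * l) (L - l) y 1
     * zgeg w ((1 - x ^+ 2) * (1 - y ^+ 2)) N.+1 l
  = b 0%N * geg N L 1 1 * geg N L (x * y + w) 1.
Proof.
move=> bS cE bL1 N_gt0 x y w.
pose p l (z : {poly R}) := geg (N + 2 * l) (L - l) z 1.
pose Phi (X Y W : {poly R}) := \sum_(l < L.+1) (b l)%:P * p l X * p l Y
     * zgeg W ((1 - X ^+ 2) * (1 - Y ^+ 2)) N.+1 l.
have PhiE X Y W t : (Phi X Y W).[t] =
   \sum_(l < L.+1) b l * geg (N + 2 * l) (L - l) X.[t] 1 * geg (N + 2 * l) (L - l) Y.[t] 1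
     * zgeg W.[t] ((1 - X.[t] ^+ 2) * (1 - Y.[t] ^+ 2)) N.+1 l.
  rewrite horner_sum; apply: eq_bigr => l _.
  by rewrite /p /zgeg -/(horner_eval t _) rmorphM rmorphM rmorphM rmorphB rmorphM rmorphM
     rmorph_nat !geg_morph !rmorphM !rmorphB !rmorphXn !rmorph1 /= /horner_eval hornerC.
have bSP l : (b l.+1)%:P * l.+1%:R = (c l)%:P * (N + 2 * l)%:R :> {poly R}.
  by rewrite -!polyC_natr -!polyCM bS.
have cEP l : (c l)%:P * (L + l + N)%:R = (b l)%:P * ((L - l) * (N + 2 * l))%:R :> {poly R}.
  by rewrite -!polyC_natr -!polyCM cE.
have d1 : (1 : {poly R})^`() = 0 by rewrite -polyC1 derivC.
have dPhi X Y U : U^`() = 0 -> (Phi X Y (U - X * Y))^`() = 0.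
  move=> dU; pose W := U - X * Y; pose S := (1 - X ^+ 2) * (1 - Y ^+ 2).
  pose T := - (X * X^`() * (1 - Y ^+ 2) + Y * Y^`() * (1 - X ^+ 2)).
  have dS : S^`() = 2%:R * T.
    by rewrite /T /S derivM !derivB !expr2 !derivM d1; ring.
  have dp l Z : (p l Z)^`() = ((L - l) * (N + 2 * l))%:R * p l.+1 Z * Z^`().
    rewrite /p (@deriv_geg _ _ _ _ _ 0); last by rewrite d1; ring.
    have -> : ((N + 2 * l).+2 = N + 2 * l.+1)%N by lia.
    by rewrite subnS; ring.
  pose D x y := (\sum_(l < L.+1) (b l)%:P * p l y *
    (((L - l) * (N + 2 * l))%:R * p l.+1 x * zgeg W S N.+1 l
     - (l * (2 * l + N.-1))%:R * p l x *
       (y * geg N.+1 l.-1 W S - l.-1%:R * (x * (1 - y ^+ 2)) * geg N.+1 l.-2 W S))).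
  suff -> : (Phi X Y W)^`() = D X Y * X^`() + D Y X * Y^`().
    rewrite /D (addition_cancel (b := fun l => (b l)%:P) bSP cEP) ?bL1 //.
    rewrite (addition_cancel (b := fun l => (b l)%:P) bSP cEP) ?bL1 //; first by ring.
    by rewrite /S mulrC.
  rewrite /D /Phi raddf_sum !big_distrl -big_split; apply: eq_bigr => -[l lL] _ /=.
  rewrite !derivM derivC !dp -/S.
  have -> : (zgeg W S N.+1 l)^`() = (l * (2 * l + N.-1))%:R *
     (geg N.+1 l.-1 W S * W^`() - l.-1%:R * geg N.+1 l.-2 W S * T).
    case: l {lL} => [|l].
      by rewrite /zgeg /= geg0 mul0n !mul0r subr0 d1.
    rewrite (deriv_zgeg _ _ _ dS) /=.
    have -> : (2 * l.+1 + N.-1 = 2 * l + N.+1)%N by lia.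
    by ring.
  have -> : W^`() = - (X^`() * Y + X * Y^`()) by rewrite /W derivB derivM dU; ring.
  by rewrite /T; ring.
pose u := x * y + w.
pose X : {poly R} := x%:P + (u - x) *: 'X; pose Y : {poly R} := y%:P + (1 - y) *: 'X.
have d0 := dPhi X Y u%:P (derivC u).
have [k kE] : exists k, Phi X Y (u%:P - X * Y) = k%:P.
  have : (size (Phi X Y (u%:P - X * Y)%R) <= 1)%N.
    rewrite leqNgt; apply/negP => lt1.
    have := congr1 (fun q : {poly R} => q`_(size (Phi X Y (u%:P - X * Y))).-2) d0.
    rewrite coef_deriv coef0 prednK; last by lia.
    move/eqP; rewrite mulrn_eq0 -/(lead_coef _) lead_coef_eq0.
    case/orP=> [/eqP h|/eqP h]; first by move: lt1; lia.
    by move: lt1; rewrite h size_poly0.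
  by move/size1_polyC => ->; eexists.
have X1 : X.[1] = u by rewrite /X hornerD hornerC hornerZ hornerX mulr1 addrC subrK.
have Y1 : Y.[1] = 1 by rewrite /Y hornerD hornerC hornerZ hornerX mulr1 addrC subrK.
have W1 : (u%:P - X * Y).[1] = 0 by rewrite hornerD hornerN hornerM X1 Y1 hornerC; ring.
have X0 : X.[0] = x by rewrite /X !hornerE.
have Y0 : Y.[0] = y by rewrite /Y !hornerE.
have W0 : (u%:P - X * Y).[0] = w.
  by rewrite hornerD hornerN hornerM X0 Y0 hornerC /u; ring.
have := congr1 (fun q : {poly R} => q.[0]) kE.
have := congr1 (fun q : {poly R} => q.[1]) kE.
rewrite /= !PhiE X1 Y1 W1 X0 Y0 W0 !hornerC => k1 ->.
(* At the end of the path y = 1 and w = 0, hence s = 0, and only l = 0 survives. *)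
rewrite -k1 big_ord_recl big1 ?addr0; last first.
  move=> l _; rewrite expr1n subrr mulr0 lift0 /zgeg /= mulr0 mul0r subr0.
  suff -> : geg N.+1 l.+1 (0 : R) 0 = 0 by rewrite mulr0.
  by case: (l : nat) => [|m]; rewrite ?geg1 ?gegSS; ring.
by rewrite /= /zgeg /= geg0 muln0 addn0 subn0 mul0n !mul0r subr0; ring.
Qed.

(** * Legendre polynomials *)

Lemma zgegSS (A : comNzRingType) (w : A) n :
  zgeg w 1 2 n.+3 = (2 * n + 6)%:R * w * zgeg w 1 2 n.+2 - (n.+3 * n.+2)%:R * zgeg w 1 2 n.+1.
Proof.
have e m : geg 2 m.+1 w 1 = (2 * m + 2)%:R * w * geg 2 m w 1 - (m * (m + 1))%:R * geg 2 m.-1 w 1.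
  by rewrite gegS; ring.
by rewrite /zgeg /= (e n.+2) /= (e n); ring.
Qed.

Section Real.
Variable R : realType.
Implicit Types (x y t c : R) (n l : nat).

(** For N = 2 these are Chebyshev polynomials: U_n - U_{n-2} = 2 T_n. *)
Lemma zgeg_cos t n : zgeg (cos t) 1 2 n.+1 = n.+1`!%:R * (2 * cos (n.+1%:R * t)).
Proof.
elim/ltn_ind: n => -[_|[_|n IH]].
- by rewrite /zgeg /= geg1 muln0 (_ : 1`! = 1)%N // [1%:R * t]mul1r; ring.
- have -> : 2%:R * t = t + t by ring.
  by rewrite /zgeg /= gegSS geg1 geg0 cosD -!expr2 sin2cos2 (_ : 2`! = 2)%N //; ring.
rewrite zgegSS !IH //.
have -> : n.+3%:R * t = n.+2%:R * t + t by ring.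
have -> : n.+1%:R * t = n.+2%:R * t - t by ring.
by rewrite cosB cosD !factS; ring.
Qed.

Lemma le_of_derive_ge0 (f df : R -> R) (a b : R) : a <= b ->
  (forall x, a < x < b -> is_derive x 1 f (df x) /\ 0 <= df x) ->
  (forall x, a <= x <= b -> {for x, continuous f}) -> f a <= f b.
Proof.
move=> ab fdf fc.
apply: (@ger0_derive1_ndecr R f a b) => //.
- by move=> x; rewrite in_itv => /fdf [[]].
- by move=> x; rewrite in_itv => /fdf [fd]; rewrite derive1E derive_val.
- apply: continuous_in_subspaceT => x; rewrite inE /= in_itv /= => xab.
  exact: fc.
Qed.

Definition legendre n : {poly R} := (n`!%:R^-1) *: geg 1 n 'X 1.

Lemma legendreE n x : (legendre n).[x] = geg 1 n x 1 / n`!%:R.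
Proof.
by rewrite /legendre hornerZ -/(horner_eval x _) geg_morph /= /horner_eval hornerX hornerC mulrC.
Qed.

Lemma fact_neq0 n : n`!%:R != 0 :> R.
Proof. by rewrite pnatr_eq0 -lt0n fact_gt0. Qed.

Lemma legendre1 n : (legendre n).[1] = 1.
Proof.
rewrite legendreE; have := geg11 R 0 n; rewrite mulr1 addn0 => ->.
by rewrite divff ?fact_neq0.
Qed.

Lemma legendreN n x : (legendre n).[- x] = (-1) ^+ n * (legendre n).[x].
Proof.
rewrite !legendreE mulrA -geg_homog; congr (_ / _); congr geg; ring.
Qed.

Lemma deriv_geg1 N n : (geg N n 'X 1 : {poly R})^`() = (n * N)%:R * geg N.+2 n.-1 'X 1.
Proof.
rewrite (@deriv_geg _ _ _ _ _ 0); first by rewrite derivX; ring.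
by rewrite derivC; ring.
Qed.

(** Each derivative raises the parameter by 2, so the equation is [geg_raising] at N = 1. *)
Lemma legendre_ode n :
  (1 - 'X ^+ 2) * (legendre n)^`()^`() - 2%:R * 'X * (legendre n)^`() + (n * n.+1)%:R * legendre n = 0.
Proof.
rewrite /legendre !derivZ !deriv_geg1 derivM deriv_natr deriv_geg1.
rewrite -!mul_polyC; case: n => [|n]; first by rewrite !mul0n; ring.
have /= O := geg_raising ('X : {poly R}) 1 n.
transitivity ((n.+1`!%:R^-1)%:P * n.+1%:R * ((n + 1).+1%:R * geg 1 n.+1 'X 1 -
  1%:R * (2%:R * 'X * geg 3 n 'X 1 - (n * 3)%:R * (1 - 'X ^+ 2) * geg 5 n.-1 'X 1)) : {poly R}).
  by rewrite /=; ring.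
by rewrite O; ring.
Qed.

Lemma legendre_rec n :
  'X * (legendre n.+1)^`() - (legendre n)^`() = n.+1%:R * legendre n.+1 /\
  (legendre n.+1)^`() - 'X * (legendre n)^`() = n.+1%:R * legendre n.
Proof.
have fS : (n`!%:R^-1)%:P = (n.+1`!%:R^-1)%:P * n.+1%:R :> {poly R}.
  rewrite -polyC_natr -polyCM; congr (_%:P); rewrite factS natrM.
  by field; rewrite fact_neq0 /= nat1r pnatr_eq0.
rewrite /legendre !derivZ !deriv_geg1 -!mul_polyC fS.
have a := gegSA ('X : {poly R}) 1 1 n; have b := gegB ('X : {poly R}) 1 1 n.
split; first by rewrite a /=; ring.
transitivity ((n.+1`!%:R^-1)%:P * n.+1%:R * (n.+1%:R * geg 1 n 'X 1) : {poly R}); last by ring.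
rewrite (_ : n.+1%:R = (n + 1)%:R) ?addn1 // in b *.
by rewrite b; ring.
Qed.

End Real.

Section Real.
Variable R : realType.
Implicit Types (x y t c s : R) (n l : nat).

Lemma horner_natr n x : (n%:R : {poly R}).[x] = n%:R.
Proof. by rewrite -polyC_natr hornerC. Qed.

Lemma legendre_ode_at n x :
  (1 - x ^+ 2) * ((legendre R n)^`()^`()).[x] - 2 * x * (legendre R n)^`().[x]
    + (n * n.+1)%:R * (legendre R n).[x] = 0.
Proof.
have := congr1 (fun q : {poly R} => q.[x]) (legendre_ode R n).
by rewrite /= !(hornerD, hornerN, hornerM, hornerXn, hornerX, hornerC, horner_natr).
Qed.

(** P_{n+2}(0) = - (n+1)/(n+2) P_n(0), and (n+3)(n+1) <= (n+2)^2. *)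
Lemma legendre_at0 n : n.+1%:R * (legendre R n).[0] ^+ 2 <= 1.
Proof.
elim/ltn_ind: n => -[_|[_|n IH]].
- by rewrite legendreE geg0 divr1; lra.
- by rewrite legendreE geg1 mulr0 mul0r; lra.
have /= := IH n; rewrite ltnS leqnSn => /(_ isT) {}IH.
have -> : (legendre R n.+2).[0] = - (n.+1%:R / n.+2%:R) * (legendre R n).[0].
  rewrite !legendreE gegSS !factS !natrM; field.
  by rewrite fact_neq0 /= -!natr1; apply/andP; split; rewrite lt0r_neq0 // ltr_wpDl.
have n1 : (0 : R) < n.+1%:R by rewrite ltr0n.
have -> : n.+3%:R = n.+1%:R + 2 :> R by ring.
have -> : n.+2%:R = n.+1%:R + 1 :> R by ring.
set p := (legendre R n).[0] in IH *; set m := n.+1%:R in IH n1 *.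
have -> : (m + 2) * (- (m / (m + 1)) * p) ^+ 2 = (m * p ^+ 2) * ((m + 2) * m / (m + 1) ^+ 2).
  by field; lra.
have h : (m + 2) * m / (m + 1) ^+ 2 <= 1.
  by rewrite ler_pdivrMr ?exprn_gt0 ?mul1r; lra.
have h0 : 0 <= (m + 2) * m / (m + 1) ^+ 2 by rewrite divr_ge0 ?sqr_ge0 // mulr_ge0; lra.
by rewrite -[leRHS]mulr1; apply: ler_pM => //; rewrite mulr_ge0 ?sqr_ge0 // ltW.
Qed.

Lemma deriv_legendre_at0 n : (legendre R n.+1)^`().[0] = n.+1%:R * (legendre R n).[0].
Proof.
have [_ /(congr1 (fun q : {poly R} => q.[0]))] := legendre_rec R n.
by rewrite /= !(hornerD, hornerN, hornerM, hornerX, horner_natr) mul0r subr0.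
Qed.

(** This is Sonin's function at the equator for lam = n (n+1). Each of the two terms is at most 1 /
    (n+1), the second because P_n'(0) = n P_{n-1}(0). *)
Lemma legendre_sonin0 n :
  (legendre R n).[0] ^+ 2 + (legendre R n)^`().[0] ^+ 2 / ((n * n.+1)%:R + 2^-1) <= 2 / n.+1%:R.
Proof.
have h0 := legendre_at0 n.
have n1 : (0 : R) < n.+1%:R by rewrite ltr0n.
have h1 : (legendre R n).[0] ^+ 2 <= 1 / n.+1%:R by rewrite ler_pdivlMr // mulrC.
suff h2 : (legendre R n)^`().[0] ^+ 2 / ((n * n.+1)%:R + 2^-1) <= 1 / n.+1%:R.
  by apply: (le_trans (lerD h1 h2)); rewrite -mulrDl.
case: n h0 h1 n1 => [|n] h0 h1 n1.
  rewrite /legendre geg0 alg_polyC derivC horner0 expr0n /= mul0r; lra.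
rewrite deriv_legendre_at0.
have := legendre_at0 n; set p := (legendre R n).[0] => hp.
have m1 : (0 : R) < n.+1%:R by rewrite ltr0n.
rewrite ler_pdivlMr // mulrAC ler_pdivrMr ?natrM; last by rewrite addr_gt0 ?mulr_gt0 ?invr_gt0.
have -> : n.+2%:R = n.+1%:R + 1 :> R by ring.
set m := n.+1%:R in hp m1 *.
have : m * (m * p ^+ 2) * (m + 1) <= m * 1 * (m + 1).
  by rewrite ler_pM2r ?ler_pM2l //; lra.
rewrite exprMn; lra.
Qed.

(** * Sonin's function and the energy for Legendre's equation *)

Section Sonin.
Variables (p : {poly R}) (lam : R).
Hypothesis lam_ge0 : 0 <= lam.
Hypothesis p_ode : forall t,
  (1 - t ^+ 2) * p^`()^`().[t] - 2 * t * p^`().[t] + lam * p.[t] = 0.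

(** With x = cos theta and s = sin theta, u = sqrt(s) p(x) satisfies u'' + phi u = 0 for phi = rho /
    s^2, and u' = [sonin_w] / sqrt(s). Sonin's function u^2 + u'^2 / phi is therefore s times
    [sonin_q] / [rho]. *)
Let rho : {poly R} := (lam + 4^-1) *: (1 - 'X ^+ 2) + (4^-1)%:P.
Let sonin_w : {poly R} := (2^-1) *: ('X * p) - (1 - 'X ^+ 2) * p^`().
Let sonin_q : {poly R} := rho * p ^+ 2 + sonin_w ^+ 2.

Let hE := (hornerD, hornerN, hornerM, hornerMn, hornerZ, horner_exp, hornerX, hornerC).

Let rho_at x : rho.[x] = (lam + 4^-1) * (1 - x ^+ 2) + 4^-1.
Proof. by rewrite /rho !hE. Qed.

Let sonin_w_at x : sonin_w.[x] = 2^-1 * (x * p.[x]) - (1 - x ^+ 2) * p^`().[x].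
Proof. by rewrite /sonin_w !hE. Qed.

Let sonin_q_at x : sonin_q.[x] = rho.[x] * p.[x] ^+ 2 + sonin_w.[x] ^+ 2.
Proof. by rewrite /sonin_q !hE. Qed.

Let rho_gt0 x : -1 <= x <= 1 -> 0 < rho.[x].
Proof.
move=> /andP[h1 h2]; rewrite rho_at ltr_wpDl // mulr_ge0 //; first by rewrite addr_ge0.
by rewrite (_ : 1 - x ^+ 2 = (1 - x) * (1 + x)); [rewrite mulr_ge0; lra|ring].
Qed.

(** The derivative of Sonin's function in theta is - phi' u'^2 / phi^2, which is nonnegative on (0,
    pi/2) since phi decreases there; so the function decreases in x. It is squared in order to stay
    within rational functions. *)
Let sonin_mono x : 0 <= x <= 1 ->
  (1 - x ^+ 2) * sonin_q.[x] ^+ 2 / rho.[x] ^+ 2 <= sonin_q.[0] ^+ 2 / rho.[0] ^+ 2.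
Proof.
move=> /andP[x0 x1].
pose N1 : {poly R} := (1 - 'X ^+ 2) * sonin_q ^+ 2.
pose D : {poly R} := rho ^+ 2.
pose f (t : R) := - (N1.[t] * (D.[t])^-1).
have N1E t : N1.[t] = (1 - t ^+ 2) * sonin_q.[t] ^+ 2 by rewrite /N1 !hE.
have DE t : D.[t] = rho.[t] ^+ 2 by rewrite /D horner_exp.
have Dgt0 t : 0 <= t <= 1 -> 0 < D.[t].
  by move=> h; rewrite DE exprn_gt0 // rho_gt0 //; lra.
have fD t : 0 <= t <= 1 ->
    is_derive t 1 f ((N1.[t] * D^`().[t] - N1^`().[t] * D.[t]) / D.[t] ^+ 2).
  move=> h.
  have Dt : D.[t] != 0 by rewrite gt_eqF // Dgt0.
  have e1 := is_derive_poly N1 t.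
  have e2 := is_deriveV Dt (is_derive_poly D t).
  have e3 := is_deriveN (is_deriveM e1 e2).
  apply: (is_derive_eq e3); rewrite /= /GRing.scale /=; field; exact: Dt.
suff : f 0 <= f x by rewrite /f lerN2 !N1E !DE expr0n /= subr0 mul1r.
apply: (le_of_derive_ge0 (df := fun t => (N1.[t] * D^`().[t] - N1^`().[t] * D.[t]) / D.[t] ^+ 2)) => //.
  move=> t /andP[t0 t1]; have h : 0 <= t <= 1 by lra.
  split; first exact: fD.
  rewrite divr_ge0 ?sqr_ge0 //.
  have dsqr (g : {poly R}) : (g ^+ 2)^`() = 2%:R * g * g^`().
    by rewrite !expr2 derivM; ring.
  have r_gt0 : 0 < rho.[t] by apply: rho_gt0; lra.
  have q_ge0 : 0 <= sonin_q.[t].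
    by rewrite sonin_q_at addr_ge0 ?sqr_ge0 // mulr_ge0 ?sqr_ge0 // ltW.
  have w1E : sonin_w^`().[t] = (lam + 2^-1) * p.[t] + 2^-1 * t * p^`().[t].
    transitivity (2^-1 * (p.[t] + t * p^`().[t]) + 2 * t * p^`().[t] - (1 - t ^+ 2) * p^`()^`().[t]).
      by rewrite /sonin_w derivB derivZ !derivM derivX derivB derivC derivXn !hE /=; ring.
    transitivity (2^-1 * (p.[t] + t * p^`().[t]) + 2 * t * p^`().[t]
                  - (2 * t * p^`().[t] - lam * p.[t])); last by field.
    by congr (_ - _); move: (p_ode t); set a := (1 - _) * _; lra.
  have r1E : rho^`().[t] = - 2 * (lam + 4^-1) * t.
    by rewrite /rho derivD derivZ derivB !derivC derivXn !hE /=; ring.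
  have q1E : sonin_q^`().[t] = rho^`().[t] * p.[t] ^+ 2 + 2 * rho.[t] * p.[t] * p^`().[t]
       + 2 * sonin_w.[t] * sonin_w^`().[t].
    suff qd (r w : {poly R}) : (r * p ^+ 2 + w ^+ 2)^`().[t] =
        r^`().[t] * p.[t] ^+ 2 + 2 * r.[t] * p.[t] * p^`().[t] + 2 * w.[t] * w^`().[t] by exact: qd.
    by rewrite derivD derivM !dsqr !hE; ring.
  have N11E : N1^`().[t] = - 2 * t * sonin_q.[t] ^+ 2 + 2 * (1 - t ^+ 2) * sonin_q.[t] * sonin_q^`().[t].
    suff nd (q : {poly R}) : ((1 - 'X ^+ 2) * q ^+ 2)^`().[t] =
        - 2 * t * q.[t] ^+ 2 + 2 * (1 - t ^+ 2) * q.[t] * q^`().[t] by exact: nd.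
    by rewrite derivM derivB derivC derivXn dsqr !(hE, horner_natr) /=; ring.
  have D1E : D^`().[t] = 2 * rho.[t] * rho^`().[t] by rewrite /D dsqr 2!hornerM horner_natr.
  (* By the differential equation all terms cancel except the one in [sonin_w]^2, which comes from
     the derivative of phi. *)
  suff -> : N1.[t] * D^`().[t] - N1^`().[t] * D.[t] = rho.[t] * t * sonin_q.[t] * sonin_w.[t] ^+ 2.
    by apply: mulr_ge0; [rewrite !mulr_ge0 ?(ltW r_gt0) ?(ltW t0) | exact: sqr_ge0].
  rewrite N1E N11E D1E DE q1E w1E r1E.
  suff qr : (1 - t ^+ 2) * (rho.[t] * (- 2 * (lam + 4^-1) * t * p.[t] ^+ 2 + 2 * rho.[t] * p.[t] * p^`().[t] +
      2 * sonin_w.[t] * ((lam + 2^-1) * p.[t] + 2^-1 * t * p^`().[t])) - (- 2 * (lam + 4^-1) * t) * sonin_q.[t])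
      - t * rho.[t] * sonin_q.[t] = - (2^-1 * t * sonin_w.[t] ^+ 2).
    transitivity (- 2 * rho.[t] * sonin_q.[t] * (- (2^-1 * t * sonin_w.[t] ^+ 2))); last by field.
    by rewrite -qr; ring.
  by rewrite sonin_q_at sonin_w_at rho_at; field.
move=> t h; have h1 : 0 <= t <= 1 by lra.
have [fd _] := fD t h1.
by apply/differentiable_continuous/derivable1_diffP.
Qed.

(* The Sonin function of the equation satisfied by sqrt(sin t) p(cos t). *)
Lemma sonin_bound x s : 0 <= x -> 0 < s -> s ^+ 2 + x ^+ 2 = 1 ->
  s * (p.[x] ^+ 2 + (2^-1 * (x * p.[x]) - s ^+ 2 * p^`().[x]) ^+ 2 / ((lam + 4^-1) * s ^+ 2 + 4^-1))
  <= p.[0] ^+ 2 + p^`().[0] ^+ 2 / (lam + 2^-1).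
Proof.
move=> x0 s0 sx.
have x1 : x <= 1 by nra.
have ex : 1 - x ^+ 2 = s ^+ 2 by lra.
have := sonin_mono (x := x); rewrite x0 x1 => /(_ isT).
have r_gt0 t : 0 <= t <= 1 -> 0 < rho.[t] by move=> h; apply: rho_gt0; lra.
have qr t : 0 <= t <= 1 -> sonin_q.[t] ^+ 2 / rho.[t] ^+ 2 =
    (p.[t] ^+ 2 + sonin_w.[t] ^+ 2 / rho.[t]) ^+ 2.
  by move=> h; rewrite sonin_q_at; field; rewrite gt_eqF // r_gt0.
rewrite -mulrA !qr ?lexx ?ler01 ?x0 ?x1 // ex -exprMn.
rewrite ler_pXn2r // ?nnegrE; last 2 first.
- by rewrite mulr_ge0 ?(ltW s0) // addr_ge0 ?sqr_ge0 // divr_ge0 ?sqr_ge0 // ltW // r_gt0 // x0.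
- by rewrite addr_ge0 ?sqr_ge0 // divr_ge0 ?sqr_ge0 // ltW // r_gt0 // lexx ler01.
rewrite !rho_at !sonin_w_at ex expr0n /= subr0 !mul0r mulr0 sub0r !mulr1 mul1r sqrrN.
by rewrite -addrA (_ : 4^-1 + 4^-1 = 2^-1) //; field.
Qed.

(* The energy (1 - x^2) p'^2 + lam p^2 is nondecreasing on [0, 1]. *)
Lemma energy_bound x s : 0 <= x -> 0 < s -> s ^+ 2 + x ^+ 2 = 1 ->
  s ^+ 2 * p^`().[x] ^+ 2 <= lam * p.[1] ^+ 2.
Proof.
move=> x0 s0 sx.
have x1 : x <= 1 by nra.
have ex : 1 - x ^+ 2 = s ^+ 2 by lra.
pose e : {poly R} := (1 - 'X ^+ 2) * p^`() ^+ 2 + lam *: p ^+ 2.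
have eE t : e.[t] = (1 - t ^+ 2) * p^`().[t] ^+ 2 + lam * p.[t] ^+ 2 by rewrite /e !hE.
have : e.[x] <= e.[1].
  apply: (le_of_derive_ge0 (df := fun t => e^`().[t])) => //.
    move=> t ht; split; first exact: is_derive_poly.
    have -> : e^`().[t] = 2 * p^`().[t] * ((1 - t ^+ 2) * p^`()^`().[t] - t * p^`().[t] + lam * p.[t]).
      by rewrite /e derivD derivZ derivM !expr2 !derivM derivB derivC derivM derivX !hE; ring.
    have -> : (1 - t ^+ 2) * p^`()^`().[t] - t * p^`().[t] + lam * p.[t] = t * p^`().[t].
      by rewrite -[RHS]add0r -(p_ode t); ring.
    by have := sqr_ge0 p^`().[t]; nra.
  by move=> t _; exact: continuous_horner.
rewrite !eE ex expr1n subrr mul0r add0r => h; apply: le_trans h.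
by rewrite lerDl mulr_ge0 ?sqr_ge0.
Qed.

End Sonin.

End Real.

(** * Bernstein's inequality, and increments of functions with an integrable singularity *)

Section Real.
Variable R : realType.
Implicit Types (x y t c s : R) (n l : nat).

Lemma deriv_legendre_at n x : (legendre R n)^`().[x] = n%:R * geg 3 n.-1 x 1 / n`!%:R.
Proof.
rewrite /legendre derivZ deriv_geg1 hornerZ hornerM horner_natr muln1.
by rewrite -/(horner_eval x _) geg_morph /= /horner_eval hornerX hornerC; ring.
Qed.

Lemma deriv_legendreN n x : (legendre R n)^`().[- x] ^+ 2 = (legendre R n)^`().[x] ^+ 2.
Proof.
rewrite !deriv_legendre_at.
have -> : geg 3 n.-1 (- x) 1 = geg 3 n.-1 (-1 * x) ((-1) ^+ 2 * 1) by congr geg; ring.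
rewrite geg_homog; set e := (-1) ^+ _; have e2 : e ^+ 2 = 1 by exact: sqrr_sign.
by rewrite -[RHS]mul1r -e2; ring.
Qed.

(** The bound on P_n is read off Sonin's function. The bound on P_n' comes from its other term, the
    square of w = x p / 2 - s^2 p', or from the energy. *)
Lemma legendre_bernstein_ge0 n x s : 0 <= x -> 0 < s -> s ^+ 2 + x ^+ 2 = 1 ->
  s * (legendre R n).[x] ^+ 2 <= 2 / n.+1%:R /\
  s ^+ 3 * (legendre R n)^`().[x] ^+ 2 <= 6 * n.+1%:R.
Proof.
move=> x0 s0 sx.
have lam0 : (0 : R) <= (n * n.+1)%:R by [].
have := le_trans (sonin_bound lam0 (legendre_ode_at n) x0 s0 sx) (legendre_sonin0 R n).
have := energy_bound lam0 (legendre_ode_at n) x0 s0 sx.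
rewrite legendre1 expr1n mulr1.
set p := (legendre R n).[x]; set p' := (legendre R n)^`().[x].
set lam := (n * n.+1)%:R in lam0 *; move=> en.
set w := (_ - _ * p'); set r := (_ * s ^+ 2 + _); move=> so.
have r0 : 0 < r by rewrite /r ltr_wpDl ?mulr_ge0 ?sqr_ge0 //; lra.
have w0 : 0 <= w ^+ 2 / r by rewrite divr_ge0 ?sqr_ge0 // ltW.
set m := n.+1%:R in so *; have m1 : 1 <= m by rewrite ler1n.
have lamE : lam = m * (m - 1) by rewrite /lam /m natrM; ring.
set c := 2 / m in so *; have cE : c * m = 2 by rewrite /c divfK // gt_eqF //; lra.
have c0 : 0 < c by rewrite divr_gt0; lra.
have h1 : s * p ^+ 2 <= c by apply: le_trans so; rewrite ler_pM2l // lerDl.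
have h2 : s * w ^+ 2 <= c * r.
  rewrite -ler_pdivrMr // -mulrA; apply: le_trans so.
  by rewrite ler_pM2l // lerDr sqr_ge0.
split => //.
have [sm|sm] := leP 1 (s * m).
  have h3 : s * (s ^+ 2 * p') ^+ 2 <= 2 * c * r + c / 2.
    have -> : s ^+ 2 * p' = 2^-1 * (x * p) - w by rewrite /w; ring.
    have a1 : (2^-1 * (x * p) - w) ^+ 2 <= 2 * w ^+ 2 + p ^+ 2 / 2.
      have : x ^+ 2 * p ^+ 2 <= 1 * p ^+ 2.
        apply: ler_wpM2r; first exact: sqr_ge0.
        by have := sqr_ge0 s; lra.
      have := sqr_ge0 (2^-1 * (x * p) + w); lra.
    have := ler_wpM2l (ltW s0) a1; lra.
  have h4 : 2 * c * r + c / 2 <= c * (3 * m ^+ 2) * s ^+ 2.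
    have : 1 <= (s * m) ^+ 2 by rewrite exprn_ege1.
    have : 0 <= (m - 1) * c * s ^+ 2 by rewrite mulr_ge0 ?sqr_ge0 // mulr_ge0 ?(ltW c0) //; lra.
    move=> k1 k2.
    have : c * 1 <= c * (s * m) ^+ 2 by rewrite ler_wpM2l // ltW.
    rewrite /r lamE; have : 0 <= c * s ^+ 2 by rewrite mulr_ge0 ?sqr_ge0 ?ltW.
    lra.
  have s2 : 0 < s ^+ 2 by rewrite exprn_gt0.
  rewrite -(ler_pM2r s2).
  have -> : 6 * m * s ^+ 2 = c * (3 * m ^+ 2) * s ^+ 2.
    by transitivity ((c * m) * (3 * m * s ^+ 2)); [rewrite cE|]; ring.
  apply: le_trans h4; apply: le_trans h3; rewrite le_eqVlt; apply/orP; left; apply/eqP; ring.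
have h5 : s ^+ 2 * p' ^+ 2 <= m ^+ 2 by apply: (le_trans en); rewrite lamE; lra.
have := ler_wpM2l (ltW s0) h5.
have : s * m * m <= 1 * m by rewrite ler_wpM2r ?ltW //; lra.
lra.
Qed.

Lemma legendre_bernstein n x s : 0 < s -> s ^+ 2 + x ^+ 2 = 1 ->
  s * (legendre R n).[x] ^+ 2 <= 2 / n.+1%:R /\
  s ^+ 3 * (legendre R n)^`().[x] ^+ 2 <= 6 * n.+1%:R.
Proof.
move=> s0 sx; have [x0|x0] := leP 0 x; first exact: legendre_bernstein_ge0.
have := @legendre_bernstein_ge0 n (- x) s; rewrite sqrrN oppr_ge0 (ltW x0).
rewrite legendreN deriv_legendreN exprMn sqrr_sign mul1r; exact.
Qed.

(** Replaces the integration of |A'| <= K / sqrt(sin t). The comparison function B = sqrt(sin(t/2))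
    - sqrt(cos(t/2)) grows by 2 over [0, pi] and satisfies 3 B' >= 1 / sqrt(sin t), whence 6 K. *)
Lemma bound_increment (A dA : R -> R) (K : R) : 0 <= K ->
  (forall t, is_derive t 1 A (dA t)) ->
  (forall t, 0 < t < pi -> dA t ^+ 2 * sin t <= K ^+ 2) ->
  `|A pi - A 0| <= 6 * K.
Proof.
move=> K0 AD dAK.
pose B t := Num.sqrt (sin (2^-1 * t)) - Num.sqrt (cos (2^-1 * t)).
have pi0 := pi_gt0 R.
pose a t := Num.sqrt (sin (2^-1 * t)); pose b t := Num.sqrt (cos (2^-1 * t)).
have half t : 0 < t < pi -> 0 < sin (2^-1 * t) /\ 0 < cos (2^-1 * t).
  move=> ht; split; first by apply: sin_gt0_pi; lra.
  by apply: cos_gt0_pihalf; lra.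
have dhalf t : is_derive t 1 (fun t => 2^-1 * t) (2^-1 : R).
  by apply: (is_derive_eq (is_deriveZ _ (is_derive_id _ _))); rewrite /GRing.scale /= mulr1.
have BD t : 0 < t < pi -> is_derive t 1 B ((a t ^+ 3 + b t ^+ 3) / (4 * a t * b t)).
  move=> ht; have [s0 c0] := half t ht.
  have e1 := is_derive1_comp (is_derive1_sqrt s0) (is_derive1_comp (is_derive_sin _) (dhalf t)).
  have e2 := is_derive1_comp (is_derive1_sqrt c0) (is_derive1_comp (is_derive_cos _) (dhalf t)).
  apply: (is_derive_eq (is_deriveB e1 e2)); rewrite -/(a t) -/(b t).
  rewrite -(sqr_sqrtr (ltW s0)) -(sqr_sqrtr (ltW c0)) -/(a t) -/(b t).
  have a0 : a t != 0 by rewrite gt_eqF // sqrtr_gt0.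
  have b0 : b t != 0 by rewrite gt_eqF // sqrtr_gt0.
  by field; rewrite a0 b0.
have Bc t : {for t, continuous B}.
  have hc : {for t, continuous (fun t : R => 2^-1 * t)}.
    by apply/differentiable_continuous/derivable1_diffP; case: (dhalf t).
  apply: continuousB.
    apply: (@continuous_comp _ _ _ _ (@Num.sqrt R)); last exact: sqrt_continuous.
    by apply: continuous_comp => //; exact: continuous_sin.
  apply: (@continuous_comp _ _ _ _ (@Num.sqrt R)); last exact: sqrt_continuous.
  by apply: continuous_comp => //; exact: continuous_cos.
have key t : 0 < t < pi -> `|dA t| <= 3 * K * ((a t ^+ 3 + b t ^+ 3) / (4 * a t * b t)).
  move=> ht; have [s0 c0] := half t ht.
  have a0 : 0 < a t by rewrite sqrtr_gt0.
  have b0 : 0 < b t by rewrite sqrtr_gt0.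
  have ab : a t ^+ 4 + b t ^+ 4 = 1.
    by rewrite !(exprM _ 2 2) !sqr_sqrtr ?ltW // addrC cos2Dsin2.
  have sE : sin t = 2 * (a t ^+ 2 * b t ^+ 2).
    rewrite !sqr_sqrtr ?ltW // -{1}[t](_ : 2^-1 * t + 2^-1 * t = _) ?sinD; [ring|by field].
  have a1 : a t <= 1 by rewrite -(@expr_le1 _ 4) ?ltW //; have := exprn_gt0 4 b0; lra.
  have b1 : b t <= 1 by rewrite -(@expr_le1 _ 4) ?ltW //; have := exprn_gt0 4 a0; lra.
  (* From a^4 + b^4 = 1 and a, b <= 1. As sin t = 2 a^2 b^2, this gives 3 B' >= 3 / (4 a b) >= 1 /
     sqrt(sin t). *)
  have ab3 : 1 <= a t ^+ 3 + b t ^+ 3.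
    have : a t * a t ^+ 3 <= 1 * a t ^+ 3 by rewrite ler_wpM2r // ltW // exprn_gt0.
    have : b t * b t ^+ 3 <= 1 * b t ^+ 3 by rewrite ler_wpM2r // ltW // exprn_gt0.
    lra.
  have q0 : 0 < 4 * a t * b t by rewrite !mulr_gt0.
  apply: (@le_trans _ _ (3 * K / (4 * a t * b t))); last first.
    by rewrite ler_wpM2l ?mulr_ge0 // ler_peMl ?invr_ge0 ?(ltW q0).
  rewrite ler_pdivlMr // -(@ler_pXn2r _ 2) ?nnegrE ?mulr_ge0 ?(ltW a0) ?(ltW b0) //.
  rewrite exprMn real_normK ?num_real //.
  have -> : dA t ^+ 2 * (4 * a t * b t) ^+ 2 = 8 * (dA t ^+ 2 * sin t) by rewrite sE; ring.
  by have := dAK t ht; have := sqr_ge0 K; lra.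
have Ac t : {for t, continuous A}.
  by apply/differentiable_continuous/derivable1_diffP; case: (AD t).
have B0 : B 0 = - 1 by rewrite /B mulr0 sin0 cos0 sqrtr0 sqrtr1 sub0r.
have Bpi : B pi = 1.
  by rewrite /B mulrC sin_pihalf cos_pihalf sqrtr0 sqrtr1 subr0.
have mono (e : R) : `|e| = 1 -> 3 * K * B 0 + e * A 0 <= 3 * K * B pi + e * A pi.
  move=> e1; pose f t := 3 * K * B t + e * A t.
  apply: (le_of_derive_ge0 (f := f)
    (df := fun t => 3 * K * ((a t ^+ 3 + b t ^+ 3) / (4 * a t * b t)) + e * dA t)).
  - exact: ltW.
  - move=> t ht; split.
      have e2 := is_deriveD (is_deriveZ (3 * K) (BD t ht)) (is_deriveZ e (AD t)).
      exact: (is_derive_eq e2).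
    have := key t ht; have : `|e * dA t| = `|dA t| by rewrite normrM e1 mul1r.
    by have := ler_norm (- (e * dA t)); rewrite normrN; lra.
  - move=> t _; apply: continuousD; apply: continuousM => //; exact: cst_continuous.
have := mono 1 (normr1 _); have := mono (-1) (normrN1 _).
by rewrite B0 Bpi ler_norml => *; apply/andP; split; lra.
Qed.

End Real.

(** * The coefficients of the addition theorem *)

Section Real.
Variable R : realType.
Implicit Types (x y t c s : R) (n l N L : nat).

(** The zonal harmonic of degree l on the unit sphere of R^N, normalised so that its value at 1 is
    the dimension of the space of harmonics of degree l. *)
Definition zonal N l (z : R) : R := zgeg z 1 N l / l`!%:R.

(** The weights of the addition theorem: up to [Ycst i], which depends on i alone, the squared
    normalisation of [Ptilde i] for N = i - 1. *)
Definition coefY N L l : R :=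
  (2 * L + N)%:R * N.-1`!%:R * (\prod_(r < l) (N + 2 * r)%:R ^+ 2) /
  ((L - l)`!%:R * (L + l + N).-1`!%:R).

Lemma coefY_ge0 N L l : 0 <= coefY N L l.
Proof.
rewrite /coefY divr_ge0 ?mulr_ge0 // prodr_ge0 // => r _; exact: sqr_ge0.
Qed.

(** [geg_addition], rescaled so as to express the zonal function of R^(N+2) by those of R^(N+1): the
    inductive step on the dimension of the sphere. *)
Lemma addition_kernel N L x y s t z : (0 < N)%N -> s ^+ 2 = 1 - x ^+ 2 -> t ^+ 2 = 1 - y ^+ 2 ->
  \sum_(l < L.+1) coefY N L l * (s * t) ^+ l * geg (N + 2 * l) (L - l) x 1
      * geg (N + 2 * l) (L - l) y 1 * zonal N.+1 l z
  = N%:R * zonal N.+2 L (x * y + s * t * z).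
Proof.
move=> N0 sE tE.
(* The cut-off matters: beyond L the truncated subtraction would give (L - l)! = 1, whereas
   [geg_addition] wants b L.+1 = 0. *)
pose b l : R := if (l <= L)%N then
  (\prod_(r < l) (N + 2 * r)%:R ^+ 2) / (l`!%:R * (L - l)`!%:R * (L + l + N).-1`!%:R) else 0.
pose c l : R := b l * ((L - l) * (N + 2 * l))%:R / (L + l + N)%:R.
have LN l : (L + l + N)%:R != 0 :> R by rewrite pnatr_eq0; lia.
have bS l : b l.+1 * l.+1%:R = c l * (N + 2 * l)%:R.
  rewrite /c /b; case: ltnP => h.
    have [n Ln] : exists n, L = (l + n).+1 by exists (L - l.+1)%N; lia.
    rewrite ltnW // big_ord_recr /= factS.
    have -> : (L - l = n.+1)%N by lia.
    have -> : (L - l.+1 = n)%N by lia.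
    have -> : (L + l.+1 + N).-1`! = ((L + l + N) * (L + l + N).-1`!)%N.
      rewrite -[X in (X * _)%N]prednK ?addn_gt0 ?N0 ?orbT // -factS.
      by congr (_`!); lia.
    rewrite factS !natrM; have := LN l; have -> : (L + l + N)%:R = L%:R + l%:R + N%:R :> R by ring.
    by move=> h0; field; rewrite h0 !fact_neq0 !nat1r !pnatr_eq0.
  have -> : ((L - l) * (N + 2 * l) = 0)%N.
    by case: (ltngtP l L) h => //; [lia | move=> -> _; rewrite subnn].
  by rewrite mul0r mulr0 !mul0r.
have cE l : c l * (L + l + N)%:R = b l * ((L - l) * (N + 2 * l))%:R by rewrite /c divfK.
have bL1 : b L.+1 = 0 by rewrite /b ltnn.
have := geg_addition bS cE bL1 N0 x y (s * t * z).
rewrite -sE -tE => H.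
transitivity ((2 * L + N)%:R * N.-1`!%:R * (b 0%N * geg N L 1 1 * geg N L (x * y + s * t * z) 1)).
  rewrite -H mulr_sumr; apply: eq_bigr => -[l lL] _ /=.
  rewrite /b -ltnS lL /coefY /zonal.
  have -> : zgeg (s * t * z) (s ^+ 2 * t ^+ 2) N.+1 l = (s * t) ^+ l * zgeg z 1 N.+1 l.
    rewrite /zgeg -exprMn -[_ ^+ 2]mulr1 !geg_homog.
    case: l {lL} => [|[|l]]; rewrite ?muln0 ?mul0n /=; [by ring..|].
    by rewrite !exprS; ring.
  by field; rewrite !fact_neq0.
rewrite /b leq0n big_ord0 subn0 addn0 /zonal.
have h1 := geg11 R N.-1 L; rewrite prednK // in h1.
have -> : ((L + N).-1 = L + N.-1)%N by lia.
rewrite -h1 [RHS]mulrA -zgegE.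
have : geg N L 1 1 != 0 :> R.
  by apply/eqP => h2; move/eqP: h1; rewrite h2 mul0r eq_sym (negbTE (fact_neq0 _ _)).
by move=> h2; rewrite fact0; field; rewrite h2 !fact_neq0.
Qed.

Lemma zonal_cos l t : zonal 2 l (cos t) = if l == 0%N then 1 else 2 * cos (l%:R * t).
Proof.
rewrite /zonal; case: l => [|l] /=; first by rewrite /zgeg /= geg0 mul0n !mul0r subr0 divr1.
by rewrite zgeg_cos; field; rewrite fact_neq0.
Qed.

Lemma zonal_legendre l z : zonal 3 l z = (2 * l + 1)%:R * (legendre R l).[z].
Proof. by rewrite /zonal legendreE mulrA zgegE mul1r. Qed.

Definition cos_prim (m : int) (t : R) : R :=
  if m == 0 then t else sin (m%:~R * t) / m%:~R.

Lemma is_derive_cos_prim m t : is_derive t 1 (cos_prim m) (cos (m%:~R * t)).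
Proof.
rewrite /cos_prim; have [->|m0] := eqVneq m 0.
  by rewrite mul0r cos0; exact: is_derive_id.
have m0' : m%:~R != 0 :> R by rewrite intr_eq0.
have e0 : is_derive t 1 (fun t => m%:~R * t) (m%:~R : R).
  by apply: (is_derive_eq (is_deriveZ _ (is_derive_id _ _))); rewrite /GRing.scale /= mulr1.
have e1 := is_deriveZ (m%:~R^-1) (is_derive1_comp (is_derive_sin _) e0).
rewrite [X in is_derive _ _ X](_ : _ = m%:~R^-1 \*: (sin \o *%R m%:~R : R -> R)); last first.
  by apply/funext => u /=; rewrite mulrC.
by apply: (is_derive_eq e1); rewrite /GRing.scale /=; field.
Qed.

Lemma sin_intpi (m : int) : sin (m%:~R * pi) = 0 :> R.
Proof.
have h n : sin (n%:R * pi) = 0 :> R.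
  by elim: n => [|n IH]; rewrite ?mul0r ?sin0 // -natr1 mulrDl mul1r sinD IH sinpi; ring.
by case: m => n; [exact: h|rewrite NegzE mulrNz mulNr sinN h oppr0].
Qed.

Lemma cos_prim_pi m : cos_prim m pi - cos_prim m 0 = if m == 0 then pi else 0.
Proof.
rewrite /cos_prim; case: eqP => _; first by rewrite subr0.
by rewrite sin_intpi mulr0 sin0 !mul0r subr0.
Qed.

(** A primitive of cos (l t) [zonal 2 m] (cos t), by the product formula for cosines. Its increment
    over [0, pi] states their orthogonality without an integral. *)
Definition cos_zonal_prim (l m : nat) (t : R) : R :=
  if m == 0%N then cos_prim l%:Z t else cos_prim (l%:Z + m%:Z) t + cos_prim (l%:Z - m%:Z) t.

Lemma is_derive_cos_zonal_prim l m t :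
  is_derive t 1 (cos_zonal_prim l m) (cos (l%:R * t) * zonal 2 m (cos t)).
Proof.
rewrite /cos_zonal_prim zonal_cos; case: eqP => _.
  by rewrite mulr1; exact: is_derive_cos_prim.
apply: (is_derive_eq (is_deriveD (is_derive_cos_prim _ t) (is_derive_cos_prim _ t))).
by rewrite rmorphB rmorphD /= !mulrDl mulNr cosB cosD; ring.
Qed.

Lemma cos_zonal_prim_pi l m :
  cos_zonal_prim l m pi - cos_zonal_prim l m 0 = if l == m then pi else 0.
Proof.
rewrite /cos_zonal_prim; case: m => [|m] /=; first by rewrite cos_prim_pi.
rewrite opprD addrACA !cos_prim_pi.
have -> : (l%:Z + m.+1%:Z == 0) = false by lia.
by rewrite add0r subr_eq0 eqz_nat.
Qed.

(* By the addition theorem at two equal angles, the left-hand side is a Fourier coefficient of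
   t |-> (2 L + 1) P_L(x^2 + s^2 cos t), whose size is controlled by Bernstein's inequality. *)
Lemma coefY1_bound x s L l : 0 < s -> s ^+ 2 = 1 - x ^+ 2 -> (l <= L)%N ->
  coefY 1 L l * s ^+ l ^+ 2 * geg (1 + 2 * l) (L - l) x 1 ^+ 2
  <= 6 * Num.sqrt (8 / s) * Num.sqrt L.+1%:R.
Proof.
move=> s0 sE lL.
pose V m := coefY 1 L m * s ^+ m ^+ 2 * geg (1 + 2 * m) (L - m) x 1 ^+ 2.
have V0 m : 0 <= V m by rewrite /V mulr_ge0 ?sqr_ge0 // mulr_ge0 ?sqr_ge0 ?coefY_ge0.
pose A (t : R) := \sum_(m < L.+1) V m * cos_zonal_prim l m t.
pose dA (t : R) := cos (l%:R * t) * ((2 * L + 1)%:R * (legendre R L).[x ^+ 2 + s ^+ 2 * cos t]).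
have dAE t : dA t = \sum_(m < L.+1) V m * (cos (l%:R * t) * zonal 2 m (cos t)).
  rewrite /dA -zonal_legendre; have := @addition_kernel 1 L x x s s (cos t) isT sE sE.
  rewrite mul1r -!expr2 => <-; rewrite mulr_sumr; apply: eq_bigr => m _.
  by rewrite /V -exprM mulnC exprM; ring.
have AD t : is_derive t 1 A (dA t).
  rewrite dAE; pose f (m : 'I_L.+1) (t : R) := V m * cos_zonal_prim l m t.
  rewrite [A](_ : _ = \sum_(m < L.+1) f m); last by apply/funext => u; rewrite fct_sumE.
  by apply: is_derive_sum => m; apply: is_deriveZ; exact: is_derive_cos_zonal_prim.
have Apl : A pi - A 0 = V l * pi.
  rewrite /A -sumrB (bigD1 (Ordinal (lL : (l < L.+1)%N))) //= -mulrBr cos_zonal_prim_pi eqxx.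
  rewrite big1 ?addr0 // => m ml; rewrite -mulrBr cos_zonal_prim_pi.
  by case: eqP => [e|_]; rewrite ?mulr0 //; move/eqP: ml; case; apply: val_inj.
(* K^2 is (2 (L+1))^2 times Bernstein's 2 / (L+1), divided by s. *)
pose K := Num.sqrt (8 / s) * Num.sqrt L.+1%:R.
have K0 : 0 <= K by rewrite mulr_ge0 ?sqrtr_ge0.
have := bound_increment K0 AD; rewrite Apl => H.
suff dAK t : 0 < t < pi -> dA t ^+ 2 * sin t <= K ^+ 2.
  have := H dAK; have pi2 := pi_ge2 R.
  rewrite (ger0_norm (mulr_ge0 (V0 l) (pi_ge0 R))) -/(V l) -mulrA -/K.
  by have := V0 l; nra.
move=> tpi.
have st : 0 < sin t by exact: sin_gt0_pi.
have ct := cos2Dsin2 t.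
pose u := x ^+ 2 + s ^+ 2 * cos t.
(* The weight sqrt(1 - u^2) of Bernstein's inequality at u dominates s sin t, and sin t is exactly
   the weight that [bound_increment] accepts. *)
have uE : s ^+ 2 * sin t ^+ 2 <= 1 - u ^+ 2.
  have c1 : 0 <= 1 - cos t by rewrite subr_ge0 cos_le1.
  have -> : 1 - u ^+ 2 = s ^+ 2 * sin t ^+ 2 + s ^+ 2 * (1 - s ^+ 2) * (1 - cos t) ^+ 2.
    have xx : x ^+ 2 = 1 - s ^+ 2 by lra.
    have ss : sin t ^+ 2 = 1 - cos t ^+ 2 by lra.
    by rewrite /u xx ss; ring.
  rewrite lerDl mulr_ge0 ?sqr_ge0 // mulr_ge0 ?sqr_ge0 //.
  by have := sqr_ge0 x; lra.
have stp : 0 < s * sin t by rewrite mulr_gt0.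
have u0 : 0 < 1 - u ^+ 2 by apply: lt_le_trans uE; rewrite -exprMn exprn_gt0.
have su0 : 0 < Num.sqrt (1 - u ^+ 2) by rewrite sqrtr_gt0.
have su2 : Num.sqrt (1 - u ^+ 2) ^+ 2 + u ^+ 2 = 1 by rewrite sqr_sqrtr ?ltW // subrK.
have [B _] := legendre_bernstein L su0 su2.
have B' : s * sin t * (legendre R L).[u] ^+ 2 <= 2 / L.+1%:R.
  apply: le_trans B; rewrite ler_wpM2r ?sqr_ge0 //.
  by rewrite -{1}(ger0_norm (ltW stp)) -sqrtr_sqr ler_wsqrtr // exprMn.
have K2 : K ^+ 2 = 8 * L.+1%:R / s.
  by rewrite /K exprMn !sqr_sqrtr ?divr_ge0 ?ltW // mulrAC.
rewrite K2 ler_pdivlMr //.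
rewrite /dA -/u; set p := (legendre R L).[u] in B' *.
have L1 : (0 : R) < L.+1%:R by [].
move: B'; rewrite ler_pdivlMr // => B'.
have c2 : cos (l%:R * t) ^+ 2 <= 1 by have := cos2Dsin2 (l%:R * t); have := sqr_ge0 (sin (l%:R * t)); lra.
have q0 : 0 <= s * sin t * p ^+ 2 by rewrite mulr_ge0 ?sqr_ge0 // ltW.
have -> : (cos (l%:R * t) * ((2 * L + 1)%:R * p)) ^+ 2 * sin t * s =
  cos (l%:R * t) ^+ 2 * ((2 * L + 1)%:R ^+ 2 * (s * sin t * p ^+ 2)) by ring.
apply: (@le_trans _ _ (1 * ((2 * L.+1%:R) ^+ 2 * (s * sin t * p ^+ 2)))).
  apply: ler_pM => //; [exact: sqr_ge0|by rewrite mulr_ge0 ?sqr_ge0|].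
  rewrite ler_wpM2r // ler_pXn2r ?nnegrE //.
  have -> : (2 * L + 1)%:R = 2 * L.+1%:R - 1 :> R by ring.
  by lra.
have := ler_wpM2l (ltW L1) B'; lra.
Qed.

End Real.

(** * The case N = 2, by Legendre coefficients *)

Section Real.
Variable R : realType.
Implicit Types (x y t c s : R) (n l N L : nat).

(** Q is (1 - x^2)(p q' - p' q) divided by the difference of the eigenvalues; it vanishes at both
    end points. *)
Lemma legendre_orth (l m : nat) : l != m ->
  exists2 Q : {poly R}, Q^`() = legendre R l * legendre R m & Q.[1] = Q.[-1].
Proof.
move=> lm; set p := legendre R l; set q := legendre R m.
pose a : R := (l * l.+1)%:R - (m * m.+1)%:R.
have a0 : a != 0.
  rewrite /a subr_eq0 eqr_nat; apply/eqP => e; move/eqP: lm; apply.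
  by case: (ltngtP l m) => // h; exfalso; nia.
exists (a^-1 *: ((1 - 'X ^+ 2) * (p * q^`() - p^`() * q))); last first.
  by rewrite !hornerZ !hornerM !(hornerD, hornerN, horner_exp, hornerX, hornerC) sqrrN expr1n subrr !mul0r.
rewrite derivZ; apply: (scalerI a0); rewrite scalerA divff // scale1r.
rewrite -mul_polyC /a rmorphB /= !polyC_natr.
have op := legendre_ode R l; have oq := legendre_ode R m; rewrite -/p -/q in op oq.
have dS : (1 - 'X ^+ 2 : {poly R})^`() = - (2%:R * 'X).
  by rewrite derivB -[1]polyC1 derivC expr2 derivM derivX; ring.
rewrite derivM dS derivB !derivM.
transitivity (p * ((1 - 'X ^+ 2) * q^`()^`() - 2%:R * 'X * q^`())
            - q * ((1 - 'X ^+ 2) * p^`()^`() - 2%:R * 'X * p^`())); first by ring.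
have -> : (1 - 'X ^+ 2) * q^`()^`() - 2%:R * 'X * q^`() = - ((m * m.+1)%:R * q).
  by apply/eqP; rewrite -addr_eq0 oq.
have -> : (1 - 'X ^+ 2) * p^`()^`() - 2%:R * 'X * p^`() = - ((l * l.+1)%:R * p).
  by apply/eqP; rewrite -addr_eq0 op.
ring.
Qed.

(** P_{m+2}' = P_m' + (2m+3) P_{m+1} writes P_m' in Legendre polynomials of degree below m, all
    orthogonal to P_l. *)
Lemma legendre_deriv_orth (l m : nat) : (m <= l)%N ->
  exists2 Q : {poly R}, Q^`() = legendre R l * (legendre R m)^`() & Q.[1] = Q.[-1].
Proof.
elim/ltn_ind: m => m IH ml.
case: m IH ml => [|[|m]] IH ml.
- exists 0; last by rewrite !horner0.
  by rewrite /legendre geg0 alg_polyC !derivC mulr0.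
- have [|Q QE Q1] := @legendre_orth l 0; first by lia.
  exists Q => //; rewrite QE; congr (_ * _).
  have [_] := legendre_rec R 0; rewrite (_ : (legendre R 0)^`() = 0) ?mulr0 ?subr0 ?mul1r => [<- //|].
  by rewrite /legendre geg0 alg_polyC derivC.
- have [//|//|Q1 Q1E Q1e] := IH m; first by lia.
  have [|Q2 Q2E Q2e] := @legendre_orth l m.+1; first by lia.
  exists (Q1 + (2 * m + 3)%:R * Q2); last by rewrite !hornerD !hornerM !horner_natr Q1e Q2e.
  rewrite derivD derivM deriv_natr Q1E Q2E.
  have [a _] := legendre_rec R m; have [_ b] := legendre_rec R m.+1.
  transitivity (legendre R l * ((legendre R m)^`() + m.+1%:R * legendre R m.+1 + m.+2%:R * legendre R m.+1)).
    by ring.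
  by congr (_ * _); rewrite -a -b; ring.
Qed.

(** For l = m, (x P_l^2)' = (2l+1) P_l^2 + 2 P_l (x P_l' - l P_l), and x P_l' - l P_l = P_{l-1}' is
    orthogonal to P_l. *)
Lemma legendre_prim (l m : nat) :
  exists2 Q : {poly R}, Q^`() = legendre R l * ((2 * m + 1)%:R * legendre R m)
    & Q.[1] - Q.[-1] = if l == m then 2 else 0.
Proof.
have [<-{m}|lm] := eqVneq l m; last first.
  have [Q QE Q1] := legendre_orth lm; exists ((2 * m + 1)%:R * Q).
    by rewrite derivM deriv_natr QE; ring.
  by rewrite !hornerM !horner_natr Q1 subrr.
have [Q QE Q1] : exists2 Q : {poly R}, Q^`() = legendre R l * ('X * (legendre R l)^`() - l%:R * legendre R l)
    & Q.[1] = Q.[-1].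
  case: l => [|l].
    exists 0; rewrite ?horner0 // derivC /legendre geg0 alg_polyC derivC; ring.
  have [Q QE Q1] := legendre_deriv_orth (leqnSn l).
  by exists Q => //; rewrite QE; have [<- _] := legendre_rec R l; congr (_ * _); ring.
exists ('X * legendre R l ^+ 2 - 2%:R * Q).
  by rewrite derivB !derivM derivX deriv_natr QE; ring.
rewrite 2!hornerD 2!hornerN !(hornerM, hornerX, horner_natr) Q1 legendreN legendre1.
set e := (-1) ^+ l; have e2 : e ^+ 2 = 1 by exact: sqrr_sign.
by transitivity (1 + e ^+ 2); [ring | rewrite e2; ring].
Qed.

Lemma horner_inj (p q : {poly R}) : (forall z, p.[z] = q.[z]) -> p = q.
Proof.
move=> pq; apply/eqP; rewrite -subr_eq0; apply/negPn/negP => d0.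
have := @max_poly_roots _ (p - q) [seq i%:R | i <- iota 0 (size (p - q))] d0.
rewrite size_map size_iota ltnn => h; apply: notF; apply: h.
  by apply/allP => z _; rewrite /root hornerD hornerN pq subrr.
by rewrite map_inj_uniq ?iota_uniq // => i j /eqP; rewrite eqr_nat => /eqP.
Qed.

(* As for [coefY1_bound], with Legendre coefficients; integrating by parts makes P_l' appear,
   for which Bernstein's inequality holds as well. *)
Lemma coefY2_bound x s L l : 0 < s -> s ^+ 2 = 1 - x ^+ 2 -> (l <= L)%N ->
  coefY R 2 L l * s ^+ l ^+ 2 * geg (2 + 2 * l) (L - l) x 1 ^+ 2
  <= 20 / s ^+ 2 * Num.sqrt L.+1%:R.
Proof.
move=> s0 sE lL.
pose V m := coefY R 2 L m * s ^+ m ^+ 2 * geg (2 + 2 * m) (L - m) x 1 ^+ 2.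
have V0 m : 0 <= V m by rewrite /V mulr_ge0 ?sqr_ge0 // mulr_ge0 ?sqr_ge0 ?coefY_ge0.
have s2 : 0 < s ^+ 2 by rewrite exprn_gt0.
have s2n : s ^+ 2 != 0 by rewrite gt_eqF.
pose P := legendre R l.
have /choice[Q QE] : forall m, exists Q : {poly R},
   Q^`() = P * ((2 * m + 1)%:R * legendre R m) /\ Q.[1] - Q.[-1] = if l == m then 2 else 0.
  by move=> m; have [Q h1 h2] := legendre_prim l m; exists Q.
pose AP : {poly R} := \sum_(m < L.+1) (V m)%:P * Q m.
pose U : {poly R} := (x ^+ 2)%:P + (s ^+ 2)%:P * 'X.
pose F : {poly R} := (2 / L`!%:R * L.+1%:R)%:P * geg 2 L U 1.
(* F is 2 (L+1) times a Chebyshev polynomial of the second kind at [U], so its primitive G is 2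
   T_{L+1}([U]) / s^2: on [-1, 1] it is bounded by 2 / s^2, whatever L is. *)
pose G : {poly R} := ((L.+1)`!%:R^-1 / s ^+ 2)%:P * zgeg U 1 2 L.+1.
have UE z : U.[z] = x ^+ 2 + s ^+ 2 * z by rewrite /U !hornerE.
have evg N n z : (geg N n U 1).[z] = geg N n U.[z] 1.
  by rewrite -/(horner_eval z _) geg_morph /= /horner_eval hornerC.
have dG : G^`() = F.
  rewrite /G derivM derivC mul0r add0r (@deriv_zgeg _ _ _ _ _ 0); last first.
    by rewrite -[1]polyC1 derivC; ring.
  have -> : U^`() = (s ^+ 2)%:P by rewrite /U derivD derivC derivM derivC derivX; ring.
  rewrite mulr0 subr0 /F.
  rewrite [X in _ * X](_ : _ = (((2 * L + 2) * L.+1)%:R * s ^+ 2)%:P * geg 2 L U 1); last first.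
    by rewrite [in RHS]polyCM polyC_natr natrM; ring.
  rewrite mulrA -polyCM; congr (_%:P * _); rewrite factS !natrM natrD natrM.
  by field; rewrite fact_neq0 (gt_eqF s0) nat1r pnatr_eq0.
have FE z : F.[z] = \sum_(m < L.+1) V m * ((2 * m + 1)%:R * legendre R m).[z].
  rewrite /F hornerM hornerC evg UE.
  have := @addition_kernel R 2 L x x s s z isT sE sE.
  rewrite -!expr2 => h.
  transitivity (2%:R * zonal 4 L (x ^+ 2 + s ^+ 2 * z)).
    by rewrite /zonal mulrA -zgegE natrD natrM -natr1; ring.
  rewrite -h; apply: eq_bigr => m _; rewrite hornerM horner_natr zonal_legendre.
  by rewrite /V -exprM mulnC exprM; ring.
have dAP : AP^`() = F * P.
  have -> : F = \sum_(m < L.+1) (V m)%:P * ((2 * m + 1)%:R * legendre R m).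
    apply: horner_inj => z; rewrite FE horner_sum.
    by apply: eq_bigr => m _; rewrite [RHS]hornerM hornerC.
  rewrite /AP raddf_sum mulr_suml; apply: eq_bigr => m _ /=.
  by rewrite derivM derivC (QE m).1; ring.
have APl : AP.[1] - AP.[-1] = 2 * V l.
  rewrite /AP !horner_sum -sumrB (bigD1 (Ordinal (lL : (l < L.+1)%N))) //=.
  rewrite !hornerM !hornerC -mulrBr (QE l).2 eqxx big1 ?addr0 1?mulrC // => m ml.
  rewrite !hornerM !hornerC -mulrBr (QE m).2.
  by case: eqP => [e|_]; rewrite ?mulr0 //; move/eqP: ml; case; apply: val_inj.
(* Integration by parts: 2 V l is the increment of H plus that of G P, and H' involves the bounded G
   instead of F. *)
pose H := AP - G * P.
have dH : H^`() = - (G * P^`()) by rewrite /H derivB derivM dAP dG; ring.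
have Gb t : (G.[cos t]) ^+ 2 <= 4 / s ^+ 2 ^+ 2.
  have [v vE] : exists v, U.[cos t] = cos v.
    exists (acos U.[cos t]); rewrite acosK // in_itv /= UE.
    have := cos_le1 t; have := cos_geN1 t => c1 c2.
    have : s ^+ 2 <= 1 by have := sqr_ge0 x; lra.
    by move=> s1; apply/andP; split; nra.
  have -> : G.[cos t] = 2 * cos (L.+1%:R * v) / s ^+ 2.
    rewrite /G hornerM hornerC /zgeg hornerD hornerN 2!hornerM !evg horner_natr hornerC vE.
    rewrite -/(zgeg (cos v) 1 2 L.+1) zgeg_cos.
    by field; rewrite fact_neq0 (gt_eqF s0).
  rewrite exprMn exprVn ler_pM2r ?invr_gt0 ?exprn_gt0 //.
  by have := cos2Dsin2 (L.+1%:R * v); have := sqr_ge0 (sin (L.+1%:R * v)); lra.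
pose A (t : R) := H.[cos t].
pose dA (t : R) := sin t * (G.[cos t] * P^`().[cos t]).
have AD t : is_derive t 1 A (dA t).
  apply: (is_derive_eq (is_derive1_comp (is_derive_poly H _) (is_derive_cos t))).
  by rewrite dH hornerN hornerM /dA; ring.
pose K := Num.sqrt (24 * l.+1%:R) / s ^+ 2.
have K0 : 0 <= K by rewrite divr_ge0 ?sqrtr_ge0 ?ltW.
have := bound_increment K0 AD.
have dAK t : 0 < t < pi -> dA t ^+ 2 * sin t <= K ^+ 2.
  move=> tpi; have st : 0 < sin t by exact: sin_gt0_pi.
  have sc : sin t ^+ 2 + cos t ^+ 2 = 1 by rewrite addrC cos2Dsin2.
  have [_ B] := legendre_bernstein l st sc.
  have K2 : K ^+ 2 = (4 / s ^+ 2 ^+ 2) * (6 * l.+1%:R).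
    by rewrite /K exprMn sqr_sqrtr ?mulr_ge0 // exprVn; ring.
  rewrite K2 /dA.
  have -> : (sin t * (G.[cos t] * P^`().[cos t])) ^+ 2 * sin t =
     G.[cos t] ^+ 2 * (sin t ^+ 3 * P^`().[cos t] ^+ 2) by ring.
  apply: ler_pM => //; first exact: sqr_ge0.
  by rewrite mulr_ge0 ?sqr_ge0 // exprn_ge0 // ltW.
move=> /(_ dAK); rewrite /A cospi cos0.
have -> : H.[-1] - H.[1] = - (2 * V l) + (G.[1] - G.[-1] * (-1) ^+ l).
  rewrite -APl /H !(hornerD, hornerN, hornerM) /P legendreN legendre1; ring.
have G1 : `|G.[1]| <= 2 / s ^+ 2.
  have := Gb 0; rewrite cos0 => h; rewrite -(@ler_pXn2r _ 2) ?nnegrE ?divr_ge0 ?(ltW s2) //.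
  rewrite real_normK ?num_real //; apply: (le_trans h).
  by rewrite expr_div_n ler_pM2r ?invr_gt0 ?exprn_gt0 //; lra.
have GN1 : `|G.[-1] * (-1) ^+ l| <= 2 / s ^+ 2.
  have := Gb pi; rewrite cospi => h; rewrite normrM normrX normrN1 expr1n mulr1.
  rewrite -(@ler_pXn2r _ 2) ?nnegrE ?divr_ge0 ?(ltW s2) //.
  rewrite real_normK ?num_real //; apply: (le_trans h).
  by rewrite expr_div_n ler_pM2r ?invr_gt0 ?exprn_gt0 //; lra.
have S1 : 1 <= Num.sqrt L.+1%:R :> R by rewrite -{1}(sqrtr1 R) ler_wsqrtr // ler1n.
(* As 24 <= 25 and l <= L. Then 2 V l <= (6 . 5 + 4) sqrt(L+1) / s^2, which leaves room for the
   constant 20. *)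
have KL : K <= 5 / s ^+ 2 * Num.sqrt L.+1%:R.
  rewrite /K [leRHS]mulrAC ler_wpM2r ?invr_ge0 ?(ltW s2) //.
  rewrite -(@ler_pXn2r _ 2) ?nnegrE ?mulr_ge0 ?sqrtr_ge0 // exprMn !sqr_sqrtr ?mulr_ge0 //.
  have : l.+1%:R <= L.+1%:R :> R by rewrite ler_nat.
  have : 0 <= L.+1%:R :> R by [].
  lra.
rewrite -/(V l); move: S1 KL.
have i0 : 0 < (s ^+ 2)^-1 by rewrite invr_gt0.
set i := (s ^+ 2)^-1 in i0 G1 GN1 *; set r := Num.sqrt _ => r1 KL.
have : i * 1 <= i * r by rewrite ler_wpM2l // ltW.
move: G1 GN1; rewrite !ler_norml => /andP[? ?] /andP[? ?] ? /andP[? ?].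
lra.
Qed.

End Real.

(** * Power series of subexponential growth *)

Section Real.
Variable R : realType.
Implicit Types (x y t c s : R) (n l N L : nat).

(** N + 2 + 2 l = N + 2 (l+1) and L - l = (L+1) - (l+1): the Gegenbauer polynomial attached to (N+2,
    L, l) is that of (N, L+1, l+1), and the weights are proportional. This carries bounds from N to
    N + 2. *)
Lemma coefYSS N L l : (0 < N)%N ->
  coefY R N.+2 L l = N.+1%:R / N%:R * coefY R N L.+1 l.+1.
Proof.
move=> N0; have N0' : N%:R != 0 :> R by rewrite pnatr_eq0 -lt0n.
rewrite /coefY big_ord_recl /= muln0 addn0 subSS.
have -> : (L + l + N.+2).-1 = (L.+1 + l.+1 + N).-1 by lia.
have -> : (2 * L + N.+2 = 2 * L.+1 + N)%N by lia.
have -> : \prod_(i < l) (N + 2 * bump 0 i)%:R ^+ 2 = \prod_(i < l) (N.+2 + 2 * i)%:R ^+ 2 :> R.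
  by apply: eq_bigr => i _; congr (_%:R ^+ _); rewrite /bump; lia.
have -> : (N.+2.-1`! = N.+1 * (N * N.-1`!))%N by rewrite /= factS -{2}(prednK N0) factS prednK.
rewrite !natrM.
set p := \prod_(i < l) _; field.
by rewrite !fact_neq0 N0'.
Qed.

Lemma coefY_bound N x s : (0 < N)%N -> 0 < s -> s ^+ 2 = 1 - x ^+ 2 ->
  exists2 C : R, 0 <= C & forall L l, (l <= L)%N ->
    coefY R N L l * s ^+ l ^+ 2 * geg (N + 2 * l) (L - l) x 1 ^+ 2 <= C * Num.sqrt L.+1%:R.
Proof.
move=> + s0 sE; elim/ltn_ind: N => -[//|[|[|N]]] IH _.
- exists (6 * Num.sqrt (8 / s)) => [|L l]; first by rewrite mulr_ge0 ?sqrtr_ge0.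
  exact: coefY1_bound.
- exists (20 / s ^+ 2) => [|L l]; first by rewrite divr_ge0 // exprn_ge0 // ltW.
  exact: coefY2_bound.
have [|//|C C0 CP] := IH N.+1; first by [].
(* The order l + 1 brings one more factor s^2, which is divided out here. *)
pose a : R := N.+2%:R / N.+1%:R / s ^+ 2.
have a0 : 0 <= a by rewrite divr_ge0 // exprn_ge0 // ltW.
exists (2 * a * C) => [|L l lL]; first by apply: mulr_ge0 => //; apply: mulr_ge0.
rewrite coefYSS //; have := CP L.+1 l.+1 lL; rewrite subSS.
have -> : (N.+1 + 2 * l.+1 = N.+3 + 2 * l)%N by lia.
have sL : Num.sqrt L.+2%:R <= 2 * Num.sqrt L.+1%:R :> R.
  rewrite -(@ler_pXn2r _ 2) ?nnegrE ?mulr_ge0 ?sqrtr_ge0 // exprMn !sqr_sqrtr //.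
  have : 1 <= L.+1%:R :> R by rewrite ler1n.
  by rewrite -[L.+2%:R]natr1; lra.
move=> h; have := ler_wpM2l a0 (le_trans h (ler_wpM2l C0 sL)).
set g := geg _ _ _ _; set k := coefY _ _ _ _; move=> h'.
have -> : N.+2%:R / N.+1%:R * k * s ^+ l ^+ 2 * g ^+ 2 = a * (k * s ^+ l.+1 ^+ 2 * g ^+ 2).
  by rewrite /a (exprS s l); field; rewrite (gt_eqF s0) nat1r pnatr_eq0.
by apply: (le_trans h'); rewrite le_eqVlt; apply/orP; left; apply/eqP; ring.
Qed.

(** Radius of convergence at least 1, in a form that survives termwise differentiation and admits
    vanishing coefficients, as in terminating series. *)
Definition subexp (f : nat -> R) :=
  forall rho : R, 1 < rho -> exists2 C : R, 0 <= C & forall n, `|f n| <= C * rho ^+ n.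

Lemma subexp_ratio (f : nat -> R) :
  (forall rho : R, 1 < rho -> exists N, forall n, (N <= n)%N -> `|f n.+1| <= rho * `|f n|) ->
  subexp f.
Proof.
move=> H rho rho1; have [N NP] := H rho rho1.
exists (\sum_(m < N.+1) `|f m|); first exact: sumr_ge0.
have r0 : 0 <= rho by lra.
elim=> [|n IH].
  by rewrite expr0 mulr1 big_ord_recl lerDl sumr_ge0.
have [nN|nN] := leqP N n.
  by apply: (le_trans (NP n nN)); rewrite exprS mulrCA ler_wpM2l.
rewrite (bigD1 (Ordinal (nN : (n.+1 < N.+1)%N))) //= mulrDl.
apply: (@le_trans _ _ (`|f n.+1| * rho ^+ n.+1)).
  by rewrite ler_peMr // exprn_ege1 // ltW.
by rewrite lerDl mulr_ge0 ?exprn_ge0 // sumr_ge0.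
Qed.

Lemma subexp_cvg (f : nat -> R) x : subexp f -> `|x| < 1 -> cvgn (pseries f x).
Proof.
move=> sf x1.
(* So that rho > 1 while rho |x| < 1. *)
pose rho := 2 / (1 + `|x|).
have nx := normr_ge0 x.
have r1 : 1 < rho by rewrite /rho ltr_pdivlMr; lra.
have r0 : 0 <= rho by lra.
have [C C0 CP] := sf rho r1.
apply: normed_cvg.
apply: (@series_le_cvg _ _ (geometric C (rho * `|x|))) => [n|n|n|]; rewrite /geometric /=.
- exact: normr_ge0.
- by apply: mulr_ge0 => //; apply: exprn_ge0; exact: mulr_ge0.
- by rewrite normrM normrX exprMn mulrA ler_wpM2r // exprn_ge0.
apply: is_cvg_geometric_series; rewrite (ger0_norm (mulr_ge0 r0 nx)).
by rewrite /rho mulrAC ltr_pdivrMr; lra.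
Qed.

Lemma subexp_diffs (f : nat -> R) : subexp f -> subexp (pseries_diffs f).
Proof.
move=> sf rho rho1.
(* One factor sqrt(rho) serves the coefficients, the other the factor n + 1 of the derivative. *)
pose s := Num.sqrt rho.
have s1 : 1 < s by rewrite /s -(sqrtr1 R) ltr_sqrt; lra.
have [C C0 CP] := sf s s1.
have [D D0 DP] : exists2 D : R, 0 <= D & forall n, n.+1%:R <= D * s ^+ n.
  exists (1 + (s - 1)^-1); first by rewrite addr_ge0 // invr_ge0; lra.
  elim=> [|n IH]; first by rewrite expr0 mulr1 lerDl invr_ge0; lra.
  have e : 1 <= s ^+ n by rewrite exprn_ege1 // ltW.
  rewrite -natr1 exprS.
  have : 1 <= (1 + (s - 1)^-1) * (s - 1) by rewrite mulrDl mulVf ?lerDr; lra.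
  move=> h; set D := 1 + (s - 1)^-1 in IH h *; have : 1 * 1 <= (D * (s - 1)) * s ^+ n by apply: ler_pM.
  move: IH; clearbody D; lra.
exists (D * C * s); first by rewrite !mulr_ge0 //; lra.
move=> n; rewrite /pseries_diffs normrM ger0_norm //.
apply: (@le_trans _ _ ((D * s ^+ n) * (C * s ^+ n.+1))); first by apply: ler_pM.
have -> : rho = s ^+ 2 by rewrite sqr_sqrtr //; lra.
by rewrite exprS -exprM mulnC exprM le_eqVlt; apply/orP; left; apply/eqP; ring.
Qed.

Lemma is_derive_pseries (f : nat -> R) x : subexp f -> `|x| < 1 ->
  is_derive x 1 (fun z => limn (pseries f z)) (limn (pseries (pseries_diffs f) x)).
Proof.
move=> sf x1.
pose K := (1 + `|x|) / 2; have nx := normr_ge0 x.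
have K0 : 0 <= K by rewrite /K; lra.
have K1 : `|K| < 1 by rewrite ger0_norm // /K; lra.
have sd := subexp_diffs sf.
apply: (@pseries_snd_diffs R f K x).
- exact: subexp_cvg.
- exact: subexp_cvg.
- by apply: subexp_cvg => //; exact: subexp_diffs.
- by rewrite (ger0_norm K0) /K; lra.
Qed.

(** Multiplying the n-th coefficient by a + n is the action of the Euler operator z d/dz + a. *)
Lemma pseries_euler (f g : nat -> R) (a z : R) : subexp f -> `|z| < 1 ->
  (forall n, g n = (a + n%:R) * f n) ->
  limn (pseries g z) = z * limn (pseries (pseries_diffs f) z) + a * limn (pseries f z).
Proof.
move=> sf z1 gf; apply: cvg_lim => //.
have cd := subexp_cvg (subexp_diffs sf) z1.
have cf := subexp_cvg sf z1.
have h := pseries_diffs_equiv cd.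
rewrite [pseries g z](_ : _ = (fun n => z * series (fun i => i%:R * f i * z ^+ i.-1) n
     + a * pseries f z n)); last first.
  apply/funext => n; rewrite /pseries /series /= !mulr_sumr -big_split /=.
  by apply: eq_bigr => -[|i] _; rewrite gf ?exprS /=; ring.
by apply: cvgD; apply: cvgM => //; exact: cvg_cst.
Qed.

End Real.

(** * Gamma and Ferrers functions at integers and half-integers *)

Section Real.
Variable R : realType.
Implicit Types (x y t c s : R) (n l N L : nat).

Definition rGamma_seq x : nat -> R :=
  fun n => pochhammer x n.+1 / (n`!%:R * n%:R `^ x).

Lemma pochhammerSr x n : pochhammer x n.+1 = pochhammer x n * (x + n%:R).
Proof. by rewrite /pochhammer big_ord_recr. Qed.

Lemma pochhammerSl x n : pochhammer x n.+1 = x * pochhammer (x + 1) n.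
Proof.
rewrite /pochhammer big_ord_recl /= addr0; congr (_ * _).
by apply: eq_bigr => i _; rewrite /bump /= natrD addrA.
Qed.

Lemma rGamma_seqS x n : (x + n.+1%:R + 1 != 0) ->
  rGamma_seq x n.+1 * (1 + (x + 1) / n.+1%:R) = x * rGamma_seq (x + 1) n.+1.
Proof.
move=> h; rewrite /rGamma_seq pochhammerSl (pochhammerSr (x + 1) n.+1).
have n0 : n.+1%:R != 0 :> R by [].
rewrite powRD ?n0 ?implybT // powRr1 //.
have p0 : n.+1%:R `^ x != 0 :> R by rewrite powR_eq0 (negbTE n0).
by field; rewrite p0 fact_neq0 nat1r n0.
Qed.

Lemma cvg_inv_ratio x : (1 + (x + 1) / n.+1%:R) @[n --> \oo] --> (1 : R).
Proof.
have h := cvgD (cvg_cst (1 : R)) (cvgM (cvg_cst (x + 1)) (@cvg_harmonic R)).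
by rewrite mulr0 addr0 in h; exact: h.
Qed.

Lemma near_neq x : \forall n \near \oo, x + n.+1%:R + 1 != 0 :> R.
Proof.
near=> n.
have : `|x| < n%:R by near: n; exact: nbhs_infty_gtr.
have := ler_norm (- x); rewrite normrN => h1 h2.
by rewrite gt_eqF // -natr1; lra.
Unshelve. all: by end_near. Qed.

(** The terms of Gauss's sequence at x + 1, multiplied by x, agree with those at x up to a factor
    tending to 1. Going down works for every x, also through the zeros of 1 / Gamma; going up, in
    [rGamma_up], requires dividing by x. *)
Lemma rGamma_rec x : cvgn (rGamma_seq (x + 1)) ->
  rGamma x = x * rGamma (x + 1) /\ cvgn (rGamma_seq x).
Proof.
move=> h.
suff H : rGamma_seq x @ \oo --> x * rGamma (x + 1).
  by split; [exact: (cvg_lim _ H) | exact: (cvgP _ H)].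
rewrite -cvg_shiftS.
have h1 : (fun n => rGamma_seq (x + 1) n.+1) @ \oo --> rGamma (x + 1).
  by rewrite (cvg_shiftS (rGamma_seq (x + 1))).
have h2 := cvgM (cvgM (cvg_cst x) h1) (cvgV (oner_neq0 R) (cvg_inv_ratio x)).
rewrite invr1 mulr1 in h2.
have {}h2 : (fun n => x * rGamma_seq (x + 1) n.+1 * (1 + (x + 1) / n.+1%:R)^-1) @ \oo
  --> x * rGamma (x + 1) by exact: h2.
apply: cvg_trans h2; apply: near_eq_cvg.
near=> n.
have n0 : n.+1%:R != 0 :> R by [].
have xn : x + n.+1%:R + 1 != 0 by near: n; exact: near_neq.
rewrite /= -rGamma_seqS // mulfK //.
rewrite (_ : 1 + _ = (x + n.+1%:R + 1) / n.+1%:R) ?mulf_neq0 ?invr_neq0 //.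
by field; rewrite nat1r.
Unshelve. all: by end_near. Qed.

Lemma rGamma_up x : x != 0 -> cvgn (rGamma_seq x) -> cvgn (rGamma_seq (x + 1)).
Proof.
move=> x0 /cvg_ex[/= l hl].
apply/cvg_ex; exists (x^-1 * l * 1); rewrite -cvg_shiftS.
rewrite -(cvg_shiftS (rGamma_seq x)) in hl.
have h : (fun n => x^-1 * rGamma_seq x n.+1 * (1 + (x + 1) / n.+1%:R)) @ \oo --> x^-1 * l * 1.
  exact: (cvgM (cvgM (cvg_cst x^-1) hl) (cvg_inv_ratio x)).
apply: cvg_trans h; apply: near_eq_cvg.
near=> n.
have xn : x + n.+1%:R + 1 != 0 by near: n; exact: near_neq.
by rewrite /= -mulrA rGamma_seqS // mulKf.
Unshelve. all: by end_near. Qed.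

Lemma rGamma1 : rGamma 1 = 1 :> R /\ cvgn (rGamma_seq 1).
Proof.
suff H : rGamma_seq 1 @ \oo --> (1 : R) by split; [exact: (cvg_lim _ H) | exact: (cvgP _ H)].
rewrite -cvg_shiftS.
have h := cvg_inv_ratio 0; rewrite add0r in h.
apply: cvg_trans h; apply: near_eq_cvg; near=> n.
have P m : pochhammer 1 m = m`!%:R :> R.
  elim: m => [|m IH]; first by rewrite /pochhammer big_ord0.
  by rewrite pochhammerSr IH factS natrM -natr1; ring.
rewrite /rGamma_seq /= P powRr1 // factS natrM.
by field; rewrite fact_neq0 nat1r pnatr_eq0.
Unshelve. all: by end_near. Qed.

(* Wallis: the squares of the terms decrease while their products with n/(n+1) increase. *)
Lemma rGamma_half : 0 < rGamma 2^-1 :> R /\ cvgn (rGamma_seq 2^-1).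
Proof.
pose w n := rGamma_seq 2^-1 n.+1.
have w0 n : 0 <= w n.
  apply: divr_ge0; last by apply: mulr_ge0 => //; exact: powR_ge0.
  by apply: prodr_ge0 => i _; apply: addr_ge0 => //; rewrite invr_ge0.
have wS n : w n.+1 ^+ 2 * n.+2%:R ^+ 3 = w n ^+ 2 * ((n.+2%:R + 2^-1) ^+ 2 * n.+1%:R).
  rewrite /w /rGamma_seq pochhammerSr (powR12_sqrt (ler0n R n.+1)) (powR12_sqrt (ler0n R n.+2)).
  rewrite factS natrM !exprMn !exprVn !exprMn !sqr_sqrtr //.
  by field; rewrite fact_neq0 nat1r -natrD !pnatr_eq0.
have dec n : w n.+1 <= w n.
  rewrite -(@ler_pXn2r _ 2) ?nnegrE //.
  have n2 : 0 < n.+2%:R ^+ 3 :> R by rewrite exprn_gt0.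
  rewrite -(ler_pM2r n2) wS ler_wpM2l ?sqr_ge0 //.
  have : 0 <= n%:R :> R by [].
  rewrite -[n.+2%:R]natr1 -[n.+1%:R]natr1; set m := n%:R; lra.
(* The constant 9 / 32 makes this an equality at n = 0, where w 0 = 3 / 4. *)
have low n : (9 / 32) * n.+2%:R <= w n ^+ 2 * n.+1%:R.
  elim: n => [|n IH].
    rewrite /w /rGamma_seq powR1 /pochhammer 2!big_ord_recr big_ord0 /= (_ : 1`! = 1)%N // mulr1 divr1.
    lra.
  have n2 : 0 < n.+2%:R ^+ 3 :> R by rewrite exprn_gt0.
  rewrite -(ler_pM2r n2) [leRHS]mulrAC wS.
  have : 0 <= (w n ^+ 2 * n.+1%:R - 9 / 32 * n.+2%:R) * ((n.+2%:R + 2^-1) ^+ 2 * n.+2%:R).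
    by rewrite mulr_ge0 ?subr_ge0 // mulr_ge0 ?sqr_ge0.
  have : 0 <= n%:R :> R by [].
  rewrite -[n.+3%:R]natr1 -[n.+2%:R]natr1 -[n.+1%:R]natr1; set m := n%:R; set v := w n ^+ 2; nra.
have low2 n : 2^-1 <= w n.
  rewrite -(@ler_pXn2r _ 2) ?nnegrE ?invr_ge0 //.
  have n1 : 0 < n.+1%:R :> R by [].
  rewrite -(ler_pM2r n1); have := low n; rewrite -[n.+2%:R]natr1; lra.
have cw : cvgn w.
  apply: nonincreasing_is_cvgn; first by apply/nonincreasing_seqP.
  by exists 2^-1 => _ [n _ <-].
have cG : rGamma_seq 2^-1 @ \oo --> limn w by rewrite -cvg_shiftS.
split; last by exact: (cvgP _ cG).
rewrite [rGamma _](cvg_lim _ cG) //; apply: lt_le_trans (_ : 2^-1 <= _); first by rewrite invr_gt0.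
by apply: limr_ge => //; apply: nearW.
Qed.

Lemma rGamma_pos n : 0 < rGamma (n.+1%:R / 2) :> R /\ cvgn (rGamma_seq (n.+1%:R / 2)).
Proof.
elim/ltn_ind: n => -[_|[_|n IH]].
- by rewrite mul1r; exact: rGamma_half.
- by rewrite divff //; have [-> ?] := rGamma1.
have [g0 gc] := IH n (ltnW (ltnSn _)).
have E : n.+3%:R / 2 = n.+1%:R / 2 + 1 :> R by rewrite -[n.+3%:R]natr1 -[n.+2%:R]natr1; field.
have c1 : cvgn (rGamma_seq (n.+1%:R / 2 + 1)) by apply: rGamma_up.
rewrite E; split => //.
have [h _] := rGamma_rec c1; move: g0; rewrite h pmulr_rgt0 //.
Qed.

Lemma rGamma_cvg_int (k : nat) : cvgn (rGamma_seq (1 - k%:R)).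
Proof.
elim: k => [|k IH]; first by rewrite subr0; case: rGamma1.
suff h : cvgn (rGamma_seq (1 - k.+1%:R + 1)) by case: (rGamma_rec h).
by rewrite (_ : 1 - k.+1%:R + 1 = 1 - k%:R) // -natr1; ring.
Qed.

Lemma rGamma_fact n : rGamma n.+1%:R = n`!%:R^-1 :> R.
Proof.
elim: n => [|n IH]; first by have [-> _] := rGamma1; rewrite invr1.
have [_ h] := rGamma_pos (2 * n + 3).
have [|e _] := @rGamma_rec n.+1%:R.
  rewrite (_ : n.+1%:R + 1 = (2 * n + 3).+1%:R / 2) //; first by field.
have n1 : n.+1%:R != 0 :> R by [].
by move: e; rewrite IH natr1 factS natrM invfM => ->; rewrite mulKf.
Qed.

Section Hyper.
Variables (a b c : R).

Definition hyper_coef n : R :=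
  pochhammer a n * pochhammer b n * rGamma (c + n%:R) / n`!%:R.

Hypothesis cE : forall n, rGamma (c + n%:R) = (c + n%:R) * rGamma (c + n.+1%:R).

Lemma hyper_coefS n :
  hyper_coef n.+1 * ((c + n%:R) * n.+1%:R) = hyper_coef n * ((a + n%:R) * (b + n%:R)).
Proof.
rewrite /hyper_coef !pochhammerSr (cE n) factS natrM; field.
by rewrite fact_neq0 nat1r pnatr_eq0.
Qed.

Lemma subexp_hyper : subexp hyper_coef.
Proof.
apply: subexp_ratio => rho rho1.
(* For large n the ratio of consecutive coefficients is at most (1 + e)^2 / (1 - e) in absolute
   value; this e gives rho (1 - e) = 1 + 3 e >= (1 + e)^2. *)
pose e : R := (rho - 1) / (rho + 3).
have e0 : 0 < e by rewrite divr_gt0; lra.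
have eE : e * (rho + 3) = rho - 1 by rewrite divfK // gt_eqF; lra.
have e1 : e < 1 by rewrite ltr_pdivrMr; lra.
pose m : R := `|a| + `|b| + `|c|.
have [N NP] : exists N : nat, m / e < N%:R.
  by exists (Num.truncn (m / e)).+1; rewrite truncnS_gt.
exists N.+1 => n nN.
have nm : m <= e * n%:R.
  rewrite mulrC -ler_pdivrMr //; apply: ltW; apply: (lt_le_trans NP); rewrite ler_nat; lia.
have n0 : 0 < n%:R :> R by rewrite ltr0n; lia.
have [na nb nc] : [/\ 0 <= `|a|, 0 <= `|b| & 0 <= `|c|] by [].
have ha : `|a + n%:R| <= (1 + e) * n%:R.
  by apply: (le_trans (ler_normD _ _)); rewrite (ger0_norm (ltW n0)); rewrite /m in nm; lra.
have hb : `|b + n%:R| <= (1 + e) * n%:R.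
  by apply: (le_trans (ler_normD _ _)); rewrite (ger0_norm (ltW n0)); rewrite /m in nm; lra.
have hc : (1 - e) * n%:R <= `|c + n%:R|.
  apply: le_trans (ler_norm _); have := ler_norm (- c); rewrite normrN /m in nm *; lra.
have E : `|hyper_coef n.+1| * (`|c + n%:R| * n.+1%:R) = `|hyper_coef n| * (`|a + n%:R| * `|b + n%:R|).
  by rewrite -[n.+1%:R](@ger0_norm R) // -!normrM hyper_coefS.
have f10 : 0 <= `|hyper_coef n.+1| by [].
have f0 : 0 <= `|hyper_coef n| by [].
set f1 : R := `|hyper_coef n.+1| in f10 E *; set f : R := `|hyper_coef n| in f0 E *.
have k1 : f1 * ((1 - e) * n%:R * n%:R) <= f * ((1 + e) * n%:R * ((1 + e) * n%:R)).
  apply: (@le_trans _ _ (f1 * (`|c + n%:R| * n.+1%:R))).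
    apply: ler_wpM2l => //; apply: ler_pM => //; last by rewrite ler_nat.
    by rewrite mulr_ge0 ?(ltW n0) // subr_ge0 ltW.
  by rewrite E; apply: ler_wpM2l => //; apply: ler_pM.
have k2 : f1 * (1 - e) <= f * (1 + e) ^+ 2.
  have nn : 0 < n%:R * n%:R :> R by rewrite mulr_gt0.
  by rewrite -(ler_pM2r nn); lra.
have k3 : f * (1 + e) ^+ 2 <= f * (rho * (1 - e)).
  by apply: ler_wpM2l => //; nra.
have e1' : 0 < 1 - e by lra.
by rewrite -(ler_pM2r e1'); lra.
Qed.

(** Since 1 / Gamma(c - 1 + n) = (c - 1 + n) / Gamma(c + n), the Euler operator z d/dz + c - 1
    lowers c to c - 1. The closed forms [hyperF_geg] and [hyperF_geg_neg] are obtained by iterating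
    it. *)
Lemma hyperF_pred (z : R) : rGamma (c - 1) = (c - 1) * rGamma c -> `|z| < 1 ->
  exists2 d : R, is_derive z 1 (hyperF a b c) d &
    hyperF a b (c - 1) z = z * d + (c - 1) * hyperF a b c z.
Proof.
move=> c1 z1; exists (limn (pseries (pseries_diffs hyper_coef) z)).
  exact: is_derive_pseries (subexp_hyper) z1.
apply: (pseries_euler subexp_hyper z1) => -[|n].
  by rewrite /hyper_coef !addr0 c1; ring.
have -> : c - 1 + n.+1%:R = c + n%:R by rewrite -natr1; ring.
by rewrite /hyper_coef cE; ring.
Qed.

End Hyper.

Lemma pseries_at0 (f : nat -> R) : limn (pseries f 0) = f 0%N.
Proof.
apply: cvg_lim => //; rewrite -cvg_shiftS.
rewrite [X in X @ _](_ : _ = fun=> f 0%N); first exact: cvg_cst.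
apply/funext => n; rewrite /pseries /series /= big_nat_recl // expr0 mulr1.
by rewrite big1 ?addr0 // => i _; rewrite expr0n mulr0.
Qed.

(** With c = a the series h solves (1 - z) h' = b h, so h (1 - z)^b is constant. *)
Lemma hyperF_binomial (a b z : R) : 0 < a ->
  (forall n, rGamma (a + n%:R) = (a + n%:R) * rGamma (a + n.+1%:R)) ->
  0 <= z < 1 -> hyperF a b a z = rGamma a * (1 - z) `^ (- b).
Proof.
move=> a0 aE /andP[z0 z1].
pose f := hyper_coef a b a; have sf : subexp f := subexp_hyper a b aE.
have fS n : pseries_diffs f n = (b + n%:R) * f n.
  have an : a + n%:R != 0 by rewrite gt_eqF // ltr_wpDr.
  have := hyper_coefS a b aE n; rewrite /pseries_diffs -/f => h.
  apply: (mulfI an); rewrite [LHS]mulrA mulrC h; ring.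
pose h := hyperF a b a; pose h' t := limn (pseries (pseries_diffs f) t).
have hD t : `|t| < 1 -> is_derive t 1 h (h' t) by exact: is_derive_pseries.
have hE t : `|t| < 1 -> h' t = t * h' t + b * h t by move=> t1; exact: pseries_euler.
pose phi t := h t * (1 - t) `^ b.
have phiD t : 0 <= t <= z -> is_derive t 1 phi 0.
  move=> /andP[t0 tz].
  have t1 : `|t| < 1 by rewrite ger0_norm //; lra.
  have tp : 0 < 1 - t by lra.
  have e1 : is_derive t 1 (fun u => 1 - u) (- 1 : R).
    by apply: (is_derive_eq (is_deriveB (is_derive_cst _ _ _) (is_derive_id _ _))); rewrite sub0r.
  have e2 := is_deriveM (hD t t1) (@is_derive1_comp R (@powR R ^~ b) (fun u => 1 - u) t _ _ (is_derive1_powR b tp) e1).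
  apply: (is_derive_eq e2); rewrite /= /GRing.scale /=.
  have -> : (1 - t) `^ b = (1 - t) `^ (b - 1) * (1 - t).
    by rewrite -{3}(powRr1 (ltW tp)) -powRD ?subrK // (gt_eqF tp) implybT.
  transitivity ((1 - t) `^ (b - 1) * (h' t - (t * h' t + b * h t))); first by ring.
  by rewrite -hE // subrr mulr0.
have phic t : 0 <= t <= z -> {for t, continuous phi}.
  move=> ht; have [pd _] := phiD t ht.
  by apply/differentiable_continuous/derivable1_diffP.
have le1 : phi 0 <= phi z.
  apply: (le_of_derive_ge0 (df := fun=> 0)) => // t /andP[t0 t1].
  by split=> //; apply: phiD; rewrite !ltW.
have le2 : - phi 0 <= - phi z.
  apply: (le_of_derive_ge0 (f := fun t => - phi t) (df := fun=> 0)) => // t ht.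
    split=> //; case/andP: ht => t0 t1.
    by apply: (is_derive_eq (is_deriveN (phiD t _))); rewrite ?oppr0 // !ltW.
  by apply: continuousN; exact: phic.
have : phi z = phi 0 by apply/eqP; rewrite eq_le le1 -lerN2 le2.
rewrite /phi subr0 powR1 mulr1 /h {2}/hyperF [in RHS]pseries_at0 /f.
rewrite /hyper_coef /pochhammer !big_ord0 addr0 fact0 divr1 !mul1r => <-.
rewrite powRN mulfK // powR_eq0; apply/nandP; left; rewrite gt_eqF //; lra.
Qed.

Lemma rGamma_okpos k n :
  rGamma (k.+1%:R / 2 + n%:R) = (k.+1%:R / 2 + n%:R) * rGamma (k.+1%:R / 2 + n.+1%:R) :> R.
Proof.
have [_ h] := rGamma_pos (k + 2 * n + 2).
have e : (k + 2 * n + 2).+1%:R / 2 = k.+1%:R / 2 + n.+1%:R :> R.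
  by field.
rewrite e in h.
have e2 : k.+1%:R / 2 + n.+1%:R = k.+1%:R / 2 + n%:R + 1 :> R by rewrite -natr1; ring.
by rewrite e2 in h *; case: (rGamma_rec h).
Qed.

Lemma rGamma_okint k n :
  rGamma (1 - k%:R + n%:R) = (1 - k%:R + n%:R) * rGamma (1 - k%:R + n.+1%:R) :> R.
Proof.
have -> : 1 - k%:R + n.+1%:R = 1 - k%:R + n%:R + 1 :> R by rewrite -natr1; ring.
suff h : cvgn (rGamma_seq (1 - k%:R + n%:R + 1)) by case: (rGamma_rec h).
have [kn|nk] := leqP k n.
  have [_ h] := rGamma_pos (2 * (n - k) + 3).
  rewrite (_ : _ + 1 = (2 * (n - k) + 3).+1%:R / 2) //.
  have -> : k%:R = n%:R - (n - k)%:R :> R by rewrite natrB //; ring.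
  by field.
rewrite (_ : _ + 1 = 1 - (k - n.+1)%:R); first exact: rGamma_cvg_int.
by rewrite natrB // -natr1; ring.
Qed.

Lemma is_derive_geg N n t : is_derive t 1 (fun u => geg N n (1 - 2 * u) 1)
  (- 2 * ((n * N)%:R * geg N.+2 n.-1 (1 - 2 * t) 1) : R).
Proof.
have ev M m u : (geg M m 'X 1 : {poly R}).[u] = geg M m u 1.
  by rewrite -/(horner_eval u _) geg_morph /= /horner_eval hornerX hornerC.
have e1 : is_derive t 1 (fun u : R => 1 - 2 * u) (- 2 : R).
  apply: (is_derive_eq (is_deriveB (is_derive_cst _ _ _) (is_deriveZ 2 (is_derive_id _ _)))).
  by rewrite sub0r /GRing.scale /= mulr1.
have e2 := is_derive1_comp (is_derive_poly (geg N n 'X 1 : {poly R}) _) e1.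
rewrite [X in is_derive _ _ X](_ : _ = horner (geg N n 'X 1 : {poly R}) \o (fun u => 1 - 2 * u)); last first.
  by apply/funext => u /=; rewrite ev.
apply: (is_derive_eq e2).
by rewrite deriv_geg1 hornerM horner_natr ev; ring.
Qed.

Lemma factrS m : m.+1`!%:R = m.+1%:R * m`!%:R :> R.
Proof. by rewrite factS natrM. Qed.

(** The first two arguments depend on k / 2 + n only, so the case (k, n + 1) is the case (k + 2, n)
    with c lowered by 1. Hence an induction on n with k free: n = 0 is the binomial series, and the
    step combines [hyperF_pred] with [geg_raising]. *)
Lemma hyperF_geg k n (z : R) : 0 < z < 1 ->
  hyperF (k%:R / 2 + n%:R + 1) (- (k%:R / 2 + n%:R)) (1 + k%:R / 2) z =
  rGamma (1 + k%:R / 2) * k`!%:R / (n + k)`!%:R * (1 - z) `^ (k%:R / 2) * geg k.+1 n (1 - 2 * z) 1.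
Proof.
elim: n k z => [|n IH] k z /andP[z0 z1].
  have E : 1 + k%:R / 2 = k.+2%:R / 2 :> R by rewrite -[k.+2%:R]natr1 -[k.+1%:R]natr1; field.
  have -> : k%:R / 2 + 0%:R + 1 = 1 + k%:R / 2 :> R by ring.
  rewrite hyperF_binomial.
  - by rewrite addr0 opprK geg0; field; rewrite fact_neq0.
  - by rewrite E divr_gt0.
  - by move=> m; rewrite E; exact: rGamma_okpos.
  - by rewrite ltW.
pose M : R := k.+2%:R / 2.
have ME : M = k%:R / 2 + 1 by rewrite /M -[k.+2%:R]natr1 -[k.+1%:R]natr1; field.
have -> : k%:R / 2 + n.+1%:R = M + n%:R by rewrite ME -natr1; ring.
have cE m : rGamma (1 + M + m%:R) = (1 + M + m%:R) * rGamma (1 + M + m.+1%:R).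
  have -> : 1 + M = k.+4%:R / 2 by rewrite /M -[k.+4%:R]natr1 -[k.+3%:R]natr1; field.
  exact: rGamma_okpos.
have c1 : rGamma (1 + M - 1) = (1 + M - 1) * rGamma (1 + M).
  have := rGamma_okpos k.+1 0; rewrite !addr0 -/M.
  by rewrite [1 + M]addrC addrK.
have nz : `|z| < 1 by rewrite gtr0_norm.
have [d dD] := hyperF_pred (M + n%:R + 1) (- (M + n%:R)) cE c1 nz.
have -> : 1 + M - 1 = 1 + k%:R / 2 by rewrite ME; ring.
move=> ->.
set kap := rGamma (1 + M) * k.+2`!%:R / (n + k.+2)`!%:R.
have zp : 0 < 1 - z by lra.
have e1 : is_derive z 1 (fun u => 1 - u) (- 1 : R).
  by apply: (is_derive_eq (is_deriveB (is_derive_cst _ _ _) (is_derive_id _ _))); rewrite sub0r.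
have e2 : is_derive z 1 (fun u => kap * (1 - u) `^ M * geg k.+3 n (1 - 2 * u) 1)
   (kap * (1 - z) `^ M * (- 2 * ((n * k.+3)%:R * geg k.+1.+4 n.-1 (1 - 2 * z) 1))
    + geg k.+3 n (1 - 2 * z) 1 * (kap * (M * (1 - z) `^ (M - 1) * - 1)) : R).
  exact: (is_deriveM (is_deriveZ kap (@is_derive1_comp R (@powR R ^~ M) (fun u => 1 - u) z _ _
    (is_derive1_powR M zp) e1)) (is_derive_geg k.+3 n z)).
(* The induction hypothesis holds on all of (0, 1), so it also identifies the derivative of the
   series at z. *)
have nr : \forall u \near z, kap * (1 - u) `^ M * geg k.+3 n (1 - 2 * u) 1
    = hyperF (M + n%:R + 1) (- (M + n%:R)) (1 + M) u.
  near=> u; rewrite IH //.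
  have : u \in `]0, 1[%R by near: u; apply: near_in_itvoo; rewrite in_itv /= z0 z1.
  by rewrite in_itv.
have [_ d1] := near_eq_is_derive nr e2.
have [_ d2] := dD; rewrite d2 in d1.
rewrite d1 IH ?z0 // -/M -/kap /GRing.scale /=.
have MP : (1 - z) `^ M = (1 - z) `^ (k%:R / 2) * (1 - z).
  by rewrite -{3}(powRr1 (ltW zp)) -powRD -?ME // (gt_eqF zp) implybT.
have -> : M - 1 = k%:R / 2 by rewrite ME; ring.
rewrite MP; set P := (1 - z) `^ _.
have O := geg_raising (1 - 2 * z) k.+1 n.
have k1 : k.+1%:R != 0 :> R by [].
have kapE : kap = rGamma (1 + k%:R / 2) * (2 * k.+1%:R) * k`!%:R / (n.+1 + k).+1`!%:R.
  have g : rGamma (1 + k%:R / 2) = (1 + k%:R / 2) * rGamma (1 + M).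
    have -> : 1 + k%:R / 2 = M by rewrite ME addrC.
    by have := rGamma_okpos k.+1 0; rewrite addr0 -/M [M + _]addrC.
  rewrite /kap g (_ : n + k.+2 = (n.+1 + k).+1)%N; last by lia.
  rewrite (factrS (n.+1 + k)) (factrS k.+1) (factrS k).
  have : (n.+1 + k)`!%:R != 0 :> R := fact_neq0 _ _.
  move: ((n.+1 + k)`!%:R) => F F0; field; rewrite F0 /= ?andbT.
  by rewrite -[X in X != 0](_ : (n.+1 + k).+1%:R = _) ?pnatr_eq0 //; ring.
have -> : geg k.+1 n.+1 (1 - 2 * z) 1 = k.+1%:R / (n + k.+1).+1%:R * (k.+2%:R * (1 - 2 * z) * geg k.+3 n (1 - 2 * z) 1 -
          (n * k.+3)%:R * (1 - (1 - 2 * z) ^+ 2) * geg (k.+1).+4 n.-1 (1 - 2 * z) 1).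
  by rewrite mulrAC O mulrAC divff ?mul1r.
rewrite kapE ME factrS.
set g1 := geg k.+3 _ _ _; set g2 := geg _ n.-1 _ _; set G := rGamma _; set p := P.
have -> : (n + k.+1 = n.+1 + k)%N by lia.
have : (n.+1 + k)`!%:R != 0 :> R := fact_neq0 _ _.
move: ((n.+1 + k)`!%:R) => F F0; field; rewrite F0 /= ?andbT.
by rewrite -[X in X != 0](_ : (n.+1 + k).+1%:R = _) ?pnatr_eq0 //; ring.
Unshelve. all: by end_near. Qed.

End Real.

Section Real.
Variable R : realType.
Implicit Types (x y t c s : R) (n l N L : nat).

(** Starting from c = 1, the case k = 0 of [hyperF_geg], c is lowered l times. In z h' - l h the
    derivative of z^l cancels, and only the derivative of the polynomial remains, which raises its
    parameter by 2. *)
Lemma hyperF_geg_neg L l (z : R) : (l <= L)%N -> 0 < z < 1 ->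
  hyperF (L%:R + 1) (- L%:R) (1 - l%:R) z =
  (-1) ^+ l * (2 * l)`!%:R / (l`!%:R * (L - l)`!%:R) * z ^+ l * geg (2 * l).+1 (L - l) (1 - 2 * z) 1.
Proof.
elim: l z => [|l IH] z lL /andP[z0 z1].
  have := hyperF_geg 0 L (z := z); rewrite z0 z1 mul0r add0r addr0 subr0 => -> //.
  by rewrite powRr0 addn0 subn0 muln0 fact0 !expr0 (proj1 (rGamma1 R)); field; rewrite fact_neq0.
pose kap : R := (-1) ^+ l * (2 * l)`!%:R / (l`!%:R * (L - l)`!%:R).
have nz : `|z| < 1 by rewrite gtr0_norm.
have c1 : rGamma (1 - l%:R - 1) = (1 - l%:R - 1) * rGamma (1 - l%:R) :> R.
  have e1 : 1 - l%:R - 1 = 1 - l.+1%:R :> R by rewrite -natr1; ring.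
  have e2 : 1 - l.+1%:R + 1%:R = 1 - l%:R :> R by rewrite -natr1; ring.
  by rewrite e1; have := rGamma_okint R l.+1 0; rewrite e2 addr0.
have [d dD] := hyperF_pred (L%:R + 1) (- L%:R) (rGamma_okint R l) c1 nz.
have -> : 1 - l%:R - 1 = 1 - l.+1%:R :> R by rewrite -natr1; ring.
move=> ->.
have e2 : is_derive z 1 (fun u => kap * u ^+ l * geg (2 * l).+1 (L - l) (1 - 2 * u) 1)
   (kap * z ^+ l * (- 2 * (((L - l) * (2 * l).+1)%:R * geg (2 * l).+3 (L - l).-1 (1 - 2 * z) 1))
    + geg (2 * l).+1 (L - l) (1 - 2 * z) 1 * (kap * (l%:R * z ^+ l.-1)) : R).
  have eX : is_derive z 1 (fun u : R => u ^+ l) (l%:R * z ^+ l.-1).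
    rewrite [X in is_derive _ _ X](_ : _ = horner ('X^l : {poly R})).
      apply: (is_derive_eq (is_derive_poly _ _)).
      by rewrite derivXn hornerMn hornerXn mulr_natl.
    by apply/funext => u; rewrite hornerXn.
  apply: (is_derive_eq (is_deriveM (is_deriveZ kap eX)
    (is_derive_geg (2 * l).+1 (L - l) z))).
  by [].
have nr : \forall u \near z, kap * u ^+ l * geg (2 * l).+1 (L - l) (1 - 2 * u) 1
    = hyperF (L%:R + 1) (- L%:R) (1 - l%:R) u.
  near=> u; rewrite IH //; first by exact: ltnW.
  have : u \in `]0, 1[%R by near: u; apply: near_in_itvoo; rewrite in_itv /= z0 z1.
  by rewrite in_itv.
have [_ d1] := near_eq_is_derive nr e2.
have [_ d2] := dD; rewrite d2 in d1.
rewrite d1 IH ?z0 // ?(ltnW lL) // -/kap.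
have -> : (L - l.+1 = (L - l).-1)%N by lia.
have [m Lm] : exists m, (L - l = m.+1)%N by exists (L - l.+1)%N; lia.
rewrite Lm /=.
have kapE : (-1) ^+ l.+1 * (2 * l.+1)`!%:R / (l.+1`!%:R * m`!%:R) = - 2 * (m.+1 * (2 * l).+1)%:R * kap.
  rewrite /kap Lm (_ : 2 * l.+1 = (2 * l).+2)%N; last by lia.
  rewrite !factrS exprS; field.
  by rewrite !fact_neq0 !nat1r !pnatr_eq0.
rewrite kapE (_ : 2 * l.+1 = (2 * l).+2)%N; last by lia.
have zl : z * (l%:R * z ^+ l.-1) = l%:R * z ^+ l.
  by case: l {IH lL kap c1 d dD e2 nr d1 d2 Lm kapE} => [|l] /=; rewrite ?exprS; ring.
set g := geg _ _ _ _; set g' := geg _ _ _ _.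
transitivity (- 2 * (m.+1 * (2 * l).+1)%:R * kap * z ^+ l.+1 * g + kap * g' * (z * (l%:R * z ^+ l.-1))
   - l%:R * (kap * z ^+ l * g')); first by rewrite exprS; ring.
by rewrite zl; ring.
Unshelve. all: by end_near. Qed.

(** The prefactor of [ferrersP], times the power produced by [hyperF_geg] (first part) or
    [hyperF_geg_neg] (second part), collapses to a power of sin t because sin^2 t = (1 + cos t)(1 -
    cos t). *)
Lemma powR_trig (e t : R) : 0 < t < pi ->
  ((1 + cos t) / (1 - cos t)) `^ (- (e / 2)) * ((1 + cos t) / 2) `^ e = sin t `^ e / 2 `^ e /\
  ((1 + cos t) / (1 - cos t)) `^ (e / 2) * ((1 - cos t) / 2) `^ e = sin t `^ e / 2 `^ e.
Proof.
move=> tpi; have s0 : 0 < sin t by exact: sin_gt0_pi.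
have sc := cos2Dsin2 t.
have [a0 b0] : 0 < 1 + cos t /\ 0 < 1 - cos t.
  have : cos t ^+ 2 < 1 by rewrite -sc ltrDl exprn_gt0.
  by move=> h; split; nra.
set A := 1 + cos t in a0 *; set B := 1 - cos t in b0 *.
have AB : sin t ^+ 2 = A * B by rewrite /A /B; lra.
have E (u : R) : 0 < u -> u `^ e = u `^ (e / 2) * u `^ (e / 2).
  by move=> u0; rewrite -powRD ?(gt_eqF u0) ?implybT //; congr (_ `^ _); field.
have sE : sin t `^ e = A `^ (e / 2) * B `^ (e / 2).
  by rewrite -powRM ?ltW // -AB -[sin t ^+ 2]powR_mulrn ?ltW // -powRrM; congr (_ `^ _); field.
have D2 (u : R) : 0 < u -> (u / 2) `^ e = u `^ e / 2 `^ e.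
  by move=> u0; rewrite powRM ?invr_ge0 ?ltW // -powR_inv1 // -powRrM mulN1r powRN.
have DB : (A / B) `^ (e / 2) = A `^ (e / 2) / B `^ (e / 2).
  by rewrite powRM ?invr_ge0 ?ltW // -(powR_inv1 (ltW b0)) -powRrM mulN1r powRN.
have Ap : A `^ (e / 2) != 0 by rewrite gt_eqF // powR_gt0.
have Bp : B `^ (e / 2) != 0 by rewrite gt_eqF // powR_gt0.
have p2 : 2 `^ e != 0 :> R by rewrite gt_eqF // powR_gt0.
split.
  by rewrite powRN DB D2 // (E A) // sE; field; rewrite p2 Ap Bp.
by rewrite DB D2 // (E B) // sE; field; rewrite p2 Bp.
Qed.

Lemma half_cos t : 0 < t < pi -> 0 < (1 - cos t) / 2 < 1.
Proof.
move=> tpi; have s0 : 0 < sin t by exact: sin_gt0_pi.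
have : cos t ^+ 2 < 1 by rewrite -(cos2Dsin2 t) ltrDl exprn_gt0.
by move=> h; apply/andP; split; nra.
Qed.

Lemma ferrersP_geg k n t : 0 < t < pi ->
  ferrersP (k%:R / 2 + n%:R) (- (k%:R / 2)) (cos t) =
  rGamma (1 + k%:R / 2) * k`!%:R / (n + k)`!%:R / 2 `^ (k%:R / 2) * sin t `^ (k%:R / 2)
    * geg k.+1 n (cos t) 1.
Proof.
move=> tpi; rewrite /ferrersP opprK hyperF_geg ?half_cos //.
have -> : 1 - 2 * ((1 - cos t) / 2) = cos t by field.
have -> : 1 - (1 - cos t) / 2 = (1 + cos t) / 2 by field.
rewrite mulNr mulrA [X in X * _]mulrCA (proj1 (powR_trig _ tpi)); ring.
Qed.

Lemma ferrersP_geg_neg L l t : (l <= L)%N -> 0 < t < pi ->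
  ferrersP (L%:R) (l%:R) (cos t) =
  (-1) ^+ l * (2 * l)`!%:R / (l`!%:R * (L - l)`!%:R) / 2 `^ l%:R * sin t `^ l%:R
    * geg (2 * l).+1 (L - l) (cos t) 1.
Proof.
move=> lL tpi; rewrite /ferrersP hyperF_geg_neg ?half_cos //.
have -> : 1 - 2 * ((1 - cos t) / 2) = cos t by field.
have z0 : 0 <= (1 - cos t) / 2 by have /andP[/ltW] := half_cos tpi.
rewrite mulrA [X in X * _]mulrCA -powR_mulrn // (proj2 (powR_trig _ tpi)); ring.
Qed.

End Real.

(** * Explicit form of the functions [Ptilde] *)

Section Real.
Variable R : realType.
Implicit Types (x y t c s : R) (n l N L i : nat).

Definition Ynorm i : R := Num.sqrt (pi * Gamma (i%:R / 2 : R) / Gamma ((i%:R + 1) / 2)).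

Lemma Ynorm_gt0 i : (0 < i)%N -> 0 < Ynorm i.
Proof.
case: i => // i _; rewrite sqrtr_gt0 natr1.
rewrite divr_gt0 ?mulr_gt0 ?pi_gt0 // invr_gt0; first by case: (rGamma_pos R i).
by case: (rGamma_pos R i.+1).
Qed.

Lemma cLl_sqr i L l : (2 <= i)%N -> (l <= L)%N ->
  cLl R i L%:Z l%:Z ^+ 2 = (2 * L + i.-1)%:R / 2 * ((L + l + i.-2)`!%:R / (L - l)`!%:R).
Proof.
move=> i2 lL; rewrite /cLl.
have -> : absz (L%:Z + l%:Z + i%:Z - 2)%R = (L + l + i.-2)%N by lia.
have -> : absz (L%:Z - l%:Z)%R = (L - l)%N by lia.
have -> : 2 * L%:~R + i%:R - 1 = (2 * L + i.-1)%:R :> R.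
  by rewrite natrD -subn1 natrB ?natrM; [ring|lia].
by rewrite sqr_sqrtr // mulr_ge0 ?divr_ge0.
Qed.

Lemma cLl_sqrN L l : (l <= L)%N ->
  cLl R 2 L%:Z (- l%:Z) ^+ 2 = (2 * L + 1)%:R / 2 * ((L - l)`!%:R / (L + l)`!%:R).
Proof.
move=> lL; rewrite /cLl.
have -> : absz (L%:Z + - l%:Z + 2%:Z - 2)%R = (L - l)%N by lia.
have -> : absz (L%:Z - - l%:Z)%R = (L + l)%N by lia.
have -> : 2 * L%:~R + 2 - 1 = (2 * L + 1)%:R :> R by rewrite natrD natrM; ring.
by rewrite sqr_sqrtr // mulr_ge0 ?divr_ge0.
Qed.

Lemma continuous_sin_geg (w : R) l N n : continuous (fun t : R => w * sin t ^+ l * geg N n (cos t) 1).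
Proof.
have cc (p : {poly R}) (f : R -> R) : continuous f -> continuous (fun u => p.[f u]).
  move=> fc t; exact: (@continuous_comp _ _ _ f (horner p) t (fc t) (@continuous_horner _ p _)).
have sc : continuous (fun u : R => sin u ^+ l).
  rewrite (_ : (fun _ => _) = fun u => ('X^l : {poly R}).[sin u]); last first.
    by apply/funext => u /=; rewrite hornerXn.
  exact: cc (@continuous_sin R).
have gc : continuous (fun u : R => geg N n (cos u) 1).
  rewrite (_ : (fun _ => _) = fun u => (geg N n 'X 1 : {poly R}).[cos u]); last first.
    by apply/funext => u /=; rewrite -/(horner_eval _ _) geg_morph /= /horner_eval hornerX hornerC.
  exact: cc (@continuous_cos R).
by move=> t; apply: cvgM; [apply: cvgM; [exact: cvg_cst|exact: sc]|exact: gc].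
Qed.

(** The values of [Ptilde] at 0 and pi are one-sided limits, and the explicit form is continuous
    everywhere. *)
Lemma Ptilde_extend i (L l : int) (w : R) m N n :
  (forall t, 0 < t < pi -> Ptilde_open i L l t = w * sin t ^+ m * geg N n (cos t) 1) ->
  forall t, 0 <= t <= pi -> Ptilde i L l t = w * sin t ^+ m * geg N n (cos t) 1.
Proof.
move=> H t /andP[t0 tpi]; rewrite /Ptilde.
pose f (t : R) := w * sin t ^+ m * geg N n (cos t) 1.
have fc : continuous f by exact: continuous_sin_geg.
have pi0 := pi_gt0 R.
have [->|tn0] := eqVneq t 0.
  apply: cvg_lim => //; apply: cvg_trans (cvg_at_right_filter (fc 0)).
  apply: near_eq_cvg; near=> u; rewrite /f H //.
  by apply/andP; split; near: u; [exact: nbhs_right_gt|exact: nbhs_right_lt].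
have [->|tnpi] := eqVneq t pi.
  apply: cvg_lim => //; apply: cvg_trans (cvg_at_left_filter (fc pi)).
  apply: near_eq_cvg; near=> u; rewrite /f H //.
  by apply/andP; split; near: u; [exact: nbhs_left_gt|exact: nbhs_left_lt].
by rewrite H // !lt_neqAle t0 tpi eq_sym tn0 tnpi.
Unshelve. all: by end_near. Qed.

(** What is left of the squared normalisation of [Ptilde i] after division by [coefY]: neither L nor
    l enters. *)
Definition Ycst i : R :=
  Ynorm i ^+ 2 / 2 * (rGamma (i%:R / 2) * i.-2`!%:R / 2 `^ ((i%:R - 2) / 2)) ^+ 2 / i.-2`!%:R.

Lemma Ycst_gt0 i : (2 <= i)%N -> 0 < Ycst i.
Proof.
move=> i2; have f0 m : 0 < m`!%:R :> R by rewrite ltr0n fact_gt0.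
rewrite /Ycst divr_gt0 // mulr_gt0 ?divr_gt0 ?exprn_gt0 ?Ynorm_gt0 //; first by lia.
rewrite divr_gt0 ?powR_gt0 // mulr_gt0 //.
by case: i i2 => // i _; case: (rGamma_pos R i).
Qed.

(** An iterated recursion formula of Gamma; it turns the constants of the Ferrers functions into the
    product in [coefY], with N = m + 1. *)
Lemma rGamma_double (m l : nat) :
  rGamma ((m + 2 * l).+2%:R / 2) * (m + 2 * l)`!%:R / 2 `^ ((m + 2 * l)%:R / 2) =
  rGamma (m.+2%:R / 2) * m`!%:R / 2 `^ (m%:R / 2) * \prod_(r < l) (m.+1 + 2 * r)%:R :> R.
Proof.
elim: l => [|l IH]; first by rewrite muln0 addn0 big_ord0 mulr1.
rewrite big_ord_recr /= mulrA -IH.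
set k := (m + 2 * l)%N.
have -> : (m + 2 * l.+1 = k.+2)%N by rewrite /k; lia.
have -> : (m.+1 + 2 * l = k.+1)%N by rewrite /k; lia.
have := rGamma_okpos R k.+1 0; rewrite addr0 => ->.
have -> : k.+2%:R / 2 + 1%:R = k.+4%:R / 2 :> R by field.
have -> : k.+2%:R / 2 = k%:R / 2 + 1 :> R by field.
have -> : 2 `^ (k%:R / 2 + 1) = 2 `^ (k%:R / 2) * 2 :> R.
  by rewrite powRD ?powRr1 // pnatr_eq0 implybT.
rewrite !factrS.
have p0 : 2 `^ (k%:R / 2) != 0 :> R by rewrite gt_eqF // powR_gt0.
by field; rewrite p0.
Qed.

(** Only w^2 is recorded: the sequel uses products of two values at the same L and l, where the sign
    of w drops out. *)
Lemma Ptilde_form i L l : (2 <= i)%N -> (l <= L)%N ->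
  exists2 w : R, w ^+ 2 = Ycst i * coefY R i.-1 L l &
   forall t, 0 <= t <= pi ->
     Ptilde i L%:Z l%:Z t = w * sin t ^+ l * geg (i.-1 + 2 * l) (L - l) (cos t) 1.
Proof.
move=> i2 lL; have [m im] : exists m, i = m.+2 by exists (i - 2)%N; lia.
pose k := (m + 2 * l)%N.
have p0 (e : R) : 2 `^ e != 0 :> R by rewrite gt_eqF // powR_gt0.
pose w := Ynorm i * cLl R i L%:Z l%:Z * (rGamma (1 + k%:R / 2) * k`!%:R / (L - l + k)`!%:R / 2 `^ (k%:R / 2)).
have kE : 1 + k%:R / 2 = k.+2%:R / 2 :> R by field.
exists w.
  have -> : w = Ynorm i * cLl R i L%:Z l%:Z / (L - l + k)`!%:R *
     (rGamma (k.+2%:R / 2) * k`!%:R / 2 `^ (k%:R / 2)) by rewrite /w kE; ring.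
  rewrite rGamma_double !exprMn cLl_sqr // /Ycst /coefY im /=.
  have -> : (L - l + k = L + l + m)%N by rewrite /k; lia.
  have -> : ((L + l + m.+1).-1 = L + l + m)%N by lia.
  have -> : (m.+2%:R - 2) / 2 = m%:R / 2 :> R by field.
  rewrite -prodrXl; set P := \prod_(_ < _) _.
  by field; rewrite !fact_neq0 p0.
apply: Ptilde_extend => t tpi; rewrite /Ptilde_open.
have s0 : 0 < sin t by exact: sin_gt0_pi.
have -> : L%:~R + (i%:R - 2) / 2 = k%:R / 2 + (L - l)%:R :> R.
  by rewrite im /k natrB //; field.
have -> : l%:~R + (i%:R - 2) / 2 = k%:R / 2 :> R by rewrite im /k; field.
rewrite ferrersP_geg //.
have -> : sin t `^ (k%:R / 2) = sin t `^ ((i%:R - 2) / 2) * sin t ^+ l.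
  rewrite -(powR_mulrn l (ltW s0)) -powRD ?(gt_eqF s0) ?implybT //; congr (_ `^ _).
  by rewrite im /k; field.
rewrite powRN -/(Ynorm i) (_ : k.+1 = i.-1 + 2 * l)%N; last by rewrite im /k /=; lia.
have q0 : sin t `^ ((i%:R - 2) / 2) != 0 by rewrite gt_eqF // powR_gt0.
set q := sin t `^ _ in q0 *; set g := geg _ _ _ _; set a := cLl _ _ _ _.
by rewrite /w -/a; field; rewrite fact_neq0 q0 p0.
Qed.

(** Opposite orders give the same function up to sign, which w^2 does not see. The Ferrers function
    now has order +l, hence c = 1 - l in its series. *)
Lemma Ptilde_formN L l : (l <= L)%N ->
  exists2 w : R, w ^+ 2 = Ycst 2 * coefY R 1 L l &
   forall t, 0 <= t <= pi ->
     Ptilde 2 L%:Z (- l%:Z) t = w * sin t ^+ l * geg (1 + 2 * l) (L - l) (cos t) 1.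
Proof.
move=> lL.
have p0 : 2 `^ l%:R != 0 :> R by rewrite gt_eqF // powR_gt0.
pose w := Ynorm 2 * cLl R 2 L%:Z (- l%:Z) *
   ((-1) ^+ l * (2 * l)`!%:R / (l`!%:R * (L - l)`!%:R) / 2 `^ l%:R).
exists w.
  have -> : w ^+ 2 = ((-1) ^+ l) ^+ 2 * (Ynorm 2 ^+ 2 * cLl R 2 L%:Z (- l%:Z) ^+ 2) / (L - l)`!%:R ^+ 2 *
     (l`!%:R^-1 * (2 * l)`!%:R / 2 `^ l%:R) ^+ 2.
    by rewrite /w; field; rewrite p0 !fact_neq0.
  rewrite sqrr_sign mul1r cLl_sqrN //.
  have := rGamma_double 0 l; rewrite add0n.
  have -> : (2 * l).+2%:R / 2 = l.+1%:R :> R by field.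
  have -> : (2 * l)%:R / 2 = l%:R :> R by field.
  rewrite rGamma_fact => ->.
  rewrite /Ycst /coefY /= exprMn -prodrXl (_ : (L + l + 1).-1 = L + l)%N; last by lia.
  rewrite (_ : (2 - 2) / 2 = 0%:R / 2 :> R); last by rewrite subrr.
  set P := \prod_(_ < _) _; set q := 2 `^ _.
  have q0 : q != 0 by rewrite gt_eqF // powR_gt0.
  by field; rewrite !fact_neq0 q0.
apply: Ptilde_extend => t tpi; rewrite /Ptilde_open.
have s0 : 0 < sin t by exact: sin_gt0_pi.
rewrite -/(Ynorm 2) subrr mul0r oppr0 powRr0 !addr0 mulrNz opprK mulr1.
by rewrite ferrersP_geg_neg // /w !powR_mulrn ?(ltW s0) // (_ : (2 * l).+1 = 1 + 2 * l)%N //; ring.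
Qed.

End Real.

(** * The addition theorem for spherical harmonics *)

(** The sets [tau] listed by recursion on the last entry, the splitting on which the induction on
    the dimension runs. Here e counts the angles: e = 1 is the circle, where k and - k merge at k =
    0. *)
Fixpoint taus (e k : nat) : seq (seq int) :=
  if e is e'.+1 then
    if e' is 0%N then (if k == 0%N then [:: [:: 0]] else [:: [:: k%:Z]; [:: - k%:Z]])
    else [seq rcons a k%:Z | l <- iota 0 k.+1, a <- taus e' l]
  else [::].

Lemma tausS e k : taus e.+2 k = [seq rcons a k%:Z | l <- iota 0 k.+1, a <- taus e.+1 l].
Proof. by []. Qed.

Lemma mem_taus1 k a : (a \in taus 1 k) = (size a == 1%N) && (absz a`_0 == k).
Proof.
rewrite /=; case: eqP => [->|k0].
  by case: a => [|x [|y a]] //=; rewrite inE eqseq_cons ?andbF // eqxx andbT absz_eq0.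
case: a => [|x [|y a]] //=; rewrite !inE !eqseq_cons ?andbF // eqxx !andbT.
by apply/orP/eqP => [[]/eqP->|]; rewrite ?abszN //; lia.
Qed.

Lemma mem_tausP e k (a : seq int) : reflect
  [/\ size a = e.+1, (forall i, (1 <= i < e.+1)%N -> `|a.[# i]| <= a.[# i.+1])
    & absz a.[# e.+1] = k]
  (a \in taus e.+1 k).
Proof.
elim: e k a => [|e IH] k a.
  rewrite mem_taus1; apply: (iffP andP) => [[/eqP sa /eqP ak]|[sa _ ak]].
    by split=> // i; case: i => [|[]].
  by split; [apply/eqP|apply/eqP].
rewrite tausS; apply: (iffP allpairsPdep) => [[l [b [lk bl ->]]]|[sa mono ak]].
  have {}lk : (l <= k)%N by move: lk; rewrite mem_iota.
  have [sb mb bl'] := IH _ _ bl.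
  rewrite size_rcons sb; split=> //.
  - move=> i /andP[i1 ie]; rewrite /coord1 !nth_rcons sb.
    have [ie'|->] : (i < e.+1)%N \/ i = e.+1 by lia.
      have -> : (i.-1 < e.+1)%N by lia.
      have -> : (i.+1.-1 < e.+1)%N by lia.
      by apply: mb; rewrite i1 ie'.
    by move: bl'; rewrite /coord1 /= !ltnn !ltnSn eqxx; lia.
  - by rewrite /coord1 nth_rcons sb /= ltnn eqxx.
have [b [x ab]] : exists b x, a = rcons b x.
  by case/lastP: a sa {mono ak} => // b x _; exists b, x.
subst a; move: sa; rewrite size_rcons => -[sb].
have lx : (rcons b x).[# e.+2] = x by rewrite /coord1 nth_rcons sb /= ltnn eqxx.
have lb i : (1 <= i <= e.+1)%N -> (rcons b x).[# i] = b.[# i].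
  by move=> hi; rewrite /coord1 nth_rcons sb; have -> : (i.-1 < e.+1)%N by lia.
rewrite lx in ak.
have := mono e.+1; rewrite lx lb ?leqnn // => /(_ isT) bx.
exists (absz b.[# e.+1]), b; split.
- by rewrite mem_iota /=; lia.
- apply/IH; split=> // i hi; have := mono i; rewrite !lb; [apply; lia|lia|lia].
- by congr rcons; lia.
Qed.

Lemma taus_uniq e k : uniq (taus e.+1 k).
Proof.
elim: e k => [|e IH] k.
  by rewrite /=; case: eqP => //= k0; rewrite inE eqseq_cons andbT andbT; apply/eqP; lia.
rewrite tausS; apply: allpairs_uniq_dep.
- exact: iota_uniq.
- by move=> l _; exact: IH.
move=> [l a] [m b] /allpairsPdep[l1 [a1 [_ ha1 [-> ->]]]] /allpairsPdep[m1 [b1 [_ hb1 [-> ->]]]] /=.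
move=> /rcons_inj [ab]; subst b1.
have /mem_tausP[_ _ e1] := ha1; have /mem_tausP[_ _ e2] := hb1.
by rewrite -e1 -e2.
Qed.

Lemma tau_taus d k (a : d.-1.-tuple int) : (3 <= d)%N ->
  tau d k a <-> tval a \in taus d.-1 k.
Proof.
move=> d3; have [e de] : exists e, d.-1 = e.+2 by exists (d - 3)%N; lia.
move: a; rewrite /tau de => a; split.
  move=> [a12 mono ak].
  have nn i : (2 <= i <= e.+2)%N -> 0 <= a.[# i].
    elim: i => // -[//|[|i]] IH hi; first exact: le_trans (normr_ge0 _) a12.
    by apply: (le_trans (IH _)); [lia|apply: mono; lia].
  apply/mem_tausP; rewrite size_tuple; split=> //; last by rewrite ak.
  move=> -[//|[|i]] hi //.
  by rewrite ger0_norm; [apply: mono; lia|apply: nn; lia].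
move=> /mem_tausP[_ mono ak]; split.
- by apply: mono.
- by move=> i hi; apply: le_trans (mono i _); [exact: ler_norm|lia].
have := mono e.+1; rewrite ltnSn => /(_ isT) h.
have : 0 <= a.[# e.+2] by exact: le_trans h.
by move=> h2; rewrite -ak gez0_abs.
Qed.

Section Real.
Variable R : realType.
Implicit Types (x y c : R) (t s : nat -> R) (n l N L i : nat).

Lemma realcM x y : (x * y)%:C = x%:C * y%:C :> R[i].
Proof. exact: rmorphM. Qed.

Definition Yseq e (a : seq int) (t : nat -> R) : R[i] :=
  ((Num.sqrt (2 * pi))^-1)%:C
  * (cos (a.[# 1]%:~R * t 1%N) +i* sin (a.[# 1]%:~R * t 1%N))
  * (\prod_(2 <= i < e.+1) Ptilde i a.[# i] a.[# i.-1] (t i))%:C.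

(** The inner product of the two points with angles t and s; for e = 1 it is cos (t 1 - s 1). *)
Fixpoint polar_dot (t s : nat -> R) e : R :=
  if e is e'.+1 then cos (t e) * cos (s e) + sin (t e) * sin (s e) * polar_dot t s e' else 1.

Lemma polar_dotS t s e : polar_dot t s e.+1 =
  cos (t e.+1) * cos (s e.+1) + sin (t e.+1) * sin (s e.+1) * polar_dot t s e.
Proof. by []. Qed.

Definition angles e (t : nat -> R) := forall i, (2 <= i <= e)%N -> 0 <= t i <= pi.

(* Accounts for Y_alpha being orthonormal only up to a constant. *)
Fixpoint kerC e : R :=
  if e is e'.+1 then (if e' is 0 then (2 * pi)^-1 else kerC e' * Ycst R e * e'%:R) else 1.

Lemma kerCS e : kerC e.+2 = kerC e.+1 * Ycst R e.+2 * e.+1%:R.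
Proof. by [].  Qed.

Lemma kerC_gt0 e : (0 < e)%N -> 0 < kerC e.
Proof.
elim: e => // -[|e] IH _ /=; first by rewrite invr_gt0 mulr_gt0 ?pi_gt0.
by rewrite mulr_gt0 ?ltr0n // mulr_gt0 ?Ycst_gt0 // IH.
Qed.

Lemma prod_natSr (F G : nat -> R) e : (forall i, (2 <= i < e.+2)%N -> F i = G i) ->
  \prod_(2 <= i < e.+3) F i = \prod_(2 <= i < e.+2) G i * F e.+2.
Proof. by move=> FG; rewrite big_nat_recr //=; congr (_ * _); exact: eq_big_nat. Qed.

Lemma Yseq_rcons e a (x : int) t : (size a = e.+1) ->
  Yseq e.+2 (rcons a x) t = Yseq e.+1 a t * (Ptilde e.+2 x a.[# e.+1] (t e.+2))%:C.
Proof.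
move=> sa.
have c i : (1 <= i <= e.+1)%N -> (rcons a x).[# i] = a.[# i].
  by move=> hi; rewrite /coord1 nth_rcons sa; have -> : (i.-1 < e.+1)%N by lia.
have cl : (rcons a x).[# e.+2] = x by rewrite /coord1 nth_rcons sa /= ltnn eqxx.
have E := @prod_natSr (fun i => Ptilde i (rcons a x).[# i] (rcons a x).[# i.-1] (t i))
   (fun i => Ptilde i a.[# i] a.[# i.-1] (t i)) e.
rewrite /= cl (c e.+1) ?leqnn // in E.
rewrite /Yseq E => [|i hi]; last by rewrite (c i) ?(c i.-1) //; lia.
by rewrite realcM mulrA (c 1%N).
Qed.

(** A negative last entry of a can occur only for e = 0, and then [Ptilde_formN] gives the same
    product. *)
Lemma Ptilde_mul e k a (t s : R) : a \in taus e.+1 k -> forall L, (k <= L)%N ->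
   0 <= t <= pi -> 0 <= s <= pi ->
  Ptilde e.+2 L%:Z a.[# e.+1] t * Ptilde e.+2 L%:Z a.[# e.+1] s =
  Ycst R e.+2 * coefY R e.+1 L k * (sin t * sin s) ^+ k * geg (e.+1 + 2 * k) (L - k) (cos t) 1
     * geg (e.+1 + 2 * k) (L - k) (cos s) 1.
Proof.
move=> ha L kL ht hs.
suff [w w2 wE] : exists2 w : R, w ^+ 2 = Ycst R e.+2 * coefY R e.+1 L k &
   forall u : R, 0 <= u <= pi ->
     Ptilde e.+2 L%:Z a.[# e.+1] u = w * sin u ^+ k * geg (e.+1 + 2 * k) (L - k) (cos u) 1.
  by rewrite !wE // -w2 exprMn; ring.
have /mem_tausP[sa mono ak] := ha.
have [ax|[e0 ax]] : (a.[# e.+1] = k%:Z \/ e = 0%N /\ a.[# e.+1] = - k%:Z)%R.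
- case: e ha sa mono ak => [|e] ha sa mono ak.
    by move: ak; lia.
  by left; have := mono e.+1; rewrite ltnSn => /(_ isT); move: ak; lia.
- rewrite ax; exact: (@Ptilde_form R e.+2).
- rewrite ax e0; exact: Ptilde_formN.
Qed.

Lemma conjC_real x : (x%:C)^*%R = x%:C :> R[i].
Proof. by apply: CrealP; rewrite complex_real. Qed.

Lemma conjCM (z w : R[i]) : (z * w)^*%R = z^*%R * w^*%R.
Proof. exact: rmorphM. Qed.

Lemma conj_pair (a b : R) : (a +i* b)^*%R = a +i* (- b).
Proof. by []. Qed.

Lemma Yseq1_mul (m : int) t s : Yseq 1 [:: m] t * (Yseq 1 [:: m] s)^*%R =
  ((2 * pi)^-1)%:C * (cos (m%:~R * (t 1%N - s 1%N)) +i* sin (m%:~R * (t 1%N - s 1%N))).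
Proof.
have p0 : 0 <= 2 * pi :> R by rewrite mulr_ge0 ?pi_ge0.
have c1 : 1%:C = 1 :> R[i] by exact: rmorph1.
rewrite /Yseq !big_geq // c1 !mulr1 conjCM conjC_real conj_pair mulrACA -realcM.
rewrite -invfM -expr2 sqr_sqrtr //; congr (_ * _).
rewrite mulrBr cosB sinB /coord1 /=.
by apply/eqP; rewrite eq_complex /=; apply/andP; split; apply/eqP; ring.
Qed.

(** Induction on the number of angles. For a next-to-last entry of absolute value l, the inner sum
    is the theorem on the sphere of one dimension less; the sum over l is then [addition_kernel].
    The circle is the base case. *)
Lemma addition_theorem e k (t s : nat -> R) : angles e.+1 t -> angles e.+1 s ->
  \sum_(a <- taus e.+1 k) Yseq e.+1 a t * (Yseq e.+1 a s)^*%R =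
  (kerC e.+1 * zonal e.+2 k (polar_dot t s e.+1))%:C.
Proof.
elim: e k => [|e IH] k ht hs.
  have -> : polar_dot t s 1 = cos (t 1%N - s 1%N) by rewrite /= cosB mulr1.
  have cp (a b : R) : (a +i* b) + (a +i* (- b)) = (2 * a)%:C.
    by apply/eqP; rewrite eq_complex /=; apply/andP; split; apply/eqP; ring.
  rewrite zonal_cos; case: k => [|k].
    have -> : taus 1 0 = [:: [:: 0]] by [].
    by rewrite big_seq1 Yseq1_mul mul0r cos0 sin0 -realcM.
  have -> : taus 1 k.+1 = [:: [:: k.+1%:Z]; [:: - k.+1%:Z]] by [].
  have kN : (- k.+1%:Z)%:~R = - k.+1%:R :> R by rewrite mulrNz.
  rewrite big_cons.
  rewrite big_seq1.
  have e1 := Yseq1_mul k.+1%:Z t s.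
  have e2 := Yseq1_mul (- k.+1%:Z) t s.
  rewrite kN mulNr cosN sinN in e2.
  etransitivity; first exact: (congr2 +%R e1 e2).
  by rewrite -mulrDr cp -realcM.
rewrite tausS big_allpairs_dep.
have := @addition_kernel R e.+1 k (cos (t e.+2)) (cos (s e.+2)) (sin (t e.+2)) (sin (s e.+2))
   (polar_dot t s e.+1) isT (sin2cos2 _) (sin2cos2 _).
move=> H; rewrite polar_dotS.
transitivity ((kerC e.+1 * Ycst R e.+2 * (e.+1%:R * zonal e.+3 k
   (cos (t e.+2) * cos (s e.+2) + sin (t e.+2) * sin (s e.+2) * polar_dot t s e.+1)))%:C); last first.
  by rewrite kerCS mulrA.
pose G l := (kerC e.+1 * Ycst R e.+2 * (coefY R e.+1 k l * (sin (t e.+2) * sin (s e.+2)) ^+ l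
  * geg (e.+1 + 2 * l) (k - l) (cos (t e.+2)) 1 * geg (e.+1 + 2 * l) (k - l) (cos (s e.+2)) 1
  * zonal e.+2 l (polar_dot t s e.+1)))%:C.
transitivity (\sum_(l < k.+1) G l); last by rewrite -H mulr_sumr rmorph_sum.
rewrite -(big_mkord xpredT G) /index_iota subn0 /G.
apply: eq_big_seq => l; rewrite mem_iota => lk.
have ht' : angles e.+1 t by move=> i hi; apply: ht; lia.
have hs' : angles e.+1 s by move=> i hi; apply: hs; lia.
transitivity (\sum_(a <- taus e.+1 l) (Yseq e.+1 a t * (Yseq e.+1 a s)^*%R) *
    (Ycst R e.+2 * coefY R e.+1 k l * (sin (t e.+2) * sin (s e.+2)) ^+ l * geg (e.+1 + 2 * l) (k - l) (cos (t e.+2)) 1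
     * geg (e.+1 + 2 * l) (k - l) (cos (s e.+2)) 1)%:C).
  apply: eq_big_seq => a al.
  have sa : size a = e.+1 by case/mem_tausP: (al).
  have lk' : (l <= k)%N by lia.
  have h1 : 0 <= t e.+2 <= pi by apply: ht; lia.
  have h2 : 0 <= s e.+2 <= pi by apply: hs; lia.
  rewrite !Yseq_rcons // -(Ptilde_mul al lk' h1 h2).
  by rewrite conjCM conjC_real realcM mulrACA.
rewrite -mulr_suml IH // -realcM; congr (_%:C); ring.
Qed.

End Real.

(** * Size of the zonal functions and pointwise bounds on the harmonics *)

Section Real.
Variable R : realType.
Implicit Types (x y c : R) (t s : nat -> R) (n l N L i : nat).

Lemma polar_dot_self t e : polar_dot t t e = 1.
Proof.
by elim: e => // e IH; rewrite polar_dotS IH mulr1 -!expr2 cos2Dsin2.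
Qed.

Lemma zonalN N L x : zonal N L (- x) = (-1) ^+ L * zonal N L x.
Proof.
rewrite /zonal mulrA; congr (_ / _); rewrite /zgeg.
have h n : geg N n (- x) 1 = (-1) ^+ n * geg N n x 1.
  by rewrite -geg_homog; congr geg; ring.
rewrite !h; case: L => [|[|L]]; rewrite ?muln0 ?mul0n /=; [by ring..|].
by rewrite !exprS; ring.
Qed.

Lemma zonal1E N L : zonal N.+3 L 1 = (2 * L + N.+1)%:R / N.+1%:R * (L + N)`!%:R / (N`!%:R * L`!%:R) :> R.
Proof.
have N0 : N.+1%:R != 0 :> R by [].
apply: (mulfI N0); rewrite /zonal mulrA -zgegE.
have /(canRL (mulfK (fact_neq0 R N))) -> := geg11 R N L.
by field; rewrite !fact_neq0 nat1r N0.
Qed.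

Lemma fact_ratio_bounds L N :
  L.+1%:R ^+ N <= (L + N)`!%:R / L`!%:R :> R /\ (L + N)`!%:R / L`!%:R <= N`!%:R * L.+1%:R ^+ N :> R.
Proof.
elim: N => [|N [IH1 IH2]]; first by rewrite addn0 divff ?fact_neq0 // fact0 mulr1.
have -> : (L + N.+1)`!%:R / L`!%:R = (L + N.+1)%:R * ((L + N)`!%:R / L`!%:R) :> R.
  by rewrite addnS factrS mulrA.
rewrite factrS exprS; split.
  by apply: ler_pM; rewrite ?exprn_ge0 // ler_nat; lia.
have h : (L + N.+1)%:R <= N.+1%:R * L.+1%:R :> R by rewrite -natrM ler_nat; nia.
apply: (@le_trans _ _ ((N.+1%:R * L.+1%:R) * (N`!%:R * L.+1%:R ^+ N))).
  by apply: ler_pM => //; rewrite divr_ge0.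
by rewrite le_eqVlt; apply/orP; left; apply/eqP; ring.
Qed.

Lemma zonal1_bounds e : exists2 c : R, 0 < c & forall L,
  c * L.+1%:R ^+ e <= zonal e.+2 L (1 : R) /\ zonal e.+2 L (1 : R) <= 2 * L.+1%:R ^+ e.
Proof.
case: e => [|N].
  exists 1 => // L; have -> : zonal 2 L (1 : R) = zonal 2 L (cos 0) by rewrite cos0.
  rewrite zonal_cos mulr0 cos0 !expr0 !mulr1.
  by case: eqP => _; split; lra.
have f0 : 0 < N`!%:R :> R by rewrite ltr0n fact_gt0.
exists (N.+1%:R * N`!%:R)^-1 => [|L]; first by rewrite invr_gt0 mulr_gt0.
have [b1 b2] := fact_ratio_bounds L N.
have -> : zonal N.+3 L (1 : R) = ((2 * L + N.+1)%:R / N.+1%:R) * (((L + N)`!%:R / L`!%:R) / N`!%:R).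
  by rewrite zonal1E invfM; ring.
rewrite exprS; split.
  rewrite invfM mulrACA; apply: ler_pM.
  - by rewrite mulr_ge0 // invr_ge0.
  - by rewrite mulr_ge0 ?exprn_ge0 // invr_ge0 ltW.
  - by rewrite mulrC ler_wpM2r ?invr_ge0 // ler_nat; lia.
  - by rewrite mulrC ler_wpM2r // invr_ge0 ltW.
rewrite [leRHS]mulrA; apply: ler_pM.
- by rewrite divr_ge0.
- by rewrite !divr_ge0.
- by rewrite ler_pdivrMr // -!natrM ler_nat; nia.
- by rewrite ler_pdivrMr // [leRHS]mulrC.
Qed.

(** At y = 1 only l = 0 survives in [addition_kernel], so the zonal function is a multiple of [geg]
    at x times [geg] at 1. Its square is then the quantity bounded by [coefY_bound] times the same
    quantity at 1, which is a multiple of the zonal value at 1. *)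
Lemma zonal_decay e x : -1 < x < 1 -> exists2 C : R, 0 <= C & forall L,
  zonal e.+3 L x ^+ 2 <= C * Num.sqrt L.+1%:R * zonal e.+3 L (1 : R).
Proof.
move=> /andP[x1 x2]; pose s := Num.sqrt (1 - x ^+ 2).
have x3 : 0 < 1 - x ^+ 2 by rewrite (_ : 1 - x ^+ 2 = (1 - x) * (1 + x)); [rewrite mulr_gt0; lra|ring].
have s0 : 0 < s by rewrite sqrtr_gt0.
have sE : s ^+ 2 = 1 - x ^+ 2 by rewrite sqr_sqrtr // ltW.
have [C C0 CP] := coefY_bound (ltn0Sn e) s0 sE.
exists C => // L.
have N0 : 0 < e.+1%:R :> R by [].
have kE y (r : R) : r ^+ 2 = 1 - y ^+ 2 ->
   e.+1%:R * zonal e.+3 L y = coefY R e.+1 L 0 * geg e.+1 L y 1 * geg e.+1 L 1 1.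
  move=> rE; have o : 0 ^+ 2 = 1 - 1 ^+ 2 :> R by rewrite expr0n expr1n subrr.
  have := addition_kernel L 0 (ltn0Sn e) rE o.
  rewrite !mulr0 mulr1 addr0 => <-.
  rewrite big_ord_recl big1 ?addr0; last by move=> l _; rewrite lift0 expr0n /=; ring.
  by rewrite /= expr0 muln0 addn0 subn0 mulr1 /zonal /zgeg /= geg0 mul0n !mul0r subr0 divr1 mulr1.
have k1 := kE x s sE.
have k2 : e.+1%:R * zonal e.+3 L (1 : R) = coefY R e.+1 L 0 * geg e.+1 L 1 1 * geg e.+1 L 1 1.
  by apply: (kE 1 0); rewrite expr0n expr1n subrr.
have z1 : 0 <= zonal e.+3 L 1 :> R.
  by rewrite zonal1E !divr_ge0 ?mulr_ge0 // invr_ge0.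
have := CP L 0 (leq0n _); rewrite expr0 expr1n mulr1 muln0 addn0 subn0 => B.
have : (e.+1%:R * zonal e.+3 L x) ^+ 2 = (coefY R e.+1 L 0 * geg e.+1 L x 1 ^+ 2) * (e.+1%:R * zonal e.+3 L (1 : R)).
  by rewrite k1 k2; ring.
have h := ler_wpM2r (mulr_ge0 (ltW N0) z1) B.
rewrite exprMn => E; have N1 : 1 <= e.+1%:R :> R by rewrite ler1n.
have N2 : 0 < e.+1%:R ^+ 2 :> R by rewrite exprn_gt0.
rewrite -(ler_pM2l N2) E; apply: (le_trans h).
have q0 : 0 <= C * Num.sqrt L.+1%:R * zonal e.+3 L 1 by rewrite mulr_ge0 // mulr_ge0 ?sqrtr_ge0.
have := ler_wpM2l (ltW N0) (ler_wpM2r q0 N1); lra.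
Qed.

Definition Ynorm2 e (a : seq int) t : R :=
  (2 * pi)^-1 * \prod_(2 <= i < e.+1) Ptilde i a.[# i] a.[# i.-1] (t i) ^+ 2.

Lemma Yseq_normK e a t : Yseq e a t * (Yseq e a t)^*%R = (Ynorm2 e a t)%:C.
Proof.
have p0 : 0 <= 2 * pi :> R by rewrite mulr_ge0 ?pi_ge0.
rewrite /Yseq /Ynorm2 prodrXl; move: (\prod_(_ <= _ < _) _) => P.
rewrite !conjCM !conjC_real conj_pair; set th := _ * t 1%N.
transitivity ((((Num.sqrt (2 * pi))^-1)%:C * ((Num.sqrt (2 * pi))^-1)%:C) *
   ((cos th +i* sin th) * (cos th +i* - sin th)) * (P%:C * P%:C)); first by ring.
have -> : (cos th +i* sin th) * (cos th +i* - sin th) = 1%:C.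
  have := cos2Dsin2 th => h.
  apply/eqP; rewrite eq_complex /=; apply/andP; split; apply/eqP; [rewrite -h|]; ring.
by rewrite -!realcM mulr1 -invfM -!expr2 sqr_sqrtr.
Qed.

Lemma Ynorm2_ge0 e a t : 0 <= Ynorm2 e a t.
Proof.
rewrite mulr_ge0 ?invr_ge0 ?mulr_ge0 ?pi_ge0 //.
by apply: prodr_ge0 => i _; exact: sqr_ge0.
Qed.

Lemma Ynorm2_rcons e a (x : int) t : size a = e.+1 ->
  Ynorm2 e.+2 (rcons a x) t = Ynorm2 e.+1 a t * Ptilde e.+2 x a.[# e.+1] (t e.+2) ^+ 2.
Proof.
move=> sa.
have c i : (1 <= i <= e.+1)%N -> (rcons a x).[# i] = a.[# i].
  by move=> hi; rewrite /coord1 nth_rcons sa; have -> : (i.-1 < e.+1)%N by lia.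
have cl : (rcons a x).[# e.+2] = x by rewrite /coord1 nth_rcons sa /= ltnn eqxx.
have E := @prod_natSr R (fun i => Ptilde i (rcons a x).[# i] (rcons a x).[# i.-1] (t i) ^+ 2)
   (fun i => Ptilde i a.[# i] a.[# i.-1] (t i) ^+ 2) e.
rewrite /= cl (c e.+1) ?leqnn // in E.
have H i : (2 <= i < e.+2)%N -> Ptilde i (rcons a x).[# i] (rcons a x).[# i.-1] (t i) ^+ 2 =
    Ptilde i a.[# i] a.[# i.-1] (t i) ^+ 2.
  by move=> hi; rewrite (c i) ?(c i.-1) //; lia.
exact: (etrans (congr1 (fun p => (2 * pi)^-1 * p) (E H)) (mulrA _ _ _)).
Qed.

(** One term of the addition theorem at two equal points, where all terms are nonnegative. *)
Lemma Ynorm2_le_zonal e k a t : angles e.+1 t -> a \in taus e.+1 k ->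
  Ynorm2 e.+1 a t <= kerC R e.+1 * zonal e.+2 k (1 : R).
Proof.
move=> ht ak.
have S : \sum_(b <- taus e.+1 k) Ynorm2 e.+1 b t = kerC R e.+1 * zonal e.+2 k (1 : R).
  apply: (@complexI R); have -> : zonal e.+2 k (1 : R) = zonal e.+2 k (polar_dot t t e.+1) by rewrite polar_dot_self.
  rewrite -addition_theorem //.
  by rewrite rmorph_sum; apply: eq_bigr => b _; rewrite Yseq_normK.
rewrite -S (big_rem a) //= lerDl sumr_ge0 // => b _; exact: Ynorm2_ge0.
Qed.

Lemma taus_coord_gt0 e k j a : (1 <= j <= e.+1)%N -> a \in taus e.+1 k -> a.[# j] != 0 -> (0 < k)%N.
Proof.
move=> /andP[j1 je] /mem_tausP[sa mono ak] aj.
have h m : (j + m <= e.+1)%N -> 0 < `|a.[# j + m]|.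
  elim: m => [|m IH] hm; first by rewrite addn0 normr_gt0.
  have := mono (j + m)%N; rewrite addnS => /(_ ltac:(lia)) le.
  apply: (lt_le_trans (IH _)); first by lia.
  by apply: (le_trans le); exact: ler_norm.
have := h (e.+1 - j)%N; rewrite subnKC // => /(_ (leqnn _)).
by rewrite normr_gt0 -ak absz_gt0.
Qed.

(** Induction on the angles beyond the j-th: the first j are bounded together by a zonal value, of
    order k^(j-1), and each later one contributes a factor sqrt k by [coefY_bound]. *)
Lemma Ynorm2_bound e j t : angles e.+1 t -> (1 <= j <= e.+1)%N ->
  exists2 C : R, 0 <= C & forall k a, a \in taus e.+1 k -> a.[# j] != 0 ->
    Ynorm2 e.+1 a t <= C * (k.+1%:R ^+ j.-1 * Num.sqrt k.+1%:R ^+ (e.+1 - j)).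
Proof.
move=> + /andP[j1].
have base m : angles m.+1 t -> j = m.+1 -> exists2 C : R, 0 <= C & forall k a,
    a \in taus m.+1 k -> a.[# j] != 0 ->
    Ynorm2 m.+1 a t <= C * (k.+1%:R ^+ j.-1 * Num.sqrt k.+1%:R ^+ (m.+1 - j)).
  move=> ht ->; have [c _ zb] := zonal1_bounds m.
  have K0 := kerC_gt0 R (ltn0Sn m).
  exists (kerC R m.+1 * 2) => [|k a ak _]; first by rewrite mulr_ge0 // ltW.
  apply: (le_trans (Ynorm2_le_zonal ht ak)).
  rewrite subnn expr0 mulr1 -mulrA ler_pM2l //.
  by case: (zb k).
elim: e => [|e IH] ht je; first by apply: base => //; lia.
have [je'|je'] : (j = e.+2 \/ j <= e.+1)%N by lia.
  exact: base.
have ht' : angles e.+1 t by move=> i hi; apply: ht; lia.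
have [C C0 CP] := IH ht' je'.
have hte : 0 <= t e.+2 <= pi by apply: ht; lia.
have [D D0 DP] : exists2 D : R, 0 <= D & forall l k, (0 < l <= k)%N ->
   coefY R e.+1 k l * sin (t e.+2) ^+ l ^+ 2 * geg (e.+1 + 2 * l) (k - l) (cos (t e.+2)) 1 ^+ 2
     <= D * Num.sqrt k.+1%:R.
  (* At a pole [coefY_bound] does not apply, but sin^l vanishes, as l > 0. This is where a_j <> 0
     enters. *)
  have [s0|s0] := eqVneq (sin (t e.+2)) 0.
    exists 0 => // l k /andP[l0 _]; rewrite s0 expr0n (negbTE (lt0n_neq0 l0)) expr0n /=.
    by rewrite mulr0 !mul0r.
  have sp : 0 < sin (t e.+2) by rewrite lt_neqAle eq_sym s0 sin_ge0_pi.
  have [D D0 DP] := coefY_bound (ltn0Sn e) sp (sin2cos2 (t e.+2)).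
  by exists D => // l k /andP[_ lk]; exact: DP.
have Y0 := Ycst_gt0 R (isT : (2 <= e.+2)%N).
exists (C * (Ycst R e.+2 * D)) => [|k a].
  by rewrite mulr_ge0 // mulr_ge0 // ltW.
rewrite tausS => /allpairsPdep[l [b [lk bl ->]]].
have {}lk : (l <= k)%N by move: lk; rewrite mem_iota; lia.
have sb : size b = e.+1 by case/mem_tausP: (bl).
have -> : (rcons b k%:Z).[# j] = b.[# j].
  by rewrite /coord1 nth_rcons sb; have -> : (j.-1 < e.+1)%N by lia.
move=> bj.
have l0 : (0 < l)%N by apply: taus_coord_gt0 bl bj; rewrite j1.
rewrite Ynorm2_rcons //.
have P2 := Ptilde_mul bl lk hte hte.
set p := Ptilde _ _ _ _ in P2 *.
have pE : p ^+ 2 <= Ycst R e.+2 * D * Num.sqrt k.+1%:R.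
  have -> : p ^+ 2 = Ycst R e.+2 * (coefY R e.+1 k l * sin (t e.+2) ^+ l ^+ 2
     * geg (e.+1 + 2 * l) (k - l) (cos (t e.+2)) 1 ^+ 2).
    by rewrite expr2 P2 exprMn; ring.
  by rewrite -[leRHS]mulrA ler_pM2l //; apply: DP; rewrite l0.
have lk1 : l.+1%:R <= k.+1%:R :> R by rewrite ler_nat.
have h : Ynorm2 e.+1 b t <= C * (k.+1%:R ^+ j.-1 * Num.sqrt k.+1%:R ^+ (e.+1 - j)).
  apply: (le_trans (CP l b bl bj)); apply: ler_wpM2l => //.
  apply: ler_pM; rewrite ?exprn_ge0 ?sqrtr_ge0 //.
    by rewrite lerXn2r ?nnegrE.
  by rewrite lerXn2r ?nnegrE ?sqrtr_ge0 // ler_wsqrtr.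
apply: (le_trans (ler_pM (Ynorm2_ge0 _ _ _) (sqr_ge0 p) h pE)).
rewrite (_ : e.+2 - j = (e.+1 - j).+1)%N; last by lia.
by rewrite exprS le_eqVlt; apply/orP; left; apply/eqP; ring.
Qed.

End Real.

(** * Polar coordinates *)

Section Real.
Variable R : realType.
Implicit Types (c : R) (t s x : nat -> R) (n l N L i j e : nat).

Definition polar_coord e t j : R :=
  (\prod_(e.+1 - j <= l < e.+1) sin (t l)) * (if j == e then 1 else cos (t (e.+1 - j.+1)%N)).

Lemma polar_coord0 e t : polar_coord e.+1 t 0 = cos (t e.+1).
Proof. by rewrite /polar_coord subn0 big_geq // mul1r subSS subn0. Qed.

Lemma polar_coordS e t j : (j <= e)%N ->
  polar_coord e.+1 t j.+1 = sin (t e.+1) * polar_coord e t j.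
Proof.
move=> je; rewrite /polar_coord subSS big_nat_recr /=; last by lia.
by rewrite eqSS subSS mulrA; congr (_ * _); rewrite mulrC.
Qed.

Lemma polar_coord_dot e t s :
  \sum_(j < e.+1) polar_coord e t j * polar_coord e s j = polar_dot t s e.
Proof.
elim: e => [|e IH].
  by rewrite big_ord_recl big_ord0 addr0 /polar_coord /= subn0 !big_geq // !mul1r.
rewrite big_ord_recl /= !polar_coord0 -IH mulr_sumr; congr (_ + _).
by apply: eq_bigr => j _; rewrite -[bump 0 j]/(j.+1) !polar_coordS -1?ltnS //; ring.
Qed.

Lemma polar_coord_ext e t s j : (j <= e)%N -> (forall i, (1 <= i <= e)%N -> t i = s i) ->
  polar_coord e t j = polar_coord e s j.
Proof.
move=> je ts; rewrite /polar_coord; congr (_ * _).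
  by apply: eq_big_nat => i hi; rewrite ts //; lia.
by case: eqP => // jne; rewrite ts //; lia.
Qed.

Lemma circle_angle (a b : R) : a ^+ 2 + b ^+ 2 = 1 ->
  exists2 th : R, 0 <= th < 2 * pi & cos th = a /\ sin th = b.
Proof.
move=> ab; have p0 := pi_gt0 R.
have ha : -1 <= a <= 1 by have := sqr_ge0 b; move=> ?; apply/andP; split; nra.
have ia : a \in `[-1, 1] by rewrite in_itv.
have sb : sin (acos a) = `|b|.
  by rewrite sin_acos // -sqrtr_sqr; congr Num.sqrt; lra.
have [b0|b0] := leP 0 b.
  exists (acos a); last by rewrite acosK // sb ger0_norm.
  by rewrite acos_ge0 //=; have := acos_lepi ha; lra.
have b2 : 0 < b ^+ 2 by rewrite exprn_even_gt0 //= lt_eqF.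
have a1 : a < 1 by nra.
have a2 : 0 < acos a by rewrite acos_gt0 // a1 andbT; case/andP: ha.
exists (2 * pi - acos a); first by have := acos_lepi ha; lra.
have -> : 2 * pi - acos a = - acos a + pi *+ 2 by rewrite mulr_natl addrC.
by rewrite cosD2pi sinD2pi cosN sinN acosK // sb ltr0_norm // opprK.
Qed.

Lemma polar_exists e x : \sum_(j < e.+2) x j ^+ 2 = 1 ->
  exists t, [/\ 0 <= t 1%N < 2 * pi, angles e.+1 t & forall j, (j <= e.+1)%N -> polar_coord e.+1 t j = x j].
Proof.
elim: e x => [|e IH] x.
  rewrite big_ord_recl big_ord_recl big_ord0 addr0 => /circle_angle[th hth [cth sth]].
  exists (fun=> th); split=> // [i|j hj]; first by lia.
  case: j hj => [|j] hj; first by rewrite polar_coord0.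
  have -> : j = 0%N by lia.
  by rewrite polar_coordS // sth /polar_coord subn0 big_geq // !mulr1.
rewrite big_ord_recl /= => H.
pose a := x 0%N; have S0 : 0 <= \sum_(j < e.+2) x (bump 0 j) ^+ 2.
  by apply: sumr_ge0 => j _; exact: sqr_ge0.
have ha : -1 <= a <= 1 by rewrite -/a in H; apply/andP; split; nra.
have ia : a \in `[-1, 1] by rewrite in_itv.
pose r := sin (acos a).
have r0 : 0 <= r by rewrite /r sin_acos // sqrtr_ge0.
have rE : r ^+ 2 = \sum_(j < e.+2) x j.+1 ^+ 2.
  rewrite /r sin2cos2 acosK // -H -/a addrAC subrr add0r.
  by apply: eq_bigr => j _.
have [t [t1 ta tE]] : exists t, [/\ 0 <= t 1%N < 2 * pi, angles e.+1 t
    & forall j, (j <= e.+1)%N -> r * polar_coord e.+1 t j = x j.+1].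
  (* At a pole the remaining angles are arbitrary; those of (1, 0, ..., 0) are taken. *)
  have [rz|rnz] := eqVneq r 0.
    have [|t [t1 ta tE]] := IH (fun j => (j == 0%N)%:R).
      rewrite big_ord_recl big1 ?addr0 //= ?expr1n // => j _.
      by rewrite expr0n.
    exists t; split=> // j je; rewrite rz mul0r; apply/esym/eqP; rewrite -sqrf_eq0.
    have := rE; rewrite rz expr0n /= => /esym/eqP.
    rewrite psumr_eq0 => [/allP/(_ (Ordinal (je : (j < e.+2)%N)))|i _]; last exact: sqr_ge0.
    by rewrite mem_index_enum => /(_ isT).
  have [|t [t1 ta tE]] := IH (fun j => x j.+1 / r).
    under eq_bigr do rewrite exprMn exprVn.
    by rewrite -mulr_suml -rE divff // sqrf_eq0.
  by exists t; split=> // j je; rewrite tE // mulrC divfK.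
exists (fun i => if i == e.+2 then acos a else t i); split.
- exact: t1.
- move=> i hi; case: eqP => [_|ine]; last by apply: ta; lia.
  by rewrite acos_ge0 ?acos_lepi.
move=> j je; case: j je => [|j] je; first by rewrite polar_coord0 eqxx acosK.
rewrite polar_coordS // eqxx -tE //; congr (_ * _).
by apply: polar_coord_ext => // i hi; case: eqP => // ?; lia.
Qed.

Definition point_angles d (x : 'rV[R]_d) : nat -> R := fun i => (polar x).[# i].

Lemma polarP e (x : 'rV[R]_e.+2) : unit_sphere x -> polar_coordinates x (polar x).
Proof.
move=> xs; apply: (@xgetPex _ _ [set t | polar_coordinates x t]).
pose xf j : R := if insub j is Some k then x 0 k else 0.
have xfE (j : 'I_e.+2) : xf j = x 0 j by rewrite /xf valK.
have [|t [t1 ta tE]] := @polar_exists e xf.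
  by rewrite -[RHS]xs; apply: eq_bigr => j _; rewrite xfE.
exists [tuple t i.+1 | i < e.+1].
have tc i : (1 <= i <= e.+1)%N -> [tuple t i.+1 | i < e.+1].[# i] = t i.
  move=> hi; have h : (i.-1 < e.+1)%N by lia.
  rewrite /coord1 -[i.-1]/(val (Ordinal h)) -tnth_nth tnth_mktuple /=; congr t; lia.
split.
- by rewrite tc.
- by move=> i hi; rewrite tc; [apply: ta; lia|lia].
move=> i; rewrite -xfE -tE -1?ltnS // /polar_coord; congr (_ * _).
  by apply: eq_big_nat => l hl; rewrite tc //; have := ltn_ord i; lia.
by case: eqP => // hi; rewrite tc //; have := ltn_ord i; lia.
Qed.

Lemma point_angles_ok e (x : 'rV[R]_e.+2) : unit_sphere x -> angles e.+1 (point_angles x).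
Proof. by move=> /polarP[_ h _] i hi; apply: h; lia. Qed.

Lemma point_angles_dot e (x z : 'rV[R]_e.+2) : unit_sphere x -> unit_sphere z ->
  polar_dot (point_angles x) (point_angles z) e.+1 = \sum_i x 0 i * z 0 i.
Proof.
move=> /polarP[_ _ hx] /polarP[_ _ hz]; rewrite -polar_coord_dot.
by apply: eq_bigr => i _; rewrite hx hz.
Qed.

Lemma Y_Yseq e (a : e.+2.-1.-tuple int) (x : 'rV[R]_e.+2) :
  Y a x = Yseq e.+1 (tval a) (point_angles x).
Proof. by []. Qed.

Lemma unit_dot d (x z : 'rV[R]_d) : unit_sphere x -> unit_sphere z ->
  x != z -> \sum_i x 0 i * z 0 i < 1.
Proof.
move=> xs zs xz.
have H : \sum_i (x 0 i - z 0 i) ^+ 2 = 2 - 2 * \sum_i x 0 i * z 0 i.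
  rewrite (_ : 2 = 1 + 1) // -{1}xs -{1}zs mulr_sumr -big_split -sumrB.
  by apply: eq_bigr => i _ /=; ring.
have : 0 < \sum_i (x 0 i - z 0 i) ^+ 2.
  rewrite lt_neqAle sumr_ge0 ?andbT; last by move=> i _; exact: sqr_ge0.
  rewrite eq_sym psumr_eq0; last by move=> i _; exact: sqr_ge0.
  apply: contra xz => /allP h; apply/eqP/rowP => i.
  by have := h i (mem_index_enum _); rewrite sqrf_eq0 subr_eq0 => /eqP.
by rewrite H; lra.
Qed.

End Real.

(** * The quadratic form *)

Lemma cvg_sum_seq (K : numFieldType) (I : Type) (r : seq I) (F : I -> nat -> K) (l : I -> K) :
  (forall i, F i @ \oo --> l i) ->
  (fun n => \sum_(i <- r) F i n) @ \oo --> \sum_(i <- r) l i.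
Proof.
move=> Fl; elim: r => [|i r IH].
  rewrite big_nil (_ : (fun _ => _) = cst 0); first exact: cvg_cst.
  by apply/funext => n; rewrite big_nil.
rewrite big_cons (_ : (fun _ => _) = F i + (fun n => \sum_(j <- r) F j n)); first exact: cvgD.
by apply/funext => n; rewrite big_cons.
Qed.

Section Limits.
Variable R : realType.
Implicit Types (f g : nat -> R[i]) (c q z : R[i]).

(** The order of R[i] is partial: c <= z includes equality of the imaginary parts, so the two
    components are treated separately. *)
Lemma cvg_ge f q c : f @ \oo --> q -> (\forall n \near \oo, c <= f n) -> c <= q.
Proof.
move=> fq cf.
have gap (e : R) : 0 < e -> exists n, `|q - f n| < e%:C /\ c <= f n.
  move=> e0; have e0' : 0 < e%:C :> R[i] by rewrite ltcR.
  have /cvgrPdist_lt /(_ _ e0') h := fq.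
  have [N _ NP] : \forall n \near \oo, `|q - f n| < e%:C /\ c <= f n by apply: filterI.
  by exists N; exact: (NP N (leqnn N)).
have imle z : `|complex.Im z|%:C <= `|z|.
  rewrite normc_def lecR -sqrtr_sqr ler_wsqrtr // lerDr sqr_ge0 //.
rewrite lecE; apply/andP; split.
  apply/negPn/negP => ne.
  have d0 : 0 < `|complex.Im q - complex.Im c| by rewrite normr_gt0 subr_eq0.
  have [n [h1 /[!lecE] /andP[/eqP h2 _]]] := gap _ d0.
  have := le_lt_trans (imle _) h1; rewrite raddfB /= h2 ltcR ltxx //.
rewrite leNgt; apply/negP => lt.
have d0 : 0 < complex.Re c - complex.Re q by rewrite subr_gt0.
have [n [h1 /[!lecE] /andP[_ h2]]] := gap _ d0.
have := le_lt_trans (normc_ge_Re _) h1; rewrite raddfB /= ltcR distrC.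
by rewrite ltNge => /negP; apply; apply: le_trans (ler_norm _); rewrite lerB.
Qed.

Lemma cvg_conj f q : f @ \oo --> q -> (fun n => (f n)^*%R) @ \oo --> q^*%R.
Proof.
move=> /cvgrPdist_lt fq; apply/cvgrPdist_lt => e e0.
by apply: filterS (fq e e0) => n; rewrite -rmorphB norm_conjC.
Qed.

Lemma cvg_uniq f q1 q2 : f @ \oo --> q1 -> f @ \oo --> q2 -> q1 = q2.
Proof. by move=> h1 h2; apply: (cvg_unique _ h1 h2); exact: norm_hausdorff. Qed.

End Limits.

Section Form.
Variables (R : realType) (X : Type) (T : choiceType) (D : set nat) (A : nat -> set T).
Variables (w : T -> R) (Y : T -> X -> R[i]) (K : X -> X -> R[i]).
Hypothesis w_gt0 : forall k a, D k -> A k a -> 0 < w a.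
Hypothesis A_fin : forall k, D k -> finite_set (A k).

(** The quadratic form is the limit of partial sums of w_a |v_a|^2, where v_a = sum_i u_i Y_a(x_i).
    Eventually these are at least one fixed positive term, so the limit is positive and not merely
    nonnegative. *)
Lemma kernel_posdef (n : nat) (x : 'I_n -> X) :
  (forall i j, series (fun k => if k \in D then
     \sum_(a \in A k) (w a)%:C * Y a (x i) * (Y a (x j))^*%R else 0) @ \oo --> K (x i) (x j)) ->
  (forall u : 'I_n -> R[i], (forall k a, D k -> A k a -> \sum_i u i * Y a (x i) = 0) -> forall i, u i = 0) ->
  posdefmx (\matrix_(i, j) K (x i) (x j)).
Proof.
move=> Kcvg inj.
pose S i j := series (fun k => if k \in D then
     \sum_(a \in A k) (w a)%:C * Y a (x i) * (Y a (x j))^*%R else 0).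
have SE i j m : S i j m = \sum_(0 <= k < m) (if k \in D then
     \sum_(a <- fset_set (A k)) (w a)%:C * Y a (x i) * (Y a (x j))^*%R else 0).
  apply: eq_bigr => k _; case: ifPn => // kD; rewrite fsbig_finite //.
  by apply: A_fin; rewrite inE in kD.
split.
  apply/is_hermitianmxP; rewrite expr0 scale1r; apply/matrixP => i j; rewrite !mxE.
  apply: (cvg_uniq (Kcvg i j)).
  rewrite -/(S i j) (_ : S i j = fun m => (S j i m)^*%R); first exact: cvg_conj (Kcvg j i).
  apply/funext => m; rewrite !SE rmorph_sum; apply: eq_bigr => k _.
  case: ifPn => _; last by rewrite rmorph0.
  rewrite rmorph_sum; apply: eq_bigr => a _ /=.
  by rewrite !conjCM conjC_real conjCK; ring.
move=> u u0.
pose v a := \sum_i u 0 i * Y a (x i).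
have [k [a [Dk Aka va]]] : exists k a, [/\ D k, A k a & v a != 0].
  apply/not_existsP => H; move/negP: u0; apply; apply/eqP/rowP => i; rewrite mxE.
  apply: inj => k a Dk Aka; apply/eqP/negPn/negP => va.
  by apply: (H k); exists a.
pose F m := \sum_i \sum_j u 0 i * S i j m * (u 0 j)^*%R.
have FE m : F m = \sum_(0 <= k < m) (if k \in D then
    \sum_(a <- fset_set (A k)) (w a)%:C * (v a * (v a)^*%R) else 0).
  rewrite /F; under eq_bigr do under eq_bigr do rewrite SE mulr_sumr mulr_suml.
  under eq_bigr do rewrite exchange_big /=.
  rewrite exchange_big /=; apply: eq_bigr => l _.
  case: ifPn => _; last first.
    by rewrite big1 // => i _; rewrite big1 // => j _; rewrite mulr0 mul0r.
  under eq_bigr do under eq_bigr do rewrite mulr_sumr mulr_suml.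
  under eq_bigr do rewrite exchange_big /=.
  rewrite exchange_big /=; apply: eq_bigr => b _.
  rewrite /v rmorph_sum mulr_suml mulr_sumr; apply: eq_bigr => i _.
  rewrite mulr_sumr mulr_sumr; apply: eq_bigr => j _ /=.
  by rewrite conjCM; ring.
have Fcvg : F @ \oo --> (u *m (\matrix_(i, j) K (x i) (x j)) *m u^t*) 0 0.
  have -> : (u *m (\matrix_(i, j) K (x i) (x j)) *m u^t*) 0 0 =
      \sum_i \sum_j u 0 i * K (x i) (x j) * (u 0 j)^*%R.
    rewrite mxE exchange_big /=; apply: eq_bigr => j _.
    by rewrite !mxE mulr_suml; apply: eq_bigr => i _; rewrite !mxE.
  apply: cvg_sum_seq => i; apply: cvg_sum_seq => j.
  by apply: cvgM; [apply: cvgM; [exact: cvg_cst | exact: Kcvg] | exact: cvg_cst].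
have t_ge0 b l : D l -> A l b -> 0 <= (w b)%:C * (v b * (v b)^*%R).
  by move=> Dl Alb; rewrite mulr_ge0 ?mul_conjC_ge0 // lecR ltW // (w_gt0 Dl Alb).
have c0 : 0 < (w a)%:C * (v a * (v a)^*%R).
  by rewrite mulr_gt0 ?mul_conjC_gt0 // ltcR (w_gt0 Dk Aka).
apply: (lt_le_trans c0); apply: (cvg_ge Fcvg).
near=> m.
have km : (k < m)%N by near: m; exact: nbhs_infty_gt.
have s_ge0 l : 0 <= (if l \in D then \sum_(b <- fset_set (A l)) (w b)%:C * (v b * (v b)^*%R) else 0).
  case: ifPn => // lD; rewrite inE in lD; rewrite big_seq; apply: sumr_ge0 => b.
  by rewrite in_fset_set ?inE; [exact: t_ge0 | exact: A_fin].
rewrite FE big_mkord (bigD1 (Ordinal km)) //= (mem_set Dk).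
have ak : a \in fset_set (A k) by rewrite in_fset_set ?inE //; exact: A_fin.
rewrite (big_rem a) //= -addrA lerDl addr_ge0 //.
  rewrite big_seq; apply: sumr_ge0 => b /mem_rem; rewrite in_fset_set ?inE; first exact: t_ge0.
  exact: A_fin.
by apply: sumr_ge0 => l _; exact: s_ge0.
Unshelve. all: by end_near. Qed.

End Form.

(** * Cancellation between a point and its antipode *)

Section Core.
Variable R : realType.

Lemma norm_real (z : R[i]) : `|z| = (complex.Re `|z|)%:C.
Proof. by rewrite RRe_real // normr_real. Qed.

(** Exchanging the sums gives the sum over a of v_a conj(y a i0) with v_a = sum_i u_i y a i. The
    surviving terms are bounded through |y a i| |y a i0| <= b, a consequence of the bounds on the
    two squares. *)
Lemma norm_sum_restrict (I : finType) (T : eqType) (s : seq T) (B : pred T)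
    (y : T -> I -> R[i]) (u : I -> R[i]) (i0 : I) (z : I -> R) (b : R) :
  0 <= b ->
  (forall i, \sum_(a <- s) y a i * (y a i0)^*%R = (z i)%:C) ->
  (forall a, a \in s -> ~~ B a -> \sum_i u i * y a i = 0) ->
  (forall a i, a \in s -> B a -> y a i * (y a i)^*%R <= b%:C) ->
  `|\sum_i u i * (z i)%:C| <= (count B s)%:R * ((\sum_i `|u i|) * b%:C).
Proof.
move=> b0 zE v0 yb.
have -> : \sum_i u i * (z i)%:C = \sum_(a <- s) (\sum_i u i * y a i) * (y a i0)^*%R.
  under eq_bigr do rewrite -zE mulr_sumr.
  rewrite exchange_big /=; apply: eq_bigr => a _; rewrite mulr_suml.
  by apply: eq_bigr => i _; rewrite mulrA.
have yb2 a i : a \in s -> B a -> `|y a i| * `|y a i0| <= b%:C.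
  move=> sa Ba; have := yb a i sa Ba; have := yb a i0 sa Ba.
  rewrite -!normCK (norm_real (y a i)) (norm_real (y a i0)).
  have := normr_ge0 (y a i); have := normr_ge0 (y a i0).
  rewrite (norm_real (y a i)) (norm_real (y a i0)).
  move: (complex.Re _) (complex.Re _) => p q.
  by rewrite !expr2 -!realcM !lecR => p0 q0 pb qb; nra.
apply: le_trans (ler_norm_sum _ _ _) _.
rewrite -sum1_count natr_sum mulr_suml big_mkcond [leRHS]big_mkcond /=.
rewrite big_seq [leRHS]big_seq; apply: ler_sum => a sa.
case: ifPn => Ba; last by rewrite (v0 a) // mul0r normr0.
rewrite mul1r normrM norm_conjC mulr_suml; apply: le_trans (ler_wpM2r (normr_ge0 _) (ler_norm_sum _ _ _)) _.
rewrite mulr_suml; apply: ler_sum => i _.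
by rewrite normrM -mulrA ler_wpM2l ?normr_ge0 // yb2.
Qed.

Lemma near_all_ord (n : nat) (P : 'I_n -> nat -> Prop) :
  (forall i, exists N, forall k, (N <= k)%N -> P i k) ->
  exists N, forall i k, (N <= k)%N -> P i k.
Proof.
move=> /choice[N NP]; exists (\max_i N i)%N => i k le; apply: NP.
exact: leq_trans (leq_bigmax i) le.
Qed.

Lemma sqrt_large (C : R) : exists N, forall k, (N <= k)%N -> C <= Num.sqrt k.+1%:R.
Proof.
have [N NP] : exists N, C ^+ 2 < N%:R by exists (Num.bound (C ^+ 2)); apply: archi_boundP; exact: sqr_ge0.
exists N => k Nk; apply: le_trans (ler_norm C) _.
rewrite -sqrtr_sqr ler_wsqrtr //; apply: le_trans (ltW NP) _.
by rewrite ler_nat leqW.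
Qed.

(** [zonal_decay] gives (Z_k(x) / Z_k(1))^2 <= C sqrt(k+1) / Z_k(1), and Z_k(1) >= c (k+1) because
    the sphere has dimension at least 2. *)
Lemma zonal_ratio_small e (x eta : R) : -1 < x < 1 -> 0 < eta ->
  exists N, forall k, (N <= k)%N -> `|zonal e.+3 k x| <= eta * zonal e.+3 k 1.
Proof.
move=> /(zonal_decay e)[C C0 CP] eta0.
have [c c0 cP] := zonal1_bounds R e.+1.
have [N NP] := sqrt_large (C / (eta ^+ 2 * c)).
exists N => k /NP; rewrite ler_pdivrMr; last by rewrite mulr_gt0 // exprn_gt0.
have [lo _] := cP k; have dec := CP k.
move: (zonal _ k 1) (zonal _ k x) lo dec => Z z; set q : R := k.+1%:R.
move=> lo dec Cle.
have q1 : 1 <= q by rewrite ler1n.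
have q0 : 0 <= q by apply: le_trans q1.
have s0 : 0 <= Num.sqrt q by exact: sqrtr_ge0.
have Zq : c * q <= Z.
  apply: le_trans lo; rewrite ler_pM2l // exprS ler_peMr //.
  by rewrite exprn_ege1.
have Z0 : 0 <= Z by apply: le_trans Zq; rewrite mulr_ge0 // ltW.
rewrite -ler_sqr ?nnegrE ?normr_ge0 //; last by rewrite mulr_ge0 // ltW.
rewrite real_normK ?num_real //; apply: le_trans dec _.
rewrite exprMn (expr2 Z) mulrA ler_wpM2r //.
have sq : Num.sqrt q * Num.sqrt q = q by rewrite -expr2 sqr_sqrtr.
have : C * Num.sqrt q <= eta ^+ 2 * (c * q).
  by rewrite -{2}sq; move: (ler_wpM2r s0 Cle); lra.
move=> h; apply: (le_trans h); rewrite ler_wpM2l // sqr_ge0 //.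
Qed.

(** Here d = e + 3, and B k marks the indices outside A_k. After division by Z_k(1), the left-hand
    side is bounded by a multiple of delta, from the marked indices, plus a multiple of eta, from
    the points other than x_0 and its antipode. *)
Lemma parity_cancel (e j n : nat) (t : 'I_n -> nat -> R) (i0 : 'I_n) (p : bool)
    (S : set nat) (B : nat -> pred (seq int)) (u : 'I_n -> R[i]) :
  (1 <= j <= e.+2)%N ->
  (forall i, angles e.+2 (t i)) ->
  (forall i, i != i0 -> polar_dot (t i) (t i0) e.+2 = -1 \/ -1 < polar_dot (t i) (t i0) e.+2 < 1) ->
  (forall k, S k -> odd k = p) ->
  (forall k a, S k -> a \in taus e.+2 k -> B k a -> a.[# j] != 0) ->
  (forall k a, S k -> a \in taus e.+2 k -> ~~ B k a -> \sum_i u i * Yseq e.+2 a (t i) = 0) ->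
  (forall (delta : R) N, 0 < delta -> exists k, [/\ (N <= k)%N, S k &
     (count (B k) (taus e.+2 k))%:R <= delta * Num.sqrt k.+1%:R ^+ (e.+2 - j)]) ->
  u i0 + (-1) ^+ p * \sum_(i | (i != i0) && (polar_dot (t i) (t i0) e.+2 == -1)) u i = 0.
Proof.
move=> jb; have ej : e.+1 = (j.-1 + (e.+2 - j))%N by move: jb; clear; lia.
move=> ang dich Sp Bj v0 small.
set D := fun i => polar_dot (t i) (t i0) e.+2.
set anti := fun i => (i != i0) && (D i == -1).
set G := (X in X = 0).
pose U : R := \sum_i complex.Re `|u i|.
have UE : \sum_i `|u i| = U%:C.
  by rewrite /U rmorph_sum; apply: eq_bigr => i _; exact: norm_real.
have U0 : 0 <= U by apply: sumr_ge0 => i _; have := normr_ge0 (u i); rewrite norm_real lecR.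
have [C [C0 CP]] : exists C : R, 0 <= C /\ forall i k a, a \in taus e.+2 k -> a.[# j] != 0 ->
    Yseq e.+2 a (t i) * (Yseq e.+2 a (t i))^*%R <= (C * (k.+1%:R ^+ j.-1 * Num.sqrt k.+1%:R ^+ (e.+2 - j)))%:C.
  have /choice[C CP] i : exists C : R, 0 <= C /\ forall k a, a \in taus e.+2 k -> a.[# j] != 0 ->
      Ynorm2 e.+2 a (t i) <= C * (k.+1%:R ^+ j.-1 * Num.sqrt k.+1%:R ^+ (e.+2 - j)).
    by have [C C0 CP] := Ynorm2_bound (ang i) jb; exists C.
  exists (\sum_i C i); split; first by apply: sumr_ge0 => i _; exact: (CP i).1.
  move=> i k a ta ja; rewrite Yseq_normK lecR; apply: le_trans ((CP i).2 k a ta ja) _.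
  apply: ler_wpM2r; first by rewrite mulr_ge0 ?exprn_ge0 ?sqrtr_ge0.
  by rewrite (bigD1 i) //= lerDl sumr_ge0 // => i1 _; exact: (CP i1).1.
have [c c0 cP] := zonal1_bounds R e.+1.
have ker0 := kerC_gt0 R (ltn0Sn e.+1).
have adt k i := addition_theorem k (ang i) (ang i0).
move: (kerC R e.+2) ker0 adt => kap ker0 adt.
have key delta eta : 0 < delta -> 0 < eta ->
    complex.Re `|G| <= U * C / (kap * c) * delta + U * eta.
  move=> delta0 eta0.
  have [N NP] : exists N, forall i k, (N <= k)%N -> -1 < D i < 1 ->
      `|zonal e.+3 k (D i)| <= eta * zonal e.+3 k 1.
    apply: near_all_ord => i.
    case: (boolP (-1 < D i < 1)) => [h|_]; last by exists 0%N.
    by have [N NP] := zonal_ratio_small e h eta0; exists N => k /NP.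
  have [k [Nk Sk cnt]] := small delta N delta0.
  have [lo _] := cP k.
  have Zk0 : 0 < zonal e.+3 k (1 : R).
    by apply: lt_le_trans lo; rewrite mulr_gt0 // exprn_gt0 // ltr0n.
  pose m : R := k.+1%:R ^+ j.-1 * Num.sqrt k.+1%:R ^+ (e.+2 - j).
  have m0 : 0 <= m by rewrite mulr_ge0 ?exprn_ge0 ?sqrtr_ge0.
  pose q : R := (count (B k) (taus e.+2 k))%:R.
  have tot : `|\sum_i u i * (kap * zonal e.+3 k (D i))%:C| <= (q * (U * (C * m)))%:C.
    have := @norm_sum_restrict _ _ (taus e.+2 k) (B k) (fun a i => Yseq e.+2 a (t i)) u i0
      (fun i => kap * zonal e.+3 k (D i)) (C * m) (mulr_ge0 C0 m0)
      (adt k) (fun a => v0 k a Sk)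
      (fun a i ta Ba => CP i k a ta (Bj k a Sk ta Ba)).
    by rewrite UE -realcM -(rmorph_nat (real_complex R)) -realcM.
  have oth : `|\sum_(i | (i != i0) && (D i != -1)) u i * (kap * zonal e.+3 k (D i))%:C| <=
      (U * (kap * (eta * zonal e.+3 k 1)))%:C.
    apply: le_trans (ler_norm_sum _ _ _) _; rewrite realcM -UE mulr_suml.
    rewrite [leRHS](bigID (fun i => (i != i0) && (D i != -1))) /=.
    have pos (i : 'I_n) : 0 <= `|u i| * (kap * (eta * zonal e.+3 k 1))%:C.
      by apply: mulr_ge0 => //; rewrite lecR; exact: (mulr_ge0 (ltW ker0) (mulr_ge0 (ltW eta0) (ltW Zk0))).
    rewrite -[leLHS]addr0; apply: lerD; last by apply: sumr_ge0 => i _; exact: pos.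
    apply: ler_sum => i /andP[ii0 iD]; rewrite normrM ler_wpM2l //.
    rewrite normc_def /= expr0n addr0 sqrtr_sqr lecR normrM (gtr0_norm ker0) ler_pM2l //.
    by apply: NP => //; case: (dich i ii0) => // h; move: iD; rewrite /D h eqxx.
  have split : G * (kap * zonal e.+3 k 1)%:C =
      \sum_i u i * (kap * zonal e.+3 k (D i))%:C -
      \sum_(i | (i != i0) && (D i != -1)) u i * (kap * zonal e.+3 k (D i))%:C.
    rewrite (bigD1 i0) //= [X in _ + X - _](bigID (fun i => D i == -1)) /= addrA addrK.
    rewrite {1}/D polar_dot_self /G mulrDl; congr (_ + _).
    rewrite -mulrA mulr_suml mulr_sumr; apply: eq_bigr => i /andP[_ /eqP Di].
    have -> : zonal e.+3 k (D i) = (-1) ^+ p * zonal e.+3 k 1.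
      by rewrite (Di : D i = -1) zonalN -(Sp k Sk) signr_odd.
    rewrite !realcM rmorphXn rmorphN rmorph1 !mulrA; congr (_ * _).
    by rewrite -[RHS]mulrA mulrCA !mulrA.
  have gle : complex.Re `|G| * (kap * zonal e.+3 k 1) <=
      q * (U * (C * m)) + U * (kap * (eta * zonal e.+3 k 1)).
    rewrite -lecR realcM -norm_real raddfD.
    have -> : (kap * zonal e.+3 k 1)%:C = `|(kap * zonal e.+3 k 1)%:C|.
      by rewrite ger0_norm // lecR; exact: (mulr_ge0 (ltW ker0) (ltW Zk0)).
    by rewrite -normrM split; apply: le_trans (ler_normB _ _) (lerD tot oth).
  (* The count and the pointwise bound each carry sqrt(k+1)^(e+2-j). Their product has exponent (j -
     1) + (e + 2 - j) = e + 1, that of Z_k(1). *)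
  have qm : q * m <= delta / c * zonal e.+3 k 1.
    apply: le_trans (ler_wpM2r m0 cnt) _.
    have -> : delta * Num.sqrt k.+1%:R ^+ (e.+2 - j) * m = delta / c * (c * k.+1%:R ^+ e.+1).
      have k0 : 0 <= k.+1%:R :> R by [].
      have kE : k.+1%:R ^+ e.+1 = k.+1%:R ^+ j.-1 * (Num.sqrt k.+1%:R ^+ (e.+2 - j)) ^+ 2 :> R.
        by rewrite -exprM mulnC exprM sqr_sqrtr // -exprD; congr (_ ^+ _).
      rewrite kE /m; move: (_ ^+ j.-1) (_ ^+ (_ - j)) => r1 r2.
      by field; rewrite gt_eqF.
    by rewrite ler_wpM2l // divr_ge0 // ltW.
  rewrite -(ler_pM2r (mulr_gt0 ker0 Zk0)); apply: le_trans gle _.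
  have -> : (U * C / (kap * c) * delta + U * eta) * (kap * zonal e.+3 k 1) =
      U * C * (delta / c * zonal e.+3 k 1) + U * (kap * (eta * zonal e.+3 k 1)).
    by field; rewrite !gt_eqF.
  rewrite lerD2r (_ : q * _ = U * C * (q * m)); last by ring.
  by rewrite ler_wpM2l // mulr_ge0.
apply/eqP; rewrite -normr_eq0 norm_real.
have g0 : 0 <= complex.Re `|G| by rewrite -lecR -norm_real normr_ge0.
suff : complex.Re `|G| <= 0 by move=> h; rewrite (le_anti (introT andP (conj h g0))).
apply/ler_addgt0Pr => eps eps0; rewrite add0r.
pose M : R := U * C / (kap * c) + U + 1.
have M0 : 0 < M.
  by rewrite /M ltr_wpDl // addr_ge0 // divr_ge0 ?mulr_ge0 // ltW.
apply: le_trans (key (eps / M) (eps / M) _ _) _; rewrite ?divr_gt0 //.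
rewrite -mulrDl mulrA ler_pdivrMr // mulrC ler_wpM2l ?(ltW eps0) //.
by rewrite /M lerDl.
Qed.

End Core.

(** * Counting the missing indices, and the conclusion *)

Lemma infinite_nat_ge (S : set nat) N : infinite_set S -> exists k, (N <= k)%N /\ S k.
Proof.
move=> infS; apply/not_existsP => H; apply: infS.
apply: (sub_finite_set _ (finite_II N)) => k Sk /=.
by rewrite ltnNge; apply/negP => Nk; apply: (H k).
Qed.

Lemma small_count (R : realType) (S : set nat) (f : nat -> nat) (m : nat) (delta : R) (N : nat) :
  infinite_set S ->
  (f k)%:R / k%:R `^ (m%:R / 2) @[k --> within S \oo] --> (0 : R) ->
  0 < delta ->
  exists k, [/\ (N <= k)%N, S k & (f k)%:R <= delta * Num.sqrt k.+1%:R ^+ m].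
Proof.
move=> infS /cvgrPdist_lt lim0 delta0.
have [M _ MP] := lim0 _ delta0.
(* The bound k >= 1 keeps the denominator k^(m/2) positive. *)
have [k [+ Sk]] := infinite_nat_ge (maxn M (maxn N 1)) infS.
rewrite !geq_max => /and3P[Mk Nk k0].
exists k; split => //; have := MP k Mk Sk.
rewrite /= sub0r normrN mulrC (mulrC _ 2^-1) powRrM powR12_sqrt // powR_mulrn ?sqrtr_ge0 //.
have s0 : 0 < Num.sqrt (k%:R : R) by rewrite sqrtr_gt0 ltr0n.
rewrite mulrC ger0_norm ?divr_ge0 ?exprn_ge0 ?sqrtr_ge0 // ltr_pdivrMr ?exprn_gt0 // => /ltW/le_trans; apply.
by rewrite ler_wpM2l ?(ltW delta0) // lerXn2r ?nnegrE ?sqrtr_ge0 // ler_wsqrtr // ler_nat.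
Qed.

(** Turns the cardinal of a set of tuples into a count in the list [taus], over which the addition
    theorem sums. *)
Lemma card_tau_sub d k (B : set (d.-1.-tuple int)) : (3 <= d)%N ->
  #|` fset_set (tau d k `&` B)| = count (fun s => `[< exists2 a, B a & tval a = s >]) (taus d.-1 k).
Proof.
move=> d3.
have fin : finite_set (tau d k `&` B) by apply: sub_finite_set (finite_tau k d3) => a [].
rewrite -size_filter -(size_map (fun a : d.-1.-tuple int => tval a)); apply: perm_size; apply: uniq_perm.
- by rewrite map_inj_uniq ?fset_uniq //; exact: val_inj.
- apply: filter_uniq; have [m ->] : exists m, d.-1 = m.+1 by exists d.-2; lia.
  exact: taus_uniq.
move=> s; rewrite mem_filter; apply/mapP/andP => [[a]|[/asboolP[a Ba <-] ts]].
  rewrite in_fset_set ?inE // => -[ta Ba] ->; split; last exact: (tau_taus k a d3).1.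
  exact: (ex_intro2 _ _ a Ba erefl).
exists a => //; rewrite in_fset_set ?inE //; split => //.
exact: (tau_taus k a d3).2.
Qed.

Section Parity.
Variables (R : realType) (e j : nat) (A : nat -> set (e.+3.-1.-tuple int)).

Lemma harmonics_cancel (S : set nat) (p : bool) n (x : 'I_n -> 'rV[R]_e.+3) (u : 'I_n -> R[i]) i0 :
  (1 <= j <= e.+2)%N ->
  injective x -> (forall i, unit_sphere (x i)) ->
  (forall k, S k -> odd k = p) -> infinite_set S ->
  (forall k, S k -> tau_at e.+3 k j `<=` A k) ->
  #|` fset_set (tau e.+3 k `\` A k)|%:R / k%:R `^ ((e.+3 - j - 1)%:R / 2)
     @[k --> within S \oo] --> (0 : R) ->
  (forall k a, S k -> A k a -> \sum_i u i * Y a (x i) = 0) ->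
  u i0 + (-1) ^+ p * \sum_(i | (i != i0) && (polar_dot (point_angles (x i)) (point_angles (x i0)) e.+2 == -1)) u i = 0.
Proof.
move=> jb inj us Sp infS tauA ratio v0.
apply: (@parity_cancel R e j n (fun i => point_angles (x i)) i0 p S
   (fun k s => `[< exists2 a, (~` A k) a & tval a = s >])) => //.
- by move=> i; exact: point_angles_ok.
(* Distinct unit vectors have inner product below 1. Applied to [x i0] and to its opposite, this
   leaves only -1 or the open interval. *)
- move=> i ii0; rewrite point_angles_dot //.
  have xne : x i != x i0 by apply: contra ii0 => /eqP /inj ->.
  have -> /= := unit_dot (us i) (us i0) xne.
  have [xN|xN] := eqVneq (x i) (- x i0).
    left; rewrite xN; under eq_bigr do rewrite mxE mulNr -expr2.
    by rewrite sumrN (us i0).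
  right; rewrite andbT.
  have uN : unit_sphere (- x i0).
    by rewrite /unit_sphere /=; under eq_bigr do rewrite mxE sqrrN; exact: us.
  have := unit_dot (us i) uN xN.
  have -> : \sum_l x i 0 l * (- x i0) 0 l = - \sum_l x i 0 l * x i0 0 l.
    by rewrite -sumrN; apply: eq_bigr => l _; rewrite [(- x i0) 0 l]mxE mulrN.
  by rewrite ltrNl.
(* An index with a_j = 0 lies in [tau_at], hence in A_k. *)
- move=> k s Sk ts /asboolP[a Aa as_]; apply/negP => /eqP sj; apply: Aa.
  apply: (tauA k Sk); split; last by rewrite as_.
  by apply/(@tau_taus e.+3 k a isT); rewrite as_.
- move=> k s Sk ts /asboolP nB.
  have /eqP sz : size s = e.+2 by have /mem_tausP[] := ts.
  under eq_bigr do rewrite -(@Y_Yseq R e.+1 (Tuple sz)).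
  apply: (v0 k) => //; apply: contrapT => nA; apply: nB.
  by exists (Tuple sz).
- move=> delta N delta0.
  have [k [Nk Sk]] := small_count N infS ratio delta0.
  rewrite setDE card_tau_sub // => le; exists k; split => //.
  by rewrite (_ : (e.+2 - j)%N = (e.+3 - j - 1)%N) //; move: jb; clear; lia.
Qed.

End Parity.

Theorem corollary4p4 (R : realType) (d : nat) (E O : set nat) (j : nat)
    (A : nat -> set (d.-1.-tuple int)) (dcoef : d.-1.-tuple int -> R)
    (K : 'rV[R]_d -> 'rV[R]_d -> R[i]) :
  (3 <= d)%N ->
  E `<=` [set k | ~~ odd k] -> infinite_set E ->
  O `<=` [set k | odd k] -> infinite_set O ->
  (1 <= j <= d.-1)%N ->
  (forall k, (E `|` O) k -> tau_at d k j `<=` A k /\ A k `<=` tau d k) ->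
  (forall k a, (E `|` O) k -> A k a -> 0 < dcoef a) ->
  {within @unit_sphere R d `*` @unit_sphere R d,
    continuous (fun p : 'rV[R]_d * 'rV[R]_d => K p.1 p.2)} ->
  (forall x z, unit_sphere x -> unit_sphere z ->
    series (fun k => if k \in E `|` O
                     then \sum_(a \in A k) (dcoef a)%:C * Y a x * (Y a z)^*%R
                     else 0) @ \oo --> K x z) ->
  (let ratio (k : nat) : R :=
     #|` fset_set (tau d k `\` A k)|%:R / k%:R `^ ((d - j - 1)%:R / 2) in
   ratio k @[k --> within O \oo] --> (0 : R) /\
   ratio k @[k --> within E \oo] --> (0 : R)) ->
  strictly_positive_definite K.
Proof.
case: d A dcoef K => [|[|[|e]]] // A dcoef K _ Eeven infE Oodd infO jb Asub dpos _ Kcvg /= [limO limE] n x inj us.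
apply: (@kernel_posdef R _ _ (E `|` O) A dcoef (fun a z => Y a z) K dpos) => //.
- move=> k Dk; apply: sub_finite_set (finite_tau k (isT : (2 < e.+3)%N)).
  exact: (Asub k Dk).2.
- by move=> i i'; exact: Kcvg.
move=> u v0 i0.
have hE := @harmonics_cancel R e j A E false n x u i0 jb inj us
  (fun k Ek => negbTE (Eeven k Ek)) infE (fun k Ek => (Asub k (or_introl Ek)).1) limE
  (fun k a Ek => v0 k a (or_introl Ek)).
have hO := @harmonics_cancel R e j A O true n x u i0 jb inj us
  (fun k Ok => Oodd k Ok) infO (fun k Ok => (Asub k (or_intror Ok)).1) limO
  (fun k a Ok => v0 k a (or_intror Ok)).
move: hE hO; move: (\sum_(_ | _) _) => anti; rewrite expr0 expr1 mul1r mulN1r => hE hO.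
have : 2 * u i0 = 0 by rewrite -[RHS]addr0 -{2}hO -hE; ring.
by move/eqP; rewrite mulf_eq0 pnatr_eq0 /= => /eqP.
Qed.
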